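(* Let $\Omega=\bigcup_{i=1}^n(\alpha_i,\beta_i)$ with $-\infty<\alpha_1<\beta_1<\alpha_2<\beta_2<\dots<\alpha_n<\beta_n<\infty$. Assume that $\Omega$ is spectral with spectrum $\Lambda$. Then the unitary group $U=U_\Lambda$ associated to $\Lambda$ is a unitary group of local translations on $\Omega$. In addition, if $A$ is the self-adjoint operator associated to $\Lambda$, $$A\left(\sum_{\lambda\in\Lambda}f_\lambda e_\lambda\right)=\sum_{\lambda\in\Lambda}\lambda f_\lambda e_\lambda,\qquad\mathscr D(A)=\left\{\sum_{\lambda\in\Lambda}f_\lambda e_\lambda\in L^2(\Omega):\sum_{\lambda\in\Lambda}|\lambda|^2|f_\lambda|^2<\infty\right\},$$ then $$U(t)=\exp(2\pi itA),\quad t\in\mathbb R.$$ Conversely, if there exists a unitary group of local translations $(U(t))_{t\in\mathbb R}$ for $\Omega$, then $\Omega$ is spectral.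
   Context: For $\lambda\in\mathbb R$, $e_\lambda(x)=e^{2\pi i\lambda x}$. The set $\Omega$ is spectral with spectrum $\Lambda\subset\mathbb R$ if $\{e_\lambda:\lambda\in\Lambda\}$ is an orthogonal basis of $L^2(\Omega)$. The Lebesgue measure on $\Omega$ is renormalized to $\frac1{|\Omega|}dx$, so that the $e_\lambda$ have norm one. The unitary group associated to $\Lambda$ on $L^2(\Omega)$ is $$U_\Lambda(t)\left(\sum_{\lambda\in\Lambda}a_\lambda e_\lambda\right)=\sum_{\lambda\in\Lambda}e^{2\pi i\lambda t}a_\lambda e_\lambda,\quad\text{for }\sum_{\lambda\in\Lambda}a_\lambda e_\lambda\in L^2(\Omega),\ t\in\mathbb R.$$ A unitary group of local translations on $\Omega$ is a strongly continuous one-parameter unitary group $(U(t))_{t\in\mathbb R}$ on $L^2(\Omega)$ such that, for any $f\in L^2(\Omega)$ and any $t\in\mathbb R$, $(U(t)f)(x)=f(x+t)$ for a.e. $x\in\Omega\cap(\Omega-t)$. *)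

(* Defs.v *)
From HB Require Import structures.
From mathcomp Require Import all_boot all_order all_algebra finmap.
From mathcomp Require Import all_classical all_reals all_analysis.
From mathcomp Require Import complex.

Set Implicit Arguments.
Unset Strict Implicit.
Unset Printing Implicit Defensive.

Import Order.TTheory GRing.Theory Num.Theory.
Import numFieldNormedType.Exports.

Local Open Scope classical_set_scope.
Local Open Scope complex_scope.
Local Open Scope ring_scope.

Local Notation Re := complex.Re.
Local Notation Im := complex.Im.

(** * The Hilbert space L^2(Omega)

    The library only has real-valued L^p spaces, so the elements of the complex
    space L^2(Omega) are represented by functions [R -> R[i]] whose real and
    imaginary parts, cut off outside Omega, are in the real L^2(R).  The values
    outside Omega are irrelevant, and two functions represent the same element
    of L^2(Omega) when they satisfy [aeq Omega].  Omega is always meant to be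
    measurable with finite nonzero measure. *)

Definition L2 (R : realType) (Omega : set R) : set (R -> R[i]) :=
  [set f | (((fun x => Re (f x)) \_ Omega : R -> R)
              \in Lfun (@lebesgue_measure R) 2%:E) /\
           (((fun x => Im (f x)) \_ Omega : R -> R)
              \in Lfun (@lebesgue_measure R) 2%:E)].

Definition aeq (R : realType) (Omega : set R) (f g : R -> R[i]) : Prop :=
  {ae @lebesgue_measure R, forall x, Omega x -> f x = g x}.

Definition cintegral (R : realType)
    (mu : {measure set (measurableTypeR R) -> \bar R}) (D : set R)
    (f : R -> R[i]) : R[i] :=
  Complex (\int[mu]_(x in D) Re (f x)) (\int[mu]_(x in D) Im (f x)).

Definition dotp (R : realType) (Omega : set R) (f g : R -> R[i]) : R[i] :=
  ((fine (lebesgue_measure Omega))^-1)%:C *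
  cintegral (@lebesgue_measure R) Omega (fun x => f x * conjc (g x)).

Definition norm2 (R : realType) (Omega : set R) (f : R -> R[i]) : R :=
  Num.sqrt (Re (dotp Omega f f)).

(** * Linear operators on L^2(Omega), possibly unbounded *)

Record op (R : realType) :=
  Op { dom : set (R -> R[i]) ; act : (R -> R[i]) -> (R -> R[i]) }.

Definition total_op (R : realType) (Omega : set R)
    (V : (R -> R[i]) -> (R -> R[i])) : op R := Op (L2 Omega) V.

Record linear_op (R : realType) (Omega : set R) (T : op R) : Prop := LinearOp {
  op_dom : dom T `<=` L2 Omega ;
  op_L2 : forall f, dom T f -> L2 Omega (act T f) ;
  op_aeq : forall f g, dom T f -> L2 Omega g -> aeq Omega f g ->
    dom T g /\ aeq Omega (act T f) (act T g) ;
  op_dom0 : dom T (fun _ => 0) ;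
  op_lin : forall (c : R[i]) f g, dom T f -> dom T g ->
    dom T (fun x => c * f x + g x) /\
    aeq Omega (act T (fun x => c * f x + g x))
              (fun x => c * act T f x + act T g x)
}.

Definition dense_dom (R : realType) (Omega : set R) (T : op R) : Prop :=
  forall f (eps : R), L2 Omega f -> 0 < eps ->
    exists2 g, dom T g & norm2 Omega (fun x => f x - g x) < eps.

(* The right-hand side says that [(g, h)] is in the graph of the adjoint. *)
Definition self_adjoint (R : realType) (Omega : set R) (T : op R) : Prop :=
  [/\ linear_op Omega T, dense_dom Omega T &
   forall g h, L2 Omega g -> L2 Omega h ->
     (dom T g /\ aeq Omega (act T g) h) <->
     (forall f, dom T f -> dotp Omega (act T f) g = dotp Omega f h)].

Definition unitary (R : realType) (Omega : set R)
    (V : (R -> R[i]) -> (R -> R[i])) : Prop :=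
  [/\ linear_op Omega (total_op Omega V),
   forall f g, L2 Omega f -> L2 Omega g ->
     dotp Omega (V f) (V g) = dotp Omega f g &
   forall g, L2 Omega g -> exists2 f, L2 Omega f & aeq Omega (V f) g].

Definition orthogonal_projection (R : realType) (Omega : set R)
    (P : (R -> R[i]) -> (R -> R[i])) : Prop :=
  [/\ linear_op Omega (total_op Omega P),
   forall f, L2 Omega f -> aeq Omega (P (P f)) (P f) &
   forall f g, L2 Omega f -> L2 Omega g ->
     dotp Omega (P f) g = dotp Omega f (P g)].

(** * Functional calculus of an operator with a spectral resolution *)

Record pvm (R : realType) (Omega : set R)
    (E : set R -> (R -> R[i]) -> (R -> R[i])) : Prop := PVM {
  pvm_proj : forall B : set R, measurable B ->
    orthogonal_projection Omega (E B) ;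
  pvm_set0 : forall f, L2 Omega f -> aeq Omega (E set0 f) (fun _ => 0) ;
  pvm_setT : forall f, L2 Omega f -> aeq Omega (E setT f) f ;
  pvm_setI : forall A B : set R, measurable A -> measurable B ->
    forall f, L2 Omega f -> aeq Omega (E (A `&` B) f) (E A (E B f)) ;
  pvm_bigcup : forall B : nat -> set R, (forall k, measurable (B k)) ->
    trivIset setT B -> forall f, L2 Omega f ->
    norm2 Omega (fun x => (\sum_(k < m) E (B k) f x) - E (\bigcup_k B k) f x)
      @[m --> \oo] --> (0 : R)
}.

(* [T] is the integral of [phi] with respect to [E]: its domain consists of the
   [f] for which [phi] is square integrable with respect to the scalar measure
   [mu : B |-> <E(B) f, f>], and [<T f, f>] is then the integral of [phi]
   with respect to [mu].  Since the scalars are complex, this determines the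
   linear operator [T]. *)
Definition spectral_integral (R : realType) (Omega : set R)
    (E : set R -> (R -> R[i]) -> (R -> R[i])) (phi : R -> R[i]) (T : op R) :
    Prop :=
  linear_op Omega T /\
  forall f, L2 Omega f ->
    exists mu : {measure set (measurableTypeR R) -> \bar R},
    [/\ forall B : set R, measurable B ->
          mu B = (Re (dotp Omega (E B f) f))%:E,
        dom T f <-> (\int[mu]_x ((Re (phi x)) ^+ 2 + (Im (phi x)) ^+ 2)%:E
                     < +oo)%E &
        dom T f -> dotp Omega (act T f) f = cintegral mu setT phi].

(* [T = phi(A)], where [A] is the integral of the identity with respect to its
   spectral resolution [E]. *)
Definition functional_calculus (R : realType) (Omega : set R) (A : op R)
    (phi : R -> R[i]) (T : op R) : Prop :=
  exists E, [/\ pvm Omega E, spectral_integral Omega E (fun x => x%:C) A &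
                spectral_integral Omega E phi T].

Definition expi (R : realType) (x : R) : R[i] := Complex (cos x) (sin x).

(* [V = exp(2 pi i t A)] *)
Definition is_exp_2pii (R : realType) (Omega : set R) (t : R) (A : op R)
    (V : (R -> R[i]) -> (R -> R[i])) : Prop :=
  functional_calculus Omega A (fun x => expi (2 * pi * t * x))
    (total_op Omega V).

(** * Spectral sets *)

Definition e_ (R : realType) (l : R) : R -> R[i] := fun x => expi (2 * pi * l * x).

(* [f] is the sum in [L2 Omega] of the [a l *: e_ l] for [l] in [Lambda], that
   is, the limit of the partial sums along the finite subsets of [Lambda]. *)
Definition has_expansion (R : realType) (Omega Lambda : set R) (a : R -> R[i])
    (f : R -> R[i]) : Prop :=
  L2 Omega f /\
  forall eps : R, 0 < eps -> exists2 F0 : {fset R}, [set` F0] `<=` Lambda &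
    forall F : {fset R}, [set` F0] `<=` [set` F] -> [set` F] `<=` Lambda ->
      norm2 Omega (fun x => f x - \sum_(l <- F) a l * e_ l x) < eps.

Definition is_spectrum (R : realType) (Omega Lambda : set R) : Prop :=
  (forall l m, Lambda l -> Lambda m -> l <> m ->
     dotp Omega (e_ l) (e_ m) = 0) /\
  (forall f, L2 Omega f -> exists a, has_expansion Omega Lambda a f).

Definition spectral (R : realType) (Omega : set R) : Prop :=
  exists Lambda, is_spectrum Omega Lambda.

(* [sum a_l e_l |-> sum m_l a_l e_l]; [0] is only a default value for the [f]
   on which this is not defined. *)
Definition multiplier (R : realType) (Omega Lambda : set R) (m : R -> R[i])
    (f : R -> R[i]) : R -> R[i] :=
  xget (fun _ => 0)
    [set g | exists2 a, has_expansion Omega Lambda a f &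
                        has_expansion Omega Lambda (fun l => m l * a l) g].

Definition spectrum_group (R : realType) (Omega Lambda : set R) (t : R) :
    (R -> R[i]) -> (R -> R[i]) :=
  multiplier Omega Lambda (fun l => expi (2 * pi * l * t)).

Definition spectrum_op (R : realType) (Omega Lambda : set R) : op R :=
  Op [set f | exists2 a, has_expansion Omega Lambda a f &
        (\esum_(l in Lambda)
           (l ^+ 2 * ((Re (a l)) ^+ 2 + (Im (a l)) ^+ 2))%:E < +oo)%E]
     (multiplier Omega Lambda (fun l => l%:C)).

(** * Unitary groups of local translations *)

Record unitary_group (R : realType) (Omega : set R)
    (U : R -> (R -> R[i]) -> (R -> R[i])) : Prop := UnitaryGroup {
  ug_unitary : forall t, unitary Omega (U t) ;
  ug_0 : forall f, L2 Omega f -> aeq Omega (U 0 f) f ;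
  ug_add : forall s t f, L2 Omega f -> aeq Omega (U (s + t) f) (U s (U t f)) ;
  ug_cont : forall f (t0 : R), L2 Omega f ->
    norm2 Omega (fun x => U t f x - U t0 f x) @[t --> t0] --> (0 : R)
}.

Definition local_translations (R : realType) (Omega : set R)
    (U : R -> (R -> R[i]) -> (R -> R[i])) : Prop :=
  unitary_group Omega U /\
  forall f (t : R), L2 Omega f ->
    {ae @lebesgue_measure R, forall x, (Omega `&` [set y | Omega (y + t)]) x ->
       U t f x = f (x + t)}.

(* Main.v *)
(** On finite sums of exponentials [U_Lambda(t)] is the translation by [t], and
    both sides are continuous in [L^2], so [U_Lambda] acts by local translations.
    The spectral resolution of [A] is the projection onto the closed span of the
    [e_lambda] with [lambda] in a given Borel set.

    For the converse, slicing the double integral of [|g(x) - g(y)|^2] over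
    [D x D] along [y = x + t] bounds the variance of [g] on [D] by the
    increments of [g] under the translations which stay in [D].  Applied to
    short intervals this is a Poincare inequality: the vectors with
    [|U(t)f - f| <= C |t|] are, up to a small error, controlled by finitely many
    coordinates.  Minimizing the energy on a closed [U]-invariant subspace then
    gives an eigenvector of [U] in every nonzero such subspace.  If
    [U(t)v = e^(i sigma t) v], the product of [v] with the conjugate of
    [e^(i sigma x)] is invariant under all translations inside [Omega], across
    the gaps too, and the same variance bound on [D = Omega] shows that it is
    constant.  Thus every eigenvector is an exponential; the exponentials
    obtained are orthogonal, and the orthogonal complement of their span is
    invariant without eigenvectors, hence zero. *)

Require Import Defs.
From HB Require Import structures.
From mathcomp Require Import all_boot all_order all_algebra finmap.
From mathcomp Require Import all_classical all_reals all_analysis.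
From mathcomp Require Import measurable_realfun complex ring lra.

Set Implicit Arguments.
Unset Strict Implicit.
Unset Printing Implicit Defensive.

Import Order.TTheory GRing.Theory Num.Theory.
Import numFieldNormedType.Exports.

Local Open Scope classical_set_scope.
Local Open Scope complex_scope.
Local Open Scope ring_scope.

Local Notation Re := complex.Re.
Local Notation Im := complex.Im.
Local Notation "z ^*" := (conjc z) : ring_scope.

(** The generator of [U] enters the converse only through the dyadic difference quotients
    [dquot U k f]. Halving the step never decreases their norm, so the energy of [f] is the supremum
    over [k] of [nsq (dquot U k f)], and bounds valid for every [k] replace statements about the
    generator. Limits are taken along one ultrafilter [F] finer than [\oo]: bounded scalars converge
    along it, and the Poincare inequality upgrades convergence of finitely many coordinates to
    convergence in norm, with no extraction of subsequences. Why minimizing yields an eigenvector: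
    by the parallelogram law the minimizers form a subspace, stable under the limit D of the
    difference quotients. There D is skew and multiplies squared norms by the minimum m, so the
    equality case of Cauchy-Schwarz forces D^2 = - m, which factors as (D - i sqrt m) (D + i sqrt m)
    = 0. In the direct half, [U_Lambda], [A] and the spectral projections are all instances of the
    coefficientwise relation [mulrel]. *)

Section complex_numbers.
Variable R : realType.
Implicit Types (x y : R) (z w : R[i]).

Lemma ReD z w : Re (z + w) = Re z + Re w. Proof. by case: z; case: w. Qed.
Lemma ImD z w : Im (z + w) = Im z + Im w. Proof. by case: z; case: w. Qed.
Lemma ReN z : Re (- z) = - Re z. Proof. by case: z. Qed.
Lemma ImN z : Im (- z) = - Im z. Proof. by case: z. Qed.
Lemma ReB z w : Re (z - w) = Re z - Re w. Proof. by rewrite ReD ReN. Qed.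
Lemma ImB z w : Im (z - w) = Im z - Im w. Proof. by rewrite ImD ImN. Qed.
Lemma ReM z w : Re (z * w) = Re z * Re w - Im z * Im w.
Proof. by case: z; case: w. Qed.
Lemma ImM z w : Im (z * w) = Re z * Im w + Im z * Re w.
Proof. by case: z; case: w. Qed.
Lemma ReJ z : Re z^* = Re z. Proof. by case: z. Qed.
Lemma ImJ z : Im z^* = - Im z. Proof. by case: z. Qed.

Lemma conjcD z w : (z + w)^* = z^* + w^*. Proof. exact: rmorphD. Qed.
Lemma conjcN z : (- z)^* = - z^*. Proof. exact: rmorphN. Qed.
Lemma conjcM z w : (z * w)^* = z^* * w^*. Proof. exact: rmorphM. Qed.

Lemma complex_eqP z w : Re z = Re w -> Im z = Im w -> z = w.
Proof. by case: z; case: w => a b c d /= -> ->. Qed.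

Lemma Re_sum (I : Type) (r : seq I) (P : pred I) (F : I -> R[i]) :
  Re (\sum_(i <- r | P i) F i) = \sum_(i <- r | P i) Re (F i).
Proof. by elim/big_rec2: _ => // i x y _ <-; rewrite ReD. Qed.

(** The squared modulus as a real number; the norm of [R[i]] takes its values in [R[i]]. *)
Definition sqn z : R := Re z ^+ 2 + Im z ^+ 2.

Lemma sqn_ge0 z : 0 <= sqn z. Proof. by rewrite addr_ge0 ?sqr_ge0. Qed.

Lemma sqnM z w : sqn (z * w) = sqn z * sqn w.
Proof. rewrite /sqn ReM ImM; ring. Qed.

Lemma sqnJ z : sqn z^* = sqn z.
Proof. by rewrite /sqn ReJ ImJ sqrrN. Qed.

Lemma sqnN z : sqn (- z) = sqn z.
Proof. by rewrite /sqn ReN ImN !sqrrN. Qed.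

Lemma sqnR x : sqn x%:C = x ^+ 2.
Proof. by rewrite /sqn /= expr0n addr0. Qed.

Lemma sqn0 : sqn 0 = 0. Proof. by rewrite (sqnR 0) expr0n. Qed.
Lemma sqn1 : sqn 1 = 1. Proof. by rewrite (sqnR 1) expr1n. Qed.

Lemma sqn_eq0 z : sqn z = 0 -> z = 0.
Proof.
move=> /eqP; rewrite paddr_eq0 ?sqr_ge0 // !sqrf_eq0 => /andP[/eqP h /eqP k].
exact: complex_eqP.
Qed.

Lemma sqnD z w : sqn (z + w) <= 2 * sqn z + 2 * sqn w.
Proof.
rewrite /sqn ReD ImD; have := sqr_ge0 (Re z - Re w).
have := sqr_ge0 (Im z - Im w); nra.
Qed.

Lemma mul_conjc z : z * z^* = (sqn z)%:C.
Proof. by apply: complex_eqP; rewrite ?ReM ?ImM ReJ ImJ /sqn /=; ring. Qed.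

Lemma Re_le_sqn z : Re z ^+ 2 <= sqn z.
Proof. by rewrite lerDl sqr_ge0. Qed.

Lemma Im_le_sqn z : Im z ^+ 2 <= sqn z.
Proof. by rewrite lerDr sqr_ge0. Qed.

Lemma cvg_sqn0 (T : Type) (F : set_system T) (FF : Filter F) (f : T -> R[i]) :
  Re (f x) @[x --> F] --> (0 : R) -> Im (f x) @[x --> F] --> (0 : R) ->
  sqn (f x) @[x --> F] --> (0 : R).
Proof.
move=> h k; have := cvgD (cvgM h h) (cvgM k k).
by rewrite mulr0 addr0 => hk; exact: hk.
Qed.

Lemma cvg0D (T : Type) (F : set_system T) (FF : Filter F) (f g : T -> R) :
  f x @[x --> F] --> (0 : R) -> g x @[x --> F] --> (0 : R) ->
  f x + g x @[x --> F] --> (0 : R).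
Proof. by move=> h k; have := cvgD h k; rewrite addr0; apply. Qed.

Lemma cvg0Ml (T : Type) (F : set_system T) (FF : Filter F) (f : T -> R) (a : R) :
  f x @[x --> F] --> (0 : R) -> f x * a @[x --> F] --> (0 : R).
Proof. by move=> h; have := cvgM h (cvg_cst a); rewrite mul0r; apply. Qed.

Lemma cvg_sqrt0 (T : Type) (F : set_system T) (FF : Filter F) (f : T -> R) :
  f x @[x --> F] --> (0 : R) -> Num.sqrt (f x) @[x --> F] --> (0 : R).
Proof.
move=> h; rewrite -[0 in X in _ --> X](@sqrtr0 R).
exact: (continuous_cvg _ (@sqrt_continuous R 0) h).
Qed.

Lemma expi0 : expi (0 : R) = 1.
Proof. by apply: complex_eqP; rewrite /= ?cos0 ?sin0. Qed.

Lemma expiD x y : expi (x + y) = expi x * expi y.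
Proof.
by apply: complex_eqP; rewrite ?ReM ?ImM /= ?cosD ?sinD // addrC [X in X + _]mulrC mulrC.
Qed.

Lemma sqn_expi x : sqn (expi x) = 1.
Proof. exact: cos2Dsin2. Qed.

Lemma conj_expi x : (expi x)^* = expi (- x).
Proof. by apply: complex_eqP; rewrite /= ?cosN ?sinN. Qed.

Lemma expiN x : expi (- x) * expi x = 1.
Proof. by rewrite -expiD addNr expi0. Qed.

Lemma expi_pi : expi (pi : R) = -1.
Proof. by apply: complex_eqP; rewrite /= ?cospi ?sinpi ?oppr0. Qed.

Lemma cvg_expi x : sqn (expi y - expi x) @[y --> x] --> (0 : R).
Proof.
apply: cvg_sqn0.
  have /cvgB /(_ (cvg_cst (cos x))) := @continuous_cos R x.
  by rewrite subrr; apply.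
have /cvgB /(_ (cvg_cst (sin x))) := @continuous_sin R x.
by rewrite subrr; apply.
Qed.

End complex_numbers.

(** Completeness is phrased with sequences and squared norms, so that an instance needs no topology
    on [H]. *)
HB.mixin Record Lmodule_isHilbert (R : realType) H of GRing.Lmodule R[i] H := {
  dot : H -> H -> R[i];
  dotPl : forall (c : R[i]) f g h, dot (c *: f + g) h = c * dot f h + dot g h;
  dotJ : forall f g, dot g f = (dot f g)^*;
  dot_ge0 : forall f, 0 <= Re (dot f f);
  dot_def : forall f, Re (dot f f) = 0 -> f = 0;
  dot_complete : forall u : nat -> H,
    (forall eps, 0 < eps -> exists N, forall m n, (N <= m)%N -> (N <= n)%N ->
       Re (dot (u m - u n) (u m - u n)) < eps) ->
    exists l, forall eps, 0 < eps -> exists N, forall n, (N <= n)%N ->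
       Re (dot (u n - l) (u n - l)) < eps
}.
HB.structure Definition Hilbert (R : realType) :=
  {H of GRing.Lmodule R[i] H & Lmodule_isHilbert R H}.

(** * Geometry and norm convergence in a complex Hilbert space *)

Section hilbert_geometry.
Variables (R : realType) (H : Hilbert.type R).
Implicit Types (f g h : H) (c : R[i]).

Definition nsq f : R := Re (dot f f).
Definition nrm f : R := Num.sqrt (nsq f).

Lemma dot0l g : dot (0 : H) g = 0.
Proof.
have /eqP := dotPl 1 (0 : H) 0 g.
by rewrite scaler0 addr0 mul1r -subr_eq0 opprD addrA subrr add0r oppr_eq0 => /eqP.
Qed.

Lemma dotDl f g h : dot (f + g) h = dot f h + dot g h.
Proof. by have := dotPl 1 f g h; rewrite scale1r mul1r. Qed.

Lemma dotZl c f h : dot (c *: f) h = c * dot f h.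
Proof. by have := dotPl c f 0 h; rewrite !addr0 dot0l addr0. Qed.

Lemma dotDr f g h : dot h (f + g) = dot h f + dot h g.
Proof. by rewrite dotJ dotDl conjcD -!dotJ. Qed.

Lemma dotZr c f h : dot h (c *: f) = c^* * dot h f.
Proof. by rewrite dotJ dotZl conjcM -dotJ. Qed.

Lemma dot0r g : dot g (0 : H) = 0.
Proof. by rewrite dotJ dot0l conjc0. Qed.

Lemma dotNl f g : dot (- f) g = - dot f g.
Proof. by rewrite -scaleN1r dotZl mulN1r. Qed.

Lemma dotNr f g : dot f (- g) = - dot f g.
Proof. by rewrite dotJ dotNl conjcN -dotJ. Qed.

Lemma dotBl f g h : dot (f - g) h = dot f h - dot g h.
Proof. by rewrite dotDl dotNl. Qed.

Lemma dotBr f g h : dot h (f - g) = dot h f - dot h g.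
Proof. by rewrite dotDr dotNr. Qed.

Lemma dot_suml (I : Type) (r : seq I) (P : pred I) (F : I -> H) g :
  dot (\sum_(i <- r | P i) F i) g = \sum_(i <- r | P i) dot (F i) g.
Proof.
elim/big_rec2: _ => [|i x y _ <-]; by rewrite ?dot0l // dotDl.
Qed.

Lemma dot_sumr (I : Type) (r : seq I) (P : pred I) (F : I -> H) g :
  dot g (\sum_(i <- r | P i) F i) = \sum_(i <- r | P i) dot g (F i).
Proof.
elim/big_rec2: _ => [|i x y _ <-]; by rewrite ?dot0r // dotDr.
Qed.

Lemma dotff f : dot f f = (nsq f)%:C.
Proof.
apply: complex_eqP => //=; have := congr1 (@complex.Im R) (dotJ f f).
rewrite ImJ; lra.
Qed.

Lemma Re_dotC f g : Re (dot g f) = Re (dot f g).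
Proof. by rewrite dotJ ReJ. Qed.

Lemma nsq_ge0 f : 0 <= nsq f. Proof. exact: dot_ge0. Qed.
Lemma nsq0 : nsq 0 = 0. Proof. by rewrite /nsq dot0l. Qed.

Lemma nsqD f g : nsq (f + g) = nsq f + 2 * Re (dot f g) + nsq g.
Proof. rewrite /nsq dotDl !dotDr !ReD (Re_dotC f g); ring. Qed.

Lemma nsqZ c f : nsq (c *: f) = sqn c * nsq f.
Proof.
by rewrite /nsq dotZl dotZr mulrA mul_conjc dotff ReM /= mul0r subr0.
Qed.

Lemma nsqN f : nsq (- f) = nsq f.
Proof. by rewrite -scaleN1r nsqZ sqnN sqn1 mul1r. Qed.

Lemma nsqC f g : nsq (f - g) = nsq (g - f).
Proof. by rewrite -nsqN opprB. Qed.

Lemma nsqB f g : nsq (f - g) = nsq f - 2 * Re (dot f g) + nsq g.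
Proof. by rewrite nsqD nsqN dotNr ReN mulrN. Qed.

Lemma parallelogram f g : nsq (f + g) + nsq (f - g) = 2 * nsq f + 2 * nsq g.
Proof. rewrite nsqD nsqB; ring. Qed.

Lemma nsqD_le f g : nsq (f + g) <= 2 * nsq f + 2 * nsq g.
Proof. by rewrite -parallelogram lerDl nsq_ge0. Qed.

Lemma cauchy_schwarz f g : sqn (dot f g) <= nsq f * nsq g.
Proof.
have [g0|g0] := eqVneq (nsq g) 0.
  by rewrite (dot_def _ g0) dot0r sqn0 nsq0 mulr0.
have gp : 0 < nsq g by rewrite lt_def g0 nsq_ge0.
set c := dot f g; set k := (nsq g)^-1.
(* [c * k] is the coefficient of the projection of [f] on [g]; the inequality says that the residual
   has a nonnegative squared norm. *)
have := nsq_ge0 (f - (c * k%:C) *: g).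
rewrite nsqB nsqZ dotZr conjcM sqnM sqnR conjc_real.
have -> : c^* * k%:C * dot f g = (k * sqn c)%:C.
  by rewrite mulrAC [c^* * _]mulrC mul_conjc rmorphM mulrC.
rewrite /= => h.
have {h} : 0 <= nsq f - k * sqn c.
  move: h; have -> : sqn c * k ^+ 2 * nsq g = k * sqn c.
    by rewrite /k; field; rewrite gt_eqF.
  lra.
by rewrite subr_ge0 /k mulrC ler_pdivrMr.
Qed.

Lemma nrm_ge0 f : 0 <= nrm f. Proof. exact: sqrtr_ge0. Qed.
Lemma nrm0 : nrm 0 = 0. Proof. by rewrite /nrm nsq0 sqrtr0. Qed.

Lemma nrm_sqr f : nrm f ^+ 2 = nsq f.
Proof. by rewrite sqr_sqrtr ?nsq_ge0. Qed.

Lemma nrm_eq0 f : nrm f = 0 -> f = 0.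
Proof. by move=> h; apply: dot_def; rewrite -/(nsq f) -nrm_sqr h expr0n. Qed.

Lemma nrmN f : nrm (- f) = nrm f. Proof. by rewrite /nrm nsqN. Qed.
Lemma nrmC f g : nrm (f - g) = nrm (g - f). Proof. by rewrite /nrm nsqC. Qed.

Lemma nrmZ c f : nrm (c *: f) = Num.sqrt (sqn c) * nrm f.
Proof. by rewrite /nrm nsqZ sqrtrM ?sqn_ge0. Qed.

Lemma nrmZR (x : R) f : nrm (x%:C *: f) = `|x| * nrm f.
Proof. by rewrite nrmZ sqnR sqrtr_sqr. Qed.

Lemma nrm_le f (x : R) : 0 <= x -> (nrm f <= x) = (nsq f <= x ^+ 2).
Proof. by move=> x0; rewrite -nrm_sqr ler_pXn2r// nnegrE ?nrm_ge0. Qed.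

Lemma nrm_lt f (x : R) : 0 <= x -> (nrm f < x) = (nsq f < x ^+ 2).
Proof. by move=> x0; rewrite -nrm_sqr ltr_pXn2r// nnegrE ?nrm_ge0. Qed.

Lemma ler_nrm f g : (nrm f <= nrm g) = (nsq f <= nsq g).
Proof. by rewrite nrm_le ?nrm_ge0// nrm_sqr. Qed.

Lemma Re_dot_le f g : Re (dot f g) <= nrm f * nrm g.
Proof.
rewrite (le_trans (ler_norm _))// -(@ler_pXn2r _ 2)// ?nnegrE ?mulr_ge0 ?nrm_ge0//.
by rewrite real_normK ?num_real// exprMn !nrm_sqr (le_trans (Re_le_sqn _))// cauchy_schwarz.
Qed.

Lemma nrmD f g : nrm (f + g) <= nrm f + nrm g.
Proof.
rewrite nrm_le ?addr_ge0 ?nrm_ge0// nsqD sqrrD !nrm_sqr lerD2r lerD2l.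
by have := Re_dot_le f g; lra.
Qed.

Lemma nrmB f g : nrm (f - g) <= nrm f + nrm g.
Proof. by rewrite -[nrm g]nrmN nrmD. Qed.

Lemma nrm_triangle g f h : nrm (f - h) <= nrm (f - g) + nrm (g - h).
Proof. by rewrite -{1}[f](subrK g) -addrA nrmD. Qed.

Definition hcvg (T : Type) (F : set_system T) (u : T -> H) (l : H) :=
  nrm (u x - l) @[x --> F] --> (0 : R).

Section convergence.
Context {T : Type} {F : set_system T} {FF : Filter F}.
Implicit Types (u v : T -> H).

Lemma hcvgP u l :
  hcvg F u l <-> forall eps, 0 < eps -> \forall x \near F, nrm (u x - l) < eps.
Proof.
split => [/cvgr0Pnorm_lt h e e0|h].
  by near do rewrite -[nrm _]ger0_norm ?nrm_ge0//; exact: h.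
apply/cvgr0Pnorm_lt => e e0; near do rewrite ger0_norm ?nrm_ge0//; exact: h.
Unshelve. all: by end_near. Qed.

Lemma hcvg_le (a : T -> R) u l : (forall x, nrm (u x - l) <= a x) ->
  a x @[x --> F] --> (0 : R) -> hcvg F u l.
Proof.
move=> h a0; apply: (@squeeze_cvgr _ _ _ _ (fun=> 0) a) => //; last exact: cvg_cst.
by near=> x; rewrite nrm_ge0 h.
Unshelve. all: by end_near. Qed.

Lemma hcvg_cst l : hcvg F (fun=> l) l.
Proof. by rewrite /hcvg subrr nrm0; exact: cvg_cst. Qed.

Lemma hcvgD u v l m : hcvg F u l -> hcvg F v m -> hcvg F (fun x => u x + v x) (l + m).
Proof.
move=> ul vm; apply: (@hcvg_le (fun x => nrm (u x - l) + nrm (v x - m))).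
  by move=> x; rewrite opprD addrACA nrmD.
by rewrite -[0](addr0 0); apply: cvgD.
Qed.

Lemma hcvgZ c u l : hcvg F u l -> hcvg F (fun x => c *: u x) (c *: l).
Proof.
move=> ul; apply: (@hcvg_le (fun x => Num.sqrt (sqn c) * nrm (u x - l))).
  by move=> x; rewrite -scalerBr nrmZ.
by rewrite -[0](mulr0 (Num.sqrt (sqn c))); apply: cvgMr.
Qed.

Lemma hcvgN u l : hcvg F u l -> hcvg F (fun x => - u x) (- l).
Proof. by move=> ul; rewrite /hcvg; under eq_fun do rewrite -opprD nrmN. Qed.

Lemma hcvgB u v l m : hcvg F u l -> hcvg F v m -> hcvg F (fun x => u x - v x) (l - m).
Proof. by move=> ul vm; apply: hcvgD => //; exact: hcvgN. Qed.

Lemma hcvg_nrm u l : hcvg F u l -> nrm (u x) @[x --> F] --> nrm l.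
Proof.
move=> ul; apply/cvgrPdist_lt => e e0.
move/hcvgP : ul => /(_ e e0); apply: filterS => x; apply: le_lt_trans.
have := nrmD (u x - l) l; have := nrmD (l - u x) (u x).
by rewrite !subrK (nrmC l) ler_norml; lra.
Qed.

Lemma hcvg_nsq u l : hcvg F u l -> nsq (u x) @[x --> F] --> nsq l.
Proof.
move=> /hcvg_nrm ul; rewrite -nrm_sqr; under eq_fun do rewrite -nrm_sqr.
by rewrite expr2; under eq_fun do rewrite expr2; apply: cvgM.
Qed.

(** Polarization reduces the continuity of the inner product to that of [nsq]. *)
Lemma hcvg_dotl u l g : hcvg F u l -> Re (dot (u x) g) @[x --> F] --> Re (dot l g).
Proof.
move=> ul.
have E f : Re (dot f g) = 4^-1 * (nsq (f + g) - nsq (f - g)).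
  by rewrite nsqD nsqB; lra.
rewrite E; under eq_fun do rewrite E.
apply: cvgMr; apply: cvgB; apply: hcvg_nsq.
  by apply: hcvgD => //; exact: hcvg_cst.
by apply: hcvgB => //; exact: hcvg_cst.
Qed.

Lemma hcvg_dotl_Im u l g : hcvg F u l -> Im (dot (u x) g) @[x --> F] --> Im (dot l g).
Proof.
move=> ul; have E f : Im (dot f g) = Re (dot ((- 'i) *: f) g).
  by rewrite dotZl ReM /=; ring.
by rewrite E; under eq_fun do rewrite E; apply: hcvg_dotl; apply: hcvgZ.
Qed.

End convergence.

Lemma hcvg_nrm_le (T : Type) (F : set_system T) {FF : ProperFilter F}
    (u : T -> H) l (C : R) :
  hcvg F u l -> (\forall x \near F, nrm (u x) <= C) -> nrm l <= C.
Proof.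
move=> ul uC; apply/ler_addgt0Pr => eps e0.
move/hcvgP : ul => /(_ _ e0) ul; have [x [ux Cx]] := filter_ex (filterI ul uC).
by have := nrmD (l - u x) (u x); rewrite subrK nrmC; lra.
Qed.

Lemma hcomplete (u : nat -> H) :
  (forall eps, 0 < eps -> exists N, forall m n, (N <= m)%N -> (N <= n)%N ->
     nrm (u m - u n) < eps) -> exists l, hcvg \oo u l.
Proof.
move=> h; have [e e0|l ul] := @dot_complete R H u.
  have [|N hN] := h (Num.sqrt e); first by rewrite sqrtr_gt0.
  exists N => m n Nm Nn; have := hN m n Nm Nn.
  by rewrite nrm_lt ?sqrtr_ge0// sqr_sqrtr ?ltW.
exists l; apply/hcvgP => e e0; have [|N hN] := ul (e ^+ 2); first exact: exprn_gt0.
by exists N => // n /= /hN; rewrite nrm_lt// ltW.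
Qed.

End hilbert_geometry.

(** * Expansions in an orthonormal family *)

Section orthonormal.
Variables (R : realType) (H : Hilbert.type R) (I : choiceType).
Variables (L : set I) (e : I -> H).
Hypothesis ort : forall l m, L l -> L m -> dot (e l) (e m) = (l == m)%:R.
Implicit Types (f g h : H) (a b : I -> R[i]) (F G : {fset I}).

Definition psum b F : H := \sum_(l <- F) b l *: e l.

(** The abstract form of [has_expansion]: convergence along the finite subsets of [L], since [L]
    comes with no enumeration. *)
Definition hexp b f := forall eps, 0 < eps ->
  exists2 F0 : {fset I}, [set` F0] `<=` L &
    forall F : {fset I}, [set` F0] `<=` [set` F] -> [set` F] `<=` L ->
      nrm (f - psum b F) < eps.

(** The form of completeness that the converse delivers; [total_hexp] and [hexp_total] exchange it
    for the existence of expansions. *)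
Definition total := forall f, (forall l, L l -> dot f (e l) = 0) -> f = 0.

Lemma dot_psum b F g : dot (psum b F) g = \sum_(l <- F) b l * dot (e l) g.
Proof. by rewrite dot_suml; apply: eq_bigr => l _; rewrite dotZl. Qed.

Lemma dot_psum_e b F l : [set` F] `<=` L -> L l ->
  dot (psum b F) (e l) = if l \in F then b l else 0.
Proof.
move=> FL Ll; rewrite dot_psum; case: ifPn => lF.
  rewrite (bigD1_seq l) ?fset_uniq//= ort// eqxx mulr1 big_seq_cond big1 ?addr0// => m.
  by case/andP => mF ml; rewrite ort//; [rewrite (negbTE ml) mulr0|exact: FL].
rewrite big_seq_cond big1// => m /[!andbT] mF; rewrite ort//; last exact: FL.
by rewrite [m == l](_ : _ = false) ?mulr0//; apply: contraNF lF => /eqP <-.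
Qed.

Lemma dot_psumr b F g : [set` F] `<=` L ->
  dot g (psum b F) = \sum_(l <- F) (b l)^* * dot g (e l).
Proof. by move=> FL; rewrite dot_sumr; apply: eq_bigr => l _; rewrite dotZr. Qed.

Lemma Re_sqn_sum b F : Re (\sum_(l <- F) (b l)^* * b l) = \sum_(l <- F) sqn (b l).
Proof. by rewrite Re_sum; apply: eq_bigr => l _; rewrite mulrC mul_conjc. Qed.

Lemma dot_psum_sub b F G : [set` F] `<=` [set` G] -> [set` G] `<=` L ->
  Re (dot (psum b G) (psum b F)) = \sum_(l <- F) sqn (b l).
Proof.
move=> FG GL; rewrite dot_psumr; last exact: subset_trans GL.
rewrite -Re_sqn_sum; congr Re; rewrite big_seq [RHS]big_seq; apply: eq_bigr => l lF.
rewrite dot_psum_e//; last by apply: GL; exact: FG.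
by rewrite (FG l lF : l \in G).
Qed.

Lemma nsq_psum b F : [set` F] `<=` L -> nsq (psum b F) = \sum_(l <- F) sqn (b l).
Proof. by move=> FL; rewrite /nsq dot_psum_sub. Qed.

Lemma nsq_psumB b F G : [set` F] `<=` [set` G] -> [set` G] `<=` L ->
  nsq (psum b G - psum b F) = \sum_(l <- G) sqn (b l) - \sum_(l <- F) sqn (b l).
Proof.
move=> FG GL; rewrite nsqB dot_psum_sub// !nsq_psum//; last exact: subset_trans GL.
ring.
Qed.

Lemma nsq_bessel f F : [set` F] `<=` L ->
  nsq (f - psum (fun l => dot f (e l)) F) = nsq f - \sum_(l <- F) sqn (dot f (e l)).
Proof.
move=> FL; rewrite nsqB nsq_psum// dot_psumr// Re_sqn_sum; ring.
Qed.

Lemma bessel f F : [set` F] `<=` L -> \sum_(l <- F) sqn (dot f (e l)) <= nsq f.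
Proof. by move=> FL; rewrite -subr_ge0 -nsq_bessel// nsq_ge0. Qed.

Lemma nsq_e l : L l -> nsq (e l) = 1.
Proof. by move=> Ll; rewrite /nsq ort// eqxx. Qed.

Lemma sqn_dot_e f l : L l -> sqn (dot f (e l)) <= nsq f.
Proof. by move=> Ll; have := cauchy_schwarz f (e l); rewrite nsq_e// mulr1. Qed.

Lemma hexp_coef b f l : hexp b f -> L l -> dot f (e l) = b l.
Proof.
move=> bf Ll; apply/eqP; rewrite -subr_eq0; apply/eqP/sqn_eq0/eqP.
rewrite eq_le sqn_ge0 andbT; apply/ler_addgt0Pr => eps e0; rewrite add0r.
have [|F0 F0L h] := bf (Num.sqrt eps); first by rewrite sqrtr_gt0.
have UL : [set` (F0 `|` [fset l])%fset] `<=` L.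
  by move=> m /=; rewrite !inE => /orP[/F0L//|/eqP ->].
have {}h : nrm (f - psum b (F0 `|` [fset l])%fset) < Num.sqrt eps.
  by apply: h => // m /= mF; rewrite inE mF.
rewrite nrm_lt ?sqrtr_ge0// sqr_sqrtr ?ltW// in h.
apply: le_trans (ltW h); apply: le_trans (sqn_dot_e _ Ll).
by rewrite dotBl dot_psum_e// !inE eqxx orbT.
Qed.

Lemma hexp_unique b f g : hexp b f -> hexp b g -> f = g.
Proof.
move=> bf bg; apply/eqP; rewrite -subr_eq0; apply/eqP/nrm_eq0/eqP.
rewrite eq_le nrm_ge0 andbT; apply/ler_addgt0Pr => eps e0; rewrite add0r.
have e20 : 0 < eps / 2 by rewrite divr_gt0.
have [F FL hF] := bf _ e20; have [G GL hG] := bg _ e20.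
have UL : [set` (F `|` G)%fset] `<=` L.
  by move=> m /=; rewrite !inE => /orP[/FL|/GL].
have {}hF := hF (F `|` G)%fset _ UL; have {}hG := hG (F `|` G)%fset _ UL.
apply: le_trans (nrm_triangle (psum b (F `|` G)%fset) _ _) _.
rewrite [X in _ + X]nrmC (splitr eps) ltW// ltrD//.
  by apply: hF => m /= mF; rewrite inE mF.
by apply: hG => m /= mF; rewrite inE mF orbT.
Qed.

(** Choose finite sets [F n] whose sums of squares come within [n.+1%:R^-1] of the supremum.
    Whatever a larger finite set adds is orthogonal and hence small, so the partial sums over [F n]
    are Cauchy and their limit has the expansion [b]. *)
Lemma riesz_fischer b (C : R) :
  (forall F, [set` F] `<=` L -> \sum_(l <- F) sqn (b l) <= C) -> exists g, hexp b g.
Proof.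
move=> hC.
pose S := [set \sum_(l <- F) sqn (b l) | F in [set F : {fset I} | [set` F] `<=` L]].
have supS : has_sup S.
  split; first by exists (\sum_(l <- fset0) sqn (b l)); exists fset0 => // m; rewrite /= inE.
  by exists C => _ [F FL <-]; exact: hC.
have FS n : exists F, [set` F] `<=` L /\ sup S - n.+1%:R^-1 < \sum_(l <- F) sqn (b l).
  have [|_ [F FL <-] h] := @sup_adherent _ S n.+1%:R^-1 _ supS; last by exists F.
  by rewrite invr_gt0.
pose F n := projT1 (cid (FS n)).
have FL n : [set` F n] `<=` L by rewrite /F; case: cid => ? [].
have hF n : sup S - n.+1%:R^-1 < \sum_(l <- F n) sqn (b l) by rewrite /F; case: cid => ? [].
have key n G : [set` F n] `<=` [set` G] -> [set` G] `<=` L ->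
    nsq (psum b G - psum b (F n)) < n.+1%:R^-1.
  move=> FG GL; rewrite nsq_psumB//; have := hF n.
  have : \sum_(l <- G) sqn (b l) <= sup S by apply: sup_upper_bound => //; exists G.
  by move: n.+1%:R^-1 (sup S) (bigop _ _ _) (bigop _ _ _) => x y z t; lra.
(* The sets [F n] are not nested, so two of them are compared through their union. *)
have key2 n m : nsq (psum b (F m) - psum b (F n)) < 2 * n.+1%:R^-1 + 2 * m.+1%:R^-1.
  have UL : [set` (F n `|` F m)%fset] `<=` L.
    by move=> l /=; rewrite !inE => /orP[/FL|/FL].
  have h1 := key n (F n `|` F m)%fset _ UL; have h2 := key m (F n `|` F m)%fset _ UL.
  rewrite -[psum b (F m)](subrK (psum b (F n `|` F m)%fset)) -addrA.
  apply: le_lt_trans (nsqD_le _ _) _; rewrite [X in X < _]addrC [nsq (psum b (F m) - _)]nsqC ltrD// ltr_pM2l//.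
    by apply: h1 => l /= lF; rewrite inE lF.
  by apply: h2 => l /= lF; rewrite inE lF orbT.
have inv_small (eps : R) : 0 < eps -> exists N, forall n, (N <= n)%N -> n.+1%:R^-1 < eps.
  move=> e0; have [N _ hN] := near_infty_natSinv_lt (PosNum e0).
  by exists N => n Nn; exact: hN.
have [eps e0|g ug] := @hcomplete _ _ (fun n => psum b (F n)).
  have [|N hN] := inv_small (eps ^+ 2 / 4); first by rewrite divr_gt0// exprn_gt0.
  exists N => m n Nm Nn; rewrite nrm_lt 1?ltW//.
  by apply: lt_trans (key2 n m) _; have := hN _ Nm; have := hN _ Nn;
    move: (n.+1%:R^-1 : R) (m.+1%:R^-1 : R) => x y; lra.
exists g => eps e0.
have [|N hN] := inv_small ((eps / 2) ^+ 2); first by rewrite exprn_gt0// divr_gt0.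
move/hcvgP : ug => /(_ (eps / 2)) [|M _ hM]; first by rewrite divr_gt0.
exists (F (maxn N M)) => [|G FG GL]; first exact: FL.
apply: le_lt_trans (nrm_triangle (psum b (F (maxn N M))) _ _) _.
rewrite (splitr eps) ltrD// nrmC.
  by apply: hM; rewrite /= leq_maxr.
rewrite nrm_lt ?divr_ge0// ?ltW//.
by apply: lt_trans (key _ _ FG GL) (hN _ _); rewrite leq_maxl.
Qed.

(** By Bessel, Riesz-Fischer gives a vector with the coefficients of [f]; its difference with [f] is
    orthogonal to the family, hence zero. *)
Lemma total_hexp f : total -> hexp (fun l => dot f (e l)) f.
Proof.
move=> tot; have [F FL|g gP] := @riesz_fischer (fun l => dot f (e l)) (nsq f).
  exact: bessel.
suff gf : g = f by move: gP; rewrite gf.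
apply/eqP; rewrite -subr_eq0; apply/eqP/tot => l Ll.
by rewrite dotBl (hexp_coef gP Ll) subrr.
Qed.

Lemma hexp_total : (forall f, exists b, hexp b f) -> total.
Proof.
move=> hex f f0; have [b bf] := hex f.
have b0 l : L l -> b l = 0 by move=> Ll; rewrite -(hexp_coef bf Ll) f0.
apply: (@hexp_unique b) => // eps e0; exists fset0 => [m|F _ FL]; first by rewrite /= inE.
rewrite sub0r /psum big_seq big1 ?oppr0 ?nrm0// => l lF.
by rewrite b0 ?scale0r//; exact: FL.
Qed.

Lemma eq_hexp a b f : (forall l, L l -> a l = b l) -> hexp a f -> hexp b f.
Proof.
move=> ab af eps e0; have [F0 F0L h] := af _ e0; exists F0 => // F F0F FL.
have -> : psum b F = psum a F; last exact: h.
by rewrite /psum big_seq [RHS]big_seq; apply: eq_bigr => l lF; rewrite ab//; exact: FL.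
Qed.

End orthonormal.

(** * Finite sums and sums over unordered families *)

Lemma cvg_sum0 (R : realType) (I : eqType) (r : seq I) (T : Type)
    (F : set_system T) {FF : Filter F} (a : I -> T -> R) :
  (forall i, i \in r -> a i x @[x --> F] --> (0 : R)) ->
  \sum_(i <- r) a i x @[x --> F] --> (0 : R).
Proof.
elim: r => [|i r IH] h; first by under eq_fun do rewrite big_nil; exact: cvg_cst.
under eq_fun do rewrite big_cons.
have hi : a i x @[x --> F] --> (0 : R) by apply: h; rewrite mem_head.
have hr : \sum_(j <- r) a j x @[x --> F] --> (0 : R).
  by apply: IH => j jr; apply: h; rewrite in_cons jr orbT.
by have := cvgD hi hr; rewrite addr0; apply.
Qed.

Section esum_fset.
Variables (R : realType) (I : choiceType) (L : set I).
Local Open Scope ereal_scope.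

Lemma esum_le_fset (a : I -> \bar R) (M : \bar R) :
  (forall F : {fset I}, [set` F] `<=` L -> \sum_(l <- F) a l <= M) ->
  \esum_(l in L) a l <= M.
Proof.
move=> h; apply: ge_ereal_sup => _ [A [finA AL] <-].
rewrite fsbig_finite//=; apply: h => l /=; rewrite in_fset_set//.
by move=> /set_mem /AL.
Qed.

Lemma fset_le_esum (a : I -> \bar R) (F : {fset I}) :
  [set` F] `<=` L -> \sum_(l <- F) a l <= \esum_(l in L) a l.
Proof.
move=> FL; apply: ereal_sup_ubound; exists [set` F]; first by split.
by rewrite fsbig_finite//= set_fsetK.
Qed.

Lemma ler_sum_fset (F G : {fset I}) (a : I -> R) : [set` F] `<=` [set` G] ->
  (forall l, l \in G -> 0 <= a l)%R ->
  (\sum_(l <- F) a l <= \sum_(l <- G) a l)%R.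
Proof.
move=> FG a0; rewrite -lee_fin -!sumEFin.
by apply: lee_sum_nneg_subfset => // l; rewrite inE => /andP[_ lG] _; rewrite lee_fin a0.
Qed.

End esum_fset.

(** * Diagonal operators in an orthonormal basis *)

Section multipliers.
Variables (R : realType) (H : Hilbert.type R) (I : choiceType).
Variables (L : set I) (e : I -> H).
Hypothesis ort : forall l m, L l -> L m -> dot (e l) (e m) = (l == m)%:R.
Hypothesis tot : total L e.
Implicit Types (f g h : H) (m : I -> R[i]) (F G : {fset I}).

(** Only real parts are treated; the imaginary part of an inner product is recovered by multiplying
    one vector by ['i]. *)
Lemma dot_series_near f g (eps : R) : 0 < eps ->
  exists2 F0 : {fset I}, [set` F0] `<=` L &
    forall F : {fset I}, [set` F0] `<=` [set` F] -> [set` F] `<=` L ->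
    `|Re (dot g f) - \sum_(l <- F) Re (dot g (e l) * (dot f (e l))^*)| < eps.
Proof.
move=> e0; have k0 : 0 < nrm g + 1 by rewrite ltr_wpDl ?nrm_ge0.
have [|F0 F0L hF] := @total_hexp _ _ _ _ _ ort f tot (eps / (nrm g + 1)).
  by rewrite divr_gt0.
exists F0 => // F F0F FL; have {}hF := hF F F0F FL.
set P := psum _ _ _ in hF.
have -> : Re (dot g f) - \sum_(l <- F) Re (dot g (e l) * (dot f (e l))^*) =
    Re (dot g (f - P)).
  rewrite dotBr ReB (dot_psumr (L := L))// Re_sum; congr (_ - _).
  by apply: eq_bigr => l _; rewrite mulrC.
have : nrm g * nrm (f - P) < eps.
  have := nrm_ge0 (f - P); have := nrm_ge0 g.
  by rewrite ltr_pdivlMr// in hF; nra.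
apply: le_lt_trans; rewrite ler_norml; apply/andP; split; last exact: Re_dot_le.
by rewrite lerNl -ReN -dotNr -[nrm (f - P)]nrmN Re_dot_le.
Qed.

Lemma dot_series f g (F0 : {fset I}) (eps : R) : [set` F0] `<=` L -> 0 < eps ->
  exists F : {fset I}, [/\ [set` F0] `<=` [set` F], [set` F] `<=` L &
    `|Re (dot g f) - \sum_(l <- F) Re (dot g (e l) * (dot f (e l))^*)| < eps].
Proof.
move=> F0L e0; have [F FL hF] := dot_series_near f g e0.
have UL : [set` (F0 `|` F)%fset] `<=` L.
  by move=> l /=; rewrite !inE => /orP[/F0L|/FL].
exists (F0 `|` F)%fset; split => //; first by move=> l /= lF; rewrite inE lF.
by apply: hF => // l /= lF; rewrite inE lF orbT.
Qed.

(** The graph of the diagonal operator with entries [m]. A relation needs neither a domain nor a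
    default value when [m] is unbounded, and [total] makes it single-valued. *)
Definition mulrel m f g := forall l, L l -> dot g (e l) = m l * dot f (e l).

Lemma mulrel_unique m f g h : mulrel m f g -> mulrel m f h -> g = h.
Proof.
move=> fg fh; apply/eqP; rewrite -subr_eq0; apply/eqP/tot => l Ll.
by rewrite dotBl fg// fh// subrr.
Qed.

Lemma mulrelZ m c f g : mulrel m f g -> mulrel m (c *: f) (c *: g).
Proof. by move=> fg l Ll; rewrite !dotZl fg// mulrCA. Qed.

Lemma mulrel_adjoint m f g f' g' : mulrel m f g -> mulrel (fun l => (m l)^*) f' g' ->
  dot g f' = dot f g'.
Proof.
have Re_adj h k : mulrel m h k -> mulrel (fun l => (m l)^*) f' g' ->
    Re (dot k f') = Re (dot h g').
  move=> hk fg'; apply/eqP; rewrite -subr_eq0 -normr_le0.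
  apply/ler_addgt0Pr => eps e0; rewrite add0r.
  have e2 : 0 < eps / 2 by rewrite divr_gt0.
  have [F FL hF] := dot_series_near f' k e2; have [G GL hG] := dot_series_near g' h e2.
  have UL : [set` (F `|` G)%fset] `<=` L.
    by move=> l /=; rewrite !inE => /orP[/FL|/GL].
  have {}hF : `|Re (dot k f') - \sum_(l <- (F `|` G)%fset) Re (dot k (e l) * (dot f' (e l))^*)| < eps / 2.
    by apply: hF => // l /= lF; rewrite inE lF.
  have {}hG : `|Re (dot h g') - \sum_(l <- (F `|` G)%fset) Re (dot h (e l) * (dot g' (e l))^*)| < eps / 2.
    by apply: hG => // l /= lF; rewrite inE lF orbT.
  (* On a common finite set the two partial sums agree term by term, because moving [m l] to the
     other side of the product conjugates it. *)
  have E : \sum_(l <- (F `|` G)%fset) Re (dot h (e l) * (dot g' (e l))^*) =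
      \sum_(l <- (F `|` G)%fset) Re (dot k (e l) * (dot f' (e l))^*).
    rewrite big_seq [RHS]big_seq; apply: eq_bigr => l lU; congr Re.
    rewrite hk ?fg'; [|exact: UL..].
    by rewrite conjcM conjcK mulrCA mulrA.
  move: hF hG; rewrite E; move: (bigop _ _ _) => s; rewrite !ltr_norml ler_norml; lra.
move=> fg fg'; apply: complex_eqP; first exact: Re_adj.
have := Re_adj _ _ (mulrelZ 'i fg) fg'.
by rewrite !dotZl !ReM /= !mul0r !mul1r !sub0r => /oppr_inj.
Qed.

Lemma mulrel_real (w : I -> R) f g : mulrel (fun l => (w l)%:C) f g -> Im (dot g f) = 0.
Proof.
move=> fg; have : dot g f = dot f g.
  by apply: (mulrel_adjoint fg) => l Ll; rewrite fg// conjc_real.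
move=> /(congr1 (@complex.Im R)); rewrite [in RHS]dotJ ImJ; lra.
Qed.

(** With nonnegative weights the partial sums of the series of [dot g f] increase with the finite
    set, so their limit is the unordered sum. Weights 1 give Parseval; indicators give the spectral
    measure of a set. *)
Lemma esum_dot (w : I -> R) f g : (forall l, L l -> 0 <= w l) ->
  mulrel (fun l => (w l)%:C) f g ->
  (Re (dot g f))%:E = \esum_(l in L) (w l * sqn (dot f (e l)))%:E.
Proof.
move=> w0 fg.
have E F : [set` F] `<=` L -> \sum_(l <- F) Re (dot g (e l) * (dot f (e l))^*) =
    \sum_(l <- F) w l * sqn (dot f (e l)).
  move=> FL; rewrite big_seq [RHS]big_seq; apply: eq_bigr => l lF.
  rewrite fg; last exact: FL.
  by rewrite -mulrA mul_conjc ReM /=; ring.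
apply/eqP; rewrite eq_le; apply/andP; split.
  apply/lee_addgt0Pr => eps e0.
  have [|F [_ FL]] := @dot_series f g fset0 eps _ e0; first by move=> l; rewrite /= inE.
  rewrite E// => h; apply: le_trans (leeD2r _ (fset_le_esum _ FL)).
  rewrite sumEFin -EFinD lee_fin; move: h; move: (bigop _ _ _) => s.
  by rewrite ltr_norml => /andP[_]; lra.
apply: esum_le_fset => F FL; apply/lee_addgt0Pr => eps e0.
have [G [FG GL]] := @dot_series f g F eps FL e0.
rewrite E// sumEFin -EFinD lee_fin => h.
have : \sum_(l <- F) w l * sqn (dot f (e l)) <= \sum_(l <- G) w l * sqn (dot f (e l)).
  have wf0 l : l \in G -> 0 <= w l * sqn (dot f (e l)).
    by move=> lG; rewrite mulr_ge0 ?sqn_ge0// w0//; exact: GL.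
  exact: ler_sum_fset.
move: h; move: (bigop _ _ _) (bigop _ _ _) => s t.
by rewrite ltr_norml => /andP[+ _]; lra.
Qed.

Lemma parseval f : (nsq f)%:E = \esum_(l in L) (sqn (dot f (e l)))%:E.
Proof.
rewrite /nsq (@esum_dot (fun=> 1) f)// ?ler01//.
  by under eq_esum do rewrite mul1r.
by move=> l _; rewrite mul1r.
Qed.

Lemma mulrel_esum m f g : mulrel m f g ->
  \esum_(l in L) (sqn (m l) * sqn (dot f (e l)))%:E = (nsq g)%:E.
Proof. by move=> fg; rewrite parseval; apply: eq_esum => l Ll; rewrite fg// sqnM. Qed.

Lemma mulrel_ex m f :
  (\esum_(l in L) (sqn (m l) * sqn (dot f (e l)))%:E < +oo)%E ->
  exists g, mulrel m f g.
Proof.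
move=> fin; set S := (X in (X < _)%E) in fin.
have S0 : (0 <= S)%E by apply: esum_ge0 => l _; rewrite lee_fin mulr_ge0 ?sqn_ge0.
have [F FL|g gP] := @riesz_fischer _ _ _ _ _ ort (fun l => m l * dot f (e l)) (fine S).
  rewrite -lee_fin fineK ?ge0_fin_numE// -sumEFin.
  by under eq_bigr do rewrite sqnM; exact: fset_le_esum.
by exists g => l Ll; rewrite (hexp_coef ort gP).
Qed.

Section bounded.
Variables (C : R) (m : I -> R[i]).
Hypothesis mC : forall l, L l -> sqn (m l) <= C.

Lemma bounded_mulrel_esum f :
  (\esum_(l in L) (sqn (m l) * sqn (dot f (e l)))%:E <= (C * nsq f)%:E)%E.
Proof.
apply: esum_le_fset => F FL; rewrite sumEFin lee_fin.
apply: (@le_trans _ _ (\sum_(l <- F) C * sqn (dot f (e l)))).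
  rewrite big_seq [leRHS]big_seq; apply: ler_sum => l lF.
  by rewrite ler_wpM2r ?sqn_ge0// mC//; exact: FL.
(* [mC] forces [0 <= C] only if [L] has an element; if [L] is empty, totality makes [f] zero and
   both sides vanish. *)
have [->|[l Ll]] : F = fset0 \/ exists l, L l.
    have [->|/fset0Pn[l lF]] := eqVneq F fset0; first by left.
    by right; exists l; exact: FL.
  have [CC|C0] := leP 0 C; first by rewrite big_seq_fset0 mulr_ge0 ?nsq_ge0.
  rewrite big_seq_fset0; case: (pselect (exists l, L l)) => [[l Ll]|nL].
    by have := mC Ll; have := sqn_ge0 (m l); lra.
  suff -> : f = 0 by rewrite nsq0 mulr0.
  by apply: tot => l Ll; exfalso; apply: nL; exists l.
rewrite -mulr_sumr ler_wpM2l// ?(bessel ort)//.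
exact: le_trans (sqn_ge0 _) (mC Ll).
Qed.

Lemma bounded_mulrel_ex f : exists g, mulrel m f g.
Proof.
by apply: mulrel_ex; apply: le_lt_trans (bounded_mulrel_esum f) _; rewrite ltry.
Qed.

Lemma bounded_mulrel f g : mulrel m f g -> nsq g <= C * nsq f.
Proof.
by move=> /mulrel_esum h; have := bounded_mulrel_esum f; rewrite h lee_fin.
Qed.

End bounded.

(** Dominated convergence for diagonal operators: finitely many coefficients tend to 0 one by one,
    the rest of [f] is small uniformly in [x]. It yields both the strong continuity of the group and
    the countable additivity of the spectral projections. *)
Lemma mulrel_cvg (T : Type) (F : set_system T) {FF : Filter F} (C : R)
    (d : T -> I -> R[i]) f (u : T -> H) :
  (forall x l, L l -> sqn (d x l) <= C) ->
  (forall l, L l -> sqn (d x l) @[x --> F] --> (0 : R)) ->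
  (forall x, mulrel (d x) f (u x)) -> hcvg F u 0.
Proof.
move=> dC d0 fu; apply/hcvgP => eps e0.
(* A positive bound makes [2 * C1 + 2] a legitimate divisor. The part of [f] outside [G] then
   contributes less than [C1 * (eps / (2 * C1 + 2)) ^ 2 < eps ^ 2 / 4], and [nsqD_le] doubles each
   of the two contributions. *)
have [C1 C10 hC1] : exists2 C1, 0 < C1 & C <= C1.
  by exists (Num.max C 1); rewrite ?lt_max ?ltr01 ?orbT// le_max lexx.
have [|G GL hG] := @total_hexp _ _ _ _ _ ort f tot (eps / (2 * C1 + 2)).
  by rewrite divr_gt0//; lra.
have {}hG := hG G (@subset_refl _ _) GL.
set p := psum _ _ _ in hG.
have S0 : \sum_(l <- G) sqn (d x l) * sqn (dot f (e l)) @[x --> F] --> (0 : R).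
  apply: cvg_sum0 => l lG; rewrite -[0](mul0r (sqn (dot f (e l)))).
  by apply: cvgMl; apply: d0; exact: GL.
have e2 : 0 < eps ^+ 2 / 4 by rewrite divr_gt0// exprn_gt0.
move/cvgr0Pnorm_lt : S0 => /(_ _ e2); apply: filterS => x hx.
rewrite subr0 nrm_lt 1?ltW//.
have xC1 l : L l -> sqn (d x l) <= C1 by move=> Ll; rewrite (le_trans (dC x _ Ll)).
have [v hv] := @bounded_mulrel_ex C1 (d x) xC1 (f - p).
have [w hw] := @bounded_mulrel_ex C1 (d x) xC1 p.
have -> : u x = w + v.
  apply: (mulrel_unique (fu x)) => l Ll; rewrite dotDl hw// hv// -mulrDr -dotDl.
  by rewrite addrC subrK.
have v_le := bounded_mulrel xC1 hv.
have w_le : nsq w <= eps ^+ 2 / 4.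
  have : ((nsq w)%:E <= (\sum_(l <- G) sqn (d x l) * sqn (dot f (e l)))%:E)%E.
    rewrite -(mulrel_esum hw); apply: esum_le_fset => E EL.
    rewrite sumEFin lee_fin.
    have eqE l : L l -> sqn (d x l) * sqn (dot p (e l)) =
        if l \in G then sqn (d x l) * sqn (dot f (e l)) else 0.
      by move=> Ll; rewrite (dot_psum_e ort)//; case: ifP => // _; rewrite sqn0 mulr0.
    have pos l : 0 <= sqn (d x l) * sqn (dot f (e l)) by rewrite mulr_ge0 ?sqn_ge0.
    rewrite big_seq (eq_bigr _ (fun l lE => eqE l (EL l lE))) -big_seq.
    apply: (@le_trans _ _ (\sum_(l <- (E `|` G)%fset) if l \in G then
        sqn (d x l) * sqn (dot f (e l)) else 0)).
      apply: ler_sum_fset => [l /= lE|l _]; first by rewrite inE lE.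
      by case: ifP.
    rewrite -big_mkcond -big_filter (perm_big (enum_fset G))//.
    apply: uniq_perm; rewrite ?filter_uniq ?fset_uniq// => l.
    by rewrite mem_filter inE; case: (l \in G); rewrite /= ?orbT.
  rewrite lee_fin => /le_trans; apply; apply: ltW.
  by move: hx; rewrite ger0_norm// sumr_ge0// => l _; rewrite mulr_ge0 ?sqn_ge0.
have : C1 * nsq (f - p) < eps ^+ 2 / 4.
  move: hG; rewrite nrm_lt; last by rewrite divr_ge0//; lra.
  rewrite expr_div_n ltr_pdivlMr; last by rewrite exprn_gt0//; lra.
  have := nsq_ge0 (f - p); nra.
have := nsqD_le w v; lra.
Qed.

End multipliers.

(** * One-parameter unitary groups: difference quotients and averages *)

Section one_parameter_groups.
Variables (R : realType) (H : Hilbert.type R).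
Implicit Types (f g h : H) (c : R[i]).

Record ugroup (U : R -> H -> H) : Prop := UGroup {
  ugl : forall t c f g, U t (c *: f + g) = c *: U t f + U t g;
  ugdot : forall t f g, dot (U t f) (U t g) = dot f g;
  ug0 : forall f, U 0 f = f;
  ugS : forall s t f, U (s + t) f = U s (U t f);
  ugc : forall f t0, hcvg (nbhs t0) (U^~ f) (U t0 f)
}.

Definition step (k : nat) : R := 2^-1 ^+ k.

Lemma step_gt0 k : 0 < step k. Proof. by rewrite exprn_gt0// invr_gt0. Qed.

Lemma stepS k : step k = 2 * step k.+1.
Proof. by rewrite /step exprS mulrA mulfV ?mul1r. Qed.

Lemma stepD j k : step (j + k) = step j * step k.
Proof. exact: exprD. Qed.

Lemma step_mul k : 2 ^+ k * step k = 1.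
Proof. by rewrite /step exprVn mulfV// expf_neq0. Qed.

Lemma cvg_step : step k @[k --> \oo] --> (0 : R).
Proof. by apply: cvg_expr; rewrite ger0_norm ?invr_ge0// invf_lt1// ltr1n. Qed.

Section group.
Variables (U : R -> H -> H) (UU : ugroup U).

Lemma ugD t f g : U t (f + g) = U t f + U t g.
Proof. by have := ugl UU t 1 f g; rewrite !scale1r. Qed.

Lemma ug_zero t : U t 0 = 0.
Proof. by have := ugD t 0 0; rewrite addr0 => /eqP; rewrite -subr_eq0 opprD addrA subrr add0r oppr_eq0 => /eqP. Qed.

Lemma ugZ t c f : U t (c *: f) = c *: U t f.
Proof. by have := ugl UU t c f 0; rewrite ug_zero !addr0. Qed.

Lemma ugN t f : U t (- f) = - U t f.
Proof. by rewrite -scaleN1r ugZ scaleN1r. Qed.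

Lemma ugB t f g : U t (f - g) = U t f - U t g.
Proof. by rewrite ugD ugN. Qed.

Lemma ug_nsq t f : nsq (U t f) = nsq f.
Proof. by rewrite /nsq ugdot. Qed.

Lemma ug_nrm t f : nrm (U t f) = nrm f.
Proof. by rewrite /nrm ug_nsq. Qed.

Lemma ugK t f : U (- t) (U t f) = f.
Proof. by rewrite -ugS// addNr ug0. Qed.

Lemma ugC s t f : U s (U t f) = U t (U s f).
Proof. by rewrite -!ugS// addrC. Qed.

Lemma ug_adj t f g : dot (U t f) g = dot f (U (- t) g).
Proof. by rewrite -(ugdot UU (- t)) ugK. Qed.

Lemma ug_near f (eps : R) : 0 < eps ->
  exists2 d, 0 < d & forall t, `|t| < d -> nrm (U t f - f) < eps.
Proof.
move=> e0; have /hcvgP/(_ _ e0) := ugc UU f 0.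
rewrite ug0// => /nbhs_ballP[d d0 hd]; exists d => // t td; apply: hd.
by rewrite /ball /= sub0r normrN.
Qed.

(** Stands in for the generator: a bound on [nrm (dquot k f)] uniform in [k] replaces membership in
    its domain. Dyadic steps are used for the sake of [nrm_dquotS]. *)
Definition dquot k f : H := (2 ^+ k)%:C *: (U (step k) f - f).

Lemma nrm_dquot k f : nrm (dquot k f) = 2 ^+ k * nrm (U (step k) f - f).
Proof. by rewrite nrmZR ger0_norm ?exprn_ge0. Qed.

Lemma nrm_step k f : nrm (U (step k) f - f) = step k * nrm (dquot k f).
Proof. by rewrite nrm_dquot mulrA [step k * _]mulrC step_mul mul1r. Qed.

Lemma dquotP k c f g : dquot k (c *: f + g) = c *: dquot k f + dquot k g.
Proof.
rewrite /dquot ugD ugZ opprD addrACA -scalerBr scalerDr !scalerA.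
by rewrite [c * _]mulrC.
Qed.

Lemma dquotD k f g : dquot k (f + g) = dquot k f + dquot k g.
Proof. by have := dquotP k 1 f g; rewrite !scale1r. Qed.

Lemma dquotZ k c f : dquot k (c *: f) = c *: dquot k f.
Proof. by rewrite /dquot ugZ -scalerBr !scalerA mulrC. Qed.

Lemma dquotB k f g : dquot k (f - g) = dquot k f - dquot k g.
Proof. by rewrite dquotD -[- g]scaleN1r dquotZ scaleN1r. Qed.

Lemma dquotU k t f : dquot k (U t f) = U t (dquot k f).
Proof. by rewrite /dquot ugC -ugB -ugZ. Qed.

(** With [s] the half step, [U (2 * s) f - f] is the sum of [U s f - f] and its image under the
    isometry [U s]. *)
Lemma nrm_dquotS k f : nrm (dquot k f) <= nrm (dquot k.+1 f).
Proof.
rewrite !nrm_dquot exprSr -mulrA ler_wpM2l ?exprn_ge0//.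
rewrite stepS mulr_natl mulr2n ugS//.
rewrite -(subrK (U (step k.+1) f) (U _ (U _ f))) -ugB -addrA.
apply: le_trans (nrmD _ _) _; rewrite ug_nrm; lra.
Qed.

Lemma nrm_dquot_le j k f : (j <= k)%N -> nrm (dquot j f) <= nrm (dquot k f).
Proof.
move=> /subnK <-; elim: (k - j)%N => // n IH.
by rewrite (le_trans IH)// addSn nrm_dquotS.
Qed.

Lemma nrm_dquot_bnd k f : nrm (dquot k f) <= 2 ^+ k * (2 * nrm f).
Proof.
rewrite nrm_dquot ler_wpM2l ?exprn_ge0// (le_trans (nrmB _ _))// ug_nrm; lra.
Qed.

Lemma hcvg_dquot (T : Type) (F : set_system T) {FF : Filter F} (u : T -> H) l k :
  hcvg F u l -> hcvg F (fun x => dquot k (u x)) (dquot k l).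
Proof.
move=> ul; apply: (@hcvg_le _ _ _ _ _ (fun x => 2 ^+ k * (2 * nrm (u x - l)))).
  by move=> x; rewrite -dquotB nrm_dquot_bnd.
rewrite -[0](mulr0 (2 ^+ k)); apply: cvgMr.
by rewrite -[0](mulr0 2); apply: cvgMr.
Qed.

Lemma lipschitz_mul s f n : nrm (U (n%:R * s) f - f) <= n%:R * nrm (U s f - f).
Proof.
elim: n => [|n IH]; first by rewrite !mul0r ug0// subrr nrm0.
have -> : U (n.+1%:R * s) f - f = U s (U (n%:R * s) f - f) + (U s f - f).
  by rewrite -natr1 mulrDl mul1r [n%:R * s + s]addrC ugS// ugB addrA subrK.
apply: le_trans (nrmD _ _) _; rewrite ug_nrm -natr1 mulrDl mul1r; lra.
Qed.

(** Write [t] as a multiple of a dyadic step plus a remainder below that step. The multiple costs at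
    most [C * t] by telescoping, the remainder is negligible by strong continuity, and negative
    times are reflected by unitarity. *)
Lemma lipschitz f (C : R) : (forall k, nrm (dquot k f) <= C) ->
  forall t, nrm (U t f - f) <= C * `|t|.
Proof.
move=> hC; have C0 : 0 <= C by rewrite (le_trans (nrm_ge0 _) (hC 0%N)).
have pos t : 0 <= t -> nrm (U t f - f) <= C * t.
  move=> t0; apply/ler_addgt0Pr => eps e0.
  have [d d0 hd] := ug_near f e0.
  have /cvgr0Pnorm_lt/(_ _ d0)[k _ /(_ k (leqnn k)) /= hk] := cvg_step.
  rewrite gtr0_norm ?step_gt0// in hk.
  set n := Num.truncn (t / step k).
  have /andP[n1 n2] : n%:R <= t / step k < n.+1%:R.
    by apply: truncn_itv; rewrite divr_ge0// ltW// step_gt0.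
  rewrite ler_pdivlMr ?step_gt0// in n1; rewrite ltr_pdivrMr ?step_gt0// in n2.
  pose s := t - n%:R * step k.
  have s0 : 0 <= s by rewrite subr_ge0.
  rewrite {1}(_ : t = n%:R * step k + s); last by rewrite /s addrC subrK.
  rewrite (ugS UU (n%:R * step k) s).
  have -> : U (n%:R * step k) (U s f) - f = U (n%:R * step k) (U s f - f) +
      (U (n%:R * step k) f - f) by rewrite ugB addrA subrK.
  apply: le_trans (nrmD _ _) _; rewrite ug_nrm addrC lerD//.
    apply: le_trans (lipschitz_mul _ _ _) _; rewrite nrm_step.
    apply: le_trans (_ : n%:R * (step k * C) <= _).
      by rewrite ler_wpM2l// ler_wpM2l ?hC// ltW// step_gt0.
    by rewrite mulrA mulrC ler_wpM2l.
  apply/ltW/hd; rewrite ger0_norm//.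
  by rewrite /s; move: n2; rewrite -natr1; lra.
move=> t; have [t0|t0] := leP 0 t; first by rewrite ger0_norm// pos.
rewrite ltr0_norm// -(ug_nrm (- t)) ugB ugK nrmC; apply: pos; lra.
Qed.

(** Unfolds to the mean of [U (j * tau * step k) f] over [j < 2 ^ k], a Riemann sum on [0, tau]
    divided by tau. The binary recursion makes [avg_comp] and [avg_diff] plain inductions. *)
Fixpoint avg k (tau : R) f : H := if k is k'.+1 then
  (2^-1)%:C *: (avg k' (tau / 2) f + U (tau / 2) (avg k' (tau / 2) f)) else f.

Lemma avgB k tau f g : avg k tau (f - g) = avg k tau f - avg k tau g.
Proof.
elim: k tau => //= k IH tau; rewrite IH ugB -scalerBr; congr (_ *: _).
by rewrite opprD addrACA.
Qed.

Lemma nrm_half f g (eps : R) : nrm f <= eps -> nrm g <= eps ->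
  nrm ((2^-1)%:C *: (f + g)) <= eps.
Proof.
move=> fe ge; rewrite nrmZR ger0_norm ?invr_ge0//.
by have := nrmD f g; lra.
Qed.

Lemma nrm_avg k tau f : nrm (avg k tau f) <= nrm f.
Proof.
by elim: k tau => //= k IH tau; apply: nrm_half; rewrite ?ug_nrm.
Qed.

Lemma avg_near k (tau s eps : R) f : 0 <= tau ->
  (forall r, s <= r <= s + tau -> nrm (U r f - f) <= eps) ->
  nrm (U s (avg k tau f) - f) <= eps.
Proof.
elim: k tau s => [|k IH] tau s t0 h /=.
  by apply: h; rewrite lexx lerDl.
have -> : U s ((2^-1)%:C *: (avg k (tau / 2) f + U (tau / 2) (avg k (tau / 2) f))) - f =
    (2^-1)%:C *: ((U s (avg k (tau / 2) f) - f) + (U (s + tau / 2) (avg k (tau / 2) f) - f)).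
  rewrite ugZ ugD ugS// addrACA -opprD scalerBr; congr (_ - _).
  rewrite -mulr2n -[f *+ 2]scaler_nat scalerA (_ : _ * _ = 1) ?scale1r//.
  by apply: complex_eqP; rewrite ?ReM ?ImM /=; lra.
apply: nrm_half; apply: IH; try lra.
- by move=> r /andP[r1 r2]; apply: h; apply/andP; split; lra.
- by move=> r /andP[r1 r2]; apply: h; apply/andP; split; lra.
Qed.

Lemma avg_comp k m tau f : avg (k + m) tau f = avg k tau (avg m (tau * step k) f).
Proof.
elim: k tau => [|k IH] tau /=; first by rewrite /step expr0 mulr1.
by rewrite IH /step exprS mulrA.
Qed.

(** Moving the mean by one mesh step telescopes: only the two end vectors, of weight [step k],
    survive. *)
Lemma avg_diff k tau f :
  U (tau * step k) (avg k tau f) - avg k tau f = (step k)%:C *: (U tau f - f).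
Proof.
elim: k tau => [|k IH] tau /=; first by rewrite /step expr0 mulr1 scale1r.
have -> : tau * step k.+1 = tau / 2 * step k by rewrite /step exprS mulrA.
rewrite ugZ ugD ugC -scalerBr opprD addrACA -ugB IH ugZ.
rewrite -scalerDr scalerA ugB -ugS// -splitr addrC subrKA.
by rewrite /step exprS -rmorphM.
Qed.

End group.

(* Dyadic averages of [t |-> U t f] over [[0, tau]] replace the vector-valued
   integral in the construction of vectors in the domain of the generator. *)
Lemma smoothing (U : R -> H -> H) (N : set H) f : ugroup U ->
  (forall c g h, N g -> N h -> N (c *: g + h)) -> (forall t g, N g -> N (U t g)) ->
  (forall (u : nat -> H) l, hcvg \oo u l -> (forall n, N (u n)) -> N l) ->
  N f -> f <> 0 ->
  exists g, [/\ N g, g <> 0 & exists C, forall k, nrm (dquot U k g) <= C].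
Proof.
move=> UU NP NU Nlim Nf f0.
have f0' : 0 < nrm f.
  by rewrite lt_def nrm_ge0 andbT; apply/eqP => /nrm_eq0.
(* Within time [d] the group moves [f] by less than half its norm, so averages over shorter times
   stay away from 0. *)
have [d d0 hd] := ug_near UU f (divr_gt0 f0' (ltr0Sn R 1)).
have /cvgr0Pnorm_lt/(_ _ (divr_gt0 d0 (ltr0Sn R 1)))[p _ /(_ p (leqnn p)) /= hp] := cvg_step.
rewrite gtr0_norm ?step_gt0// in hp.
have Navg k tau : N (avg U k tau f).
  elim: k tau => //= k IH tau.
  have N0 : N 0 by have := NP (-1) f f Nf Nf; rewrite scaleN1r addNr.
  have := NP (2^-1)%:C _ _ (NP 1 _ _ (IH (tau / 2)) (NU (tau / 2) _ (IH (tau / 2)))) N0.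
  by rewrite addr0 scale1r.
have p0 := step_gt0 p.
have avg_small m k (eps : R) : (forall r, `|r| < step p * step k * 2 -> nrm (U r f - f) <= eps) ->
    nrm (avg U m (step p * step k) f - f) <= eps.
  move=> h; have pk := mulr_gt0 p0 (step_gt0 k).
  rewrite -{1}(ug0 UU (avg U m (step p * step k) f)).
  apply: avg_near => //; first exact: ltW.
  move=> r /andP[r1 r2]; apply: h; rewrite ger0_norm//; lra.
have [eps e0|g ug] := @hcomplete _ _ (fun k => avg U k (step p) f).
  have e20 : 0 < eps / 2 by rewrite divr_gt0.
  have [d' d'0 hd'] := ug_near UU f (divr_gt0 e20 (ltr0Sn R 1)).
  have /cvgr0Pnorm_lt/(_ _ d'0)[K _ /(_ K (leqnn K)) /= hK] := cvg_step.
  rewrite gtr0_norm ?step_gt0// in hK.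
  have step_le1 k : step k <= 1 by rewrite exprn_ile1// ?invr_ge0// invf_le1// ler1n.
  exists K.+1 => m n Km Kn.
  (* Refining the mesh beyond depth [K.+1] amounts to replacing [f] by its average over one mesh
     interval, which is close to [f]; averaging is a contraction. *)
  have key j : (K.+1 <= j)%N ->
      nrm (avg U j (step p) f - avg U K.+1 (step p) f) < eps / 2.
    move=> /subnKC <-; rewrite avg_comp -avgB//.
    apply: le_lt_trans (nrm_avg UU _ _ _) _.
    apply: (@le_lt_trans _ _ (eps / 2 / 2)); last by rewrite ltr_pdivrMr//; lra.
    apply: avg_small => r hr; apply/ltW/hd'; apply: lt_le_trans hr _.
    rewrite -mulrA [step K.+1 * 2]mulrC -stepS.
    by rewrite (le_trans _ (ltW hK))// ler_piMl ?step_le1// ltW// step_gt0.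
  apply: le_lt_trans (nrm_triangle (avg U K.+1 (step p) f) _ _) _.
  by rewrite (splitr eps) [X in _ + X < _]nrmC ltrD ?key.
exists g; split.
- by apply: Nlim ug _ => n; exact: Navg.
(* If the limit were 0, some average would have norm below [nrm f / 2] while lying within
   [nrm f / 2] of [f]. *)
- move=> g0; move: ug; rewrite g0 => /hcvgP/(_ _ (divr_gt0 f0' (ltr0Sn R 1))).
  move=> [m _ /(_ m (leqnn m)) /=]; rewrite subr0 => hm.
  have := avg_small m 0%N (nrm f / 2); rewrite /step expr0 mulr1 => hm'.
  have {}hm' : nrm (avg U m (step p) f - f) <= nrm f / 2.
    by apply: hm' => r hr; apply/ltW/hd; rewrite /step in hp; lra.
  by have := nrmB (avg U m (step p) f) (avg U m (step p) f - f);
    rewrite opprB addrC subrK; lra.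
(* [2 ^ p] is 1 / tau for tau = [step p]. By [avg_diff] the quotient of index [p + k] of an average
   is (U tau h - h) / tau with [nrm h <= nrm f]; smaller indices are covered by monotonicity. *)
exists (2 ^+ p * (2 * nrm f)) => k.
apply: le_trans (nrm_dquot_le UU _ (leq_addl p k)) _.
apply: (hcvg_nrm_le (hcvg_dquot UU (p + k) ug)); exists k => // n /= kn.
rewrite nrm_dquot -(subnKC kn) avg_comp stepD avg_diff//.
rewrite nrmZR gtr0_norm ?step_gt0// exprD -mulrA [2 ^+ k * _]mulrA step_mul mul1r.
rewrite ler_wpM2l ?exprn_ge0//; apply: le_trans (nrmB _ _) _; rewrite ug_nrm//.
by have := nrm_avg UU (n - k) (step p * step k) f; lra.
Qed.

End one_parameter_groups.

(** * Limits along filters and ultrafilters *)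

Section filter_limits.
Variables (R : realType).

(** Compactness of [-C, C] gives a cluster point. The ultrafilter contains either the set of indices
    close to it or the complement, and the latter contradicts clustering. *)
Lemma ultra_bounded_cvg (F : set_system nat) (u : nat -> R) (C : R) :
  UltraFilter F -> (forall n, `|u n| <= C) -> exists l : R, u n @[n --> F] --> l.
Proof.
move=> UF uC; have FF : ProperFilter F by exact: ultra_proper.
have uI : F (u @^-1` `[- C, C]%classic).
  by apply: filterE => n; rewrite /= in_itv /= -ler_norml; exact: uC.
have [l [_ ul]] := @segment_compact R (- C) C (u n @[n --> F]) _ uI.
exists l; apply/cvgrPdist_lt => eps e0.
have [//|nF] := in_ultra_setVsetC [set n | `|l - u n| < eps] UF.
have [_ [[n hn <-] hl]] := ul (u @` (~` [set n | `|l - u n| < eps])) (ball l eps)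
  (filterS (@preimage_image _ _ _ _) nF) (nbhsx_ballx l eps e0).
by exfalso; apply: hn.
Qed.

Variable H : Hilbert.type R.

(** The Cauchy sets [A 0], ..., [A n] have a common point [x n]; the sequence [u (x n)] is Cauchy
    and its limit is also the limit along the filter. *)
Lemma hcomplete_filter (T : Type) (F : set_system T) {FF : ProperFilter F} (u : T -> H) :
  (forall eps, 0 < eps -> exists2 A, F A & forall x y, A x -> A y -> nrm (u x - u y) < eps) ->
  exists l, hcvg F u l.
Proof.
move=> h; have AS n : exists A : set T, F A /\ forall x y, A x -> A y ->
    nrm (u x - u y) < n.+1%:R^-1.
  by have [|A FA hA] := h n.+1%:R^-1; [rewrite invr_gt0|exists A].
pose A n := projT1 (cid (AS n)).
have FA n : F (A n) by rewrite /A; case: cid => ? [].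
have hA n x y : A n x -> A n y -> nrm (u x - u y) < n.+1%:R^-1.
  by rewrite /A; case: cid => ? [] /= _; apply.
have BS n : exists x, forall m, (m <= n)%N -> A m x.
  suff /filter_ex[x hx] : F [set x | forall m, (m <= n)%N -> A m x] by exists x.
  elim: n => [|n IH]; first by apply: filterS (FA 0%N) => x Ax m; rewrite leqn0 => /eqP ->.
  apply: filterS (filterI IH (FA n.+1)) => x [h1 h2] m.
  by rewrite leq_eqVlt => /orP[/eqP ->//|]; exact: h1.
pose x n := projT1 (cid (BS n)).
have hx n m : (m <= n)%N -> A m (x n) by rewrite /x; case: cid => ? /=; apply.
have inv_small (eps : R) : 0 < eps -> exists N, forall n, (N <= n)%N -> n.+1%:R^-1 < eps.
  move=> e0; have [N _ hN] := near_infty_natSinv_lt (PosNum e0).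
  by exists N => n Nn; exact: hN.
have [eps e0|l xl] := @hcomplete _ _ (fun n => u (x n)).
  have [N hN] := inv_small _ e0; exists N => m n Nm Nn.
  by apply: lt_trans (hN _ (leqnn N)); apply: hA; exact: hx.
exists l; apply/hcvgP => eps e0; have e20 : 0 < eps / 2 by rewrite divr_gt0.
have [N hN] := inv_small _ e20.
move/hcvgP : xl => /(_ _ e20)[M _ hM].
apply: filterS (FA N) => y Ay.
apply: le_lt_trans (nrm_triangle (u (x (maxn N M))) _ _) _.
rewrite (splitr eps) ltrD//; last by apply: hM; rewrite /= leq_maxr.
by apply: lt_trans (hN _ (leqnn N)); apply: hA => //; apply: hx; rewrite leq_maxl.
Qed.

End filter_limits.

(** * Eigenvectors by minimizing the energy *)

Section eigenvectors.
Variables (R : realType) (H : Hilbert.type R).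
Variables (U : R -> H -> H) (UU : ugroup U).
Implicit Types (f g h : H) (c : R[i]).

(* A Poincare inequality up to finitely many coordinates: it makes the vectors
   of bounded energy relatively compact. *)
Definition poincare := forall eps : R, 0 < eps -> exists s : seq H,
  forall d (C : R), 0 <= C -> (forall t, nrm (U t d - d) <= C * `|t|) ->
    nsq d <= eps * C ^+ 2 + \sum_(phi <- s) sqn (dot d phi).

Hypothesis PU : poincare.
Variables (F : set_system nat) (UF : UltraFilter F) (Foo : \oo `<=` F).
Variable N : set H.
Hypothesis NP : forall c g h, N g -> N h -> N (c *: g + h).
Hypothesis NU : forall t g, N g -> N (U t g).
Hypothesis Nlim : forall (G : set_system nat) (u : nat -> H) l,
  ProperFilter G -> hcvg G u l -> (forall n, N (u n)) -> N l.

Let FF : ProperFilter F. Proof. exact: ultra_proper. Qed.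

(** Each inner product with a fixed vector converges along the ultrafilter. [PU], applied to the
    differences [u i - u j], turns this into the Cauchy property in norm. *)
Lemma energy_compact (u : nat -> H) (C : R) : (forall n, nrm (u n) <= C) ->
  (forall n k, nrm (dquot U k (u n)) <= C) -> exists l, hcvg F u l.
Proof.
move=> uC duC; have C0 : 0 <= C by rewrite (le_trans (nrm_ge0 _) (uC 0%N)).
apply: hcomplete_filter => eps e0.
(* [2 * C] bounds the energy of a difference, so this constant times [(2 * C) ^ 2] is at most
   [eps ^ 2 / 2]; the added 1 keeps the divisor positive. *)
have e1 : 0 < eps ^+ 2 / (2 * ((2 * C) ^+ 2 + 1)).
  by rewrite divr_gt0 ?exprn_gt0// mulr_gt0// ltr_wpDl// sqr_ge0.
have [s hs] := PU e1.
have lim phi : exists l : R[i], Re (dot (u n) phi) @[n --> F] --> Re l /\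
    Im (dot (u n) phi) @[n --> F] --> Im l.
  have b n : sqn (dot (u n) phi) <= (C * nrm phi) ^+ 2.
    rewrite (le_trans (cauchy_schwarz _ _))// exprMn -(nrm_sqr phi).
    by rewrite ler_wpM2r ?sqr_ge0// -nrm_le.
  have B0 : 0 <= C * nrm phi by rewrite mulr_ge0 ?nrm_ge0.
  have [n|r hr] := @ultra_bounded_cvg _ F (fun n => Re (dot (u n) phi)) (C * nrm phi) UF.
    rewrite -(@ler_pXn2r _ 2)// ?nnegrE// real_normK ?num_real//.
    exact: le_trans (Re_le_sqn _) (b n).
  have [n|i hi] := @ultra_bounded_cvg _ F (fun n => Im (dot (u n) phi)) (C * nrm phi) UF.
    rewrite -(@ler_pXn2r _ 2)// ?nnegrE// real_normK ?num_real//.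
    exact: le_trans (Im_le_sqn _) (b n).
  by exists (Complex r i).
pose l phi := projT1 (cid (lim phi)).
have hl phi : sqn (dot (u n) phi - l phi) @[n --> F] --> (0 : R).
  rewrite /l; case: cid => z /= [hr hi]; apply: cvg_sqn0.
    have -> : (fun n => Re (dot (u n) phi - z)) = (fun n => Re (dot (u n) phi) - Re z).
      by apply/funext => n; rewrite ReB.
    by have := cvgB hr (cvg_cst (Re z)); rewrite subrr; apply.
  have -> : (fun n => Im (dot (u n) phi - z)) = (fun n => Im (dot (u n) phi) - Im z).
      by apply/funext => n; rewrite ImB.
    by have := cvgB hi (cvg_cst (Im z)); rewrite subrr; apply.
have S0 : \sum_(phi <- s) sqn (dot (u n) phi - l phi) @[n --> F] --> (0 : R).
  by apply: cvg_sum0 => phi _.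
(* [sqnD] doubles each of the two coordinate sums, which therefore use up the other
   [eps ^ 2 / 2]. *)
have e2 : 0 < eps ^+ 2 / 8 by rewrite divr_gt0// exprn_gt0.
move/cvgr0Pnorm_lt : S0 => /(_ _ e2) FA; exists (fun n => `|\sum_(phi <- s) sqn (dot (u n) phi - l phi)| < eps ^+ 2 / 8) => // i j.
have pos n : 0 <= \sum_(phi <- s) sqn (dot (u n) phi - l phi).
  by apply: sumr_ge0 => *; exact: sqn_ge0.
rewrite !ger0_norm// => hi hj.
rewrite nrm_lt 1?ltW//.
apply: le_lt_trans (hs (u i - u j) (2 * C) _ _) _.
- by rewrite mulr_ge0.
- apply: lipschitz => // k; rewrite dquotB//; apply: le_trans (nrmB _ _) _.
  by have := duC i k; have := duC j k; lra.
have : \sum_(phi <- s) sqn (dot (u i - u j) phi) <=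
    2 * (\sum_(phi <- s) sqn (dot (u i) phi - l phi)) + 2 * (\sum_(phi <- s) sqn (dot (u j) phi - l phi)).
  rewrite !mulr_sumr -big_split /=; apply: ler_sum => phi _.
  rewrite dotBl -(subrKA (l phi)) -(sqnN (dot (u j) phi - _)) opprB; exact: sqnD.
have : eps ^+ 2 / (2 * ((2 * C) ^+ 2 + 1)) * (2 * C) ^+ 2 <= eps ^+ 2 / 2.
  have := sqr_ge0 (2 * C); have := sqr_ge0 eps.
  move: (eps ^+ 2) ((2 * C) ^+ 2) => E K E0 K0.
  by rewrite mulrAC ler_pdivrMr ?mulr_gt0 ?ltr_wpDl//; nra.
lra.
Qed.

(** The energy, a supremum over [k], may be infinite; collecting its real upper bounds over the unit
    vectors of [N] keeps the infimum in [R]. *)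
Definition energy_set : set R :=
  [set a | exists f, [/\ N f, nsq f = 1 & forall k, nsq (dquot U k f) <= a]].

Let m := inf energy_set.

Hypothesis Nn0 : exists2 f, N f & f <> 0.

Let N0 : N 0.
Proof. by have [f Nf _] := Nn0; have := NP (-1) Nf Nf; rewrite scaleN1r addNr. Qed.

Let NZ c f : N f -> N (c *: f).
Proof. by move=> Nf; have := NP c Nf N0; rewrite addr0. Qed.

Let nsq_normalize f : f <> 0 -> nsq ((nrm f)^-1%:C *: f) = 1.
Proof.
move=> f0; rewrite nsqZ sqnR -nrm_sqr -exprMn mulVf ?expr1n//.
by apply/eqP => /nrm_eq0.
Qed.

Lemma has_inf_energy : has_inf energy_set.
Proof.
split; last by exists 0 => a [f [_ _ /(_ 0%N)]]; apply: le_trans; exact: nsq_ge0.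
have [f Nf f0] := Nn0.
have [|g [Ng g0 [C hC]]] := smoothing UU NP NU _ Nf f0.
  by move=> u l ul Nu; exact: Nlim ul Nu.
exists (((nrm g)^-1 * C) ^+ 2); exists ((nrm g)^-1%:C *: g); split.
- exact: NZ.
- exact: nsq_normalize.
- move=> k; rewrite dquotZ// nsqZ sqnR exprMn -nrm_sqr ler_wpM2l ?sqr_ge0//.
  by rewrite ler_pXn2r// nnegrE ?nrm_ge0// (le_trans (nrm_ge0 _) (hC k)).
Qed.

Lemma inf_energy_le f (a : R) : N f -> (forall k, nsq (dquot U k f) <= a) ->
  m * nsq f <= a.
Proof.
move=> Nf fa; have [->|/eqP f0] := eqVneq f 0.
  by rewrite nsq0 mulr0; exact: le_trans (nsq_ge0 _) (fa 0%N).
have g1 := nsq_normalize f0; set g := _ *: f in g1.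
have f0' : 0 < nsq f by rewrite lt_def nsq_ge0 andbT; apply/eqP => /dot_def.
rewrite -ler_pdivlMr//; apply: ge_inf; first by have [] := has_inf_energy.
exists g; split=> //; first exact: NZ.
move=> k; rewrite /g dquotZ// nsqZ sqnR exprVn nrm_sqr mulrC.
by rewrite ler_wpM2r// invr_ge0 nsq_ge0.
Qed.

Let cvgF (u : nat -> R) (l : R) : u n @[n --> \oo] --> l -> u n @[n --> F] --> l.
Proof. by move=> h; apply: cvg_trans h => A; exact: Foo. Qed.

Let Finv : m + n.+1%:R^-1 @[n --> F] --> m.
Proof.
rewrite -[m in X in _ --> X](addr0 m).
by apply: cvgD; [exact: cvg_cst|apply: cvgF; exact: cvg_harmonic].
Qed.

(** A minimizing sequence has bounded norms and energies, so it converges in norm along [F], and for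
    fixed [k] the map [nsq (dquot U k _)] is continuous. *)
Lemma energy_min : exists f, [/\ N f, nsq f = 1 & forall k, nsq (dquot U k f) <= m].
Proof.
have fS n : exists f, [/\ N f, nsq f = 1 & forall k, nsq (dquot U k f) <= m + n.+1%:R^-1].
  have [|a [f [Nf f1 fa]] am] := inf_adherent (_ : 0 < n.+1%:R^-1) has_inf_energy.
    by rewrite invr_gt0.
  by exists f; split=> // k; rewrite (le_trans (fa k))// ltW.
pose u n := projT1 (cid (fS n)).
have Nu n : N (u n) by rewrite /u; case: cid => ? [].
have u1 n : nsq (u n) = 1 by rewrite /u; case: cid => ? [].
have um n k : nsq (dquot U k (u n)) <= m + n.+1%:R^-1 by rewrite /u; case: cid => ? [].
have m0 : 0 <= m + 1.
  by have := um 0%N 0%N; rewrite invr1; apply: le_trans; exact: nsq_ge0.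
(* One constant for both requirements: it dominates the norm 1 as well as the square root of
   [m + 1]. *)
have [n|n k|f uf] := @energy_compact u (1 + (m + 1)).
- by rewrite nrm_le; [rewrite u1; nra|lra].
- rewrite nrm_le; last lra.
  apply: le_trans (um n k) _.
  have : n.+1%:R^-1 <= 1 :> R by rewrite invf_le1 ?ler1n.
  move: n.+1%:R^-1 => x; nra.
exists f; split.
- exact: Nlim uf Nu.
- have uf1 : nsq (u n) @[n --> F] --> (1 : R).
    by under eq_fun do rewrite u1; exact: cvg_cst.
  exact: (cvg_unique (@Rhausdorff R) (hcvg_nsq uf) uf1).
- move=> k.
  have h : nsq (dquot U k (u n)) @[n --> F] --> nsq (dquot U k f).
    by apply: hcvg_nsq; exact: hcvg_dquot.
  apply: (ler_cvg_to h Finv).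
  by apply: filterE => n; exact: um.
Qed.

(** Homogeneous form of attaining the infimum: it admits 0 and defines a subspace. *)
Definition minimizer f := N f /\ forall k, nsq (dquot U k f) <= m * nsq f.

Lemma energy_approx f (eps : R) : N f -> 0 < eps ->
  exists k0, forall k, (k0 <= k)%N -> m * nsq f - eps < nsq (dquot U k f).
Proof.
move=> Nf e0; apply: contrapT => nk.
have : m * nsq f <= m * nsq f - eps; last lra.
apply: inf_energy_le => // k; rewrite leNgt; apply/negP => hk; apply: nk; exists k => j kj.
by rewrite (lt_le_trans hk)// -ler_nrm nrm_dquot_le.
Qed.

(** The energies of [f + g] and [f - g] add up to at most [m * nsq (f + g) + m * nsq (f - g)] by two
    parallelogram identities. As [f - g] takes at least its share, [f + g] cannot exceed its own.
    That lower bound concerns the supremum over [k], hence the [eps] and the large index. *)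
Lemma minimizerD f g : minimizer f -> minimizer g -> minimizer (f + g).
Proof.
move=> [Nf hf] [Ng hg]; split; first by have := NP 1 Nf Ng; rewrite scale1r.
have NB : N (f - g) by have := NP (-1) Ng Nf; rewrite scaleN1r addrC.
move=> k; apply/ler_addgt0Pr => eps e0.
have [k0 hk] := energy_approx NB e0.
have kk : (k <= maxn k0 k)%N by rewrite leq_maxr.
have {}hk := hk _ (leq_maxl k0 k).
have := nrm_dquot_le UU (f + g) kk; rewrite ler_nrm.
have := parallelogram (dquot U (maxn k0 k) f) (dquot U (maxn k0 k) g).
rewrite -dquotB// -dquotD//; have := hf (maxn k0 k); have := hg (maxn k0 k).
have := parallelogram f g.
move: (nsq (f + g)) (nsq (f - g)) hk => a b; nra.
Qed.

Lemma minimizerZ c f : minimizer f -> minimizer (c *: f).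
Proof.
move=> [Nf hf]; split; first exact: NZ.
by move=> k; rewrite dquotZ// (nsqZ c (dquot U k f)) (nsqZ c f) mulrCA ler_wpM2l ?sqn_ge0.
Qed.

Lemma minimizerU t f : minimizer f -> minimizer (U t f).
Proof.
move=> [Nf hf]; split; first exact: NU.
by move=> k; rewrite dquotU// !ug_nsq.
Qed.

Lemma minimizer_dquot k f : minimizer f -> minimizer (dquot U k f).
Proof.
move=> mf; apply: minimizerZ; rewrite -scaleN1r; apply: minimizerD.
  exact: minimizerU.
exact: minimizerZ.
Qed.

Lemma minimizer_nsq f : minimizer f -> nsq (dquot U k f) @[k --> F] --> m * nsq f.
Proof.
move=> [Nf hf]; apply: cvgF; apply/cvgrPdist_lt => eps e0.
have [k0 hk] := energy_approx Nf e0; exists k0 => // k /= /hk.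
by have := hf k; rewrite ltr_norml; lra.
Qed.

(** The quotients of a minimizer are minimizers with bounded norm and energy, so they converge along
    [F]: the generator acts on minimizers. *)
Lemma minimizer_lim f : minimizer f ->
  exists2 h, minimizer h & hcvg F (fun k => dquot U k f) h.
Proof.
move=> mf; have m0 : 0 <= m.
  by apply: lb_le_inf; [have [] := has_inf_energy|move=> a [g [_ _ /(_ 0%N)]]; apply: le_trans; exact: nsq_ge0].
have b1 k : nsq (dquot U k f) <= m * nsq f by have [_] := mf.
have b2 n k : nsq (dquot U k (dquot U n f)) <= m * (m * nsq f).
  have [_ /(_ k) h] := minimizer_dquot n mf.
  by apply: le_trans h _; rewrite ler_wpM2l.
have [n|n k|h hh] := @energy_compact (fun k => dquot U k f)
    (Num.sqrt (m * nsq f) + Num.sqrt (m * (m * nsq f))).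
- by apply: le_trans (ler_wsqrtr (b1 n)) _; rewrite lerDl sqrtr_ge0.
- by apply: le_trans (ler_wsqrtr (b2 n k)) _; rewrite lerDr sqrtr_ge0.
exists h => //; split.
  by apply: (Nlim FF hh) => n; have [] := minimizer_dquot n mf.
move=> k; apply: (ler_cvg_to (hcvg_nsq (hcvg_dquot UU k hh))).
  by apply: cvgMr; exact: hcvg_nsq hh.
by apply: filterE => n; have [_] := minimizer_dquot n mf.
Qed.

(** The derivative of e^(i sigma x) at 0, read along the dyadic steps. *)
Lemma cvg_dquot_expi (sigma : R) :
  sqn ((2 ^+ k)%:C * (expi (sigma * step R k) - 1) - Complex 0 sigma)
    @[k --> \oo] --> (0 : R).
Proof.
have step0 : step R k @[k --> \oo] --> 0^'.
  apply: cvg_trans (_ : _ --> within (fun x => x != 0) (nbhs (0 : R))); last by [].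
  move=> A [e e0 hA]; have /cvgr0Pnorm_lt/(_ _ e0)[K _ hK] := @cvg_step R.
  exists K => // n /= /hK h; apply: hA; rewrite /= ?sub0r ?normrN//.
  by rewrite gt_eqF// step_gt0.
have dq (p : R -> R) (a : R) : is_derive (0 : R) (1 : R) p a ->
    2 ^+ k * (p (step R k) - p 0) @[k --> \oo] --> a.
  move=> [dp <-].
  have := cvg_comp _ _ step0 dp.
  apply: cvg_trans; apply: near_eq_cvg; near=> k => /=.
  rewrite scaler1 addr0 /GRing.scale /=; congr (_ * _).
  by rewrite /step exprVn invrK.
have sc (q : R -> R) (b : R) : is_derive (sigma * 0) (1 : R) q b ->
    is_derive (0 : R) (1 : R) (fun x => q (sigma * x)) (b * sigma).
  move=> hq; have h : is_derive (0 : R) 1 (fun x => sigma * x) sigma.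
    by apply: is_derive_eq; rewrite /GRing.scale /= mulr1.
  exact: (is_derive1_comp (g := fun x => sigma * x) hq h).
apply: cvg_sqn0.
  have /sc/dq := is_derive_cos (sigma * 0).
  rewrite mulr0 sin0 oppr0 mul0r cos0; apply: cvg_trans; apply: near_eq_cvg.
  by near=> k; rewrite ReB ReM /= !mul0r !subr0.
have /sc/dq := is_derive_sin (sigma * 0).
rewrite mulr0 cos0 mul1r sin0 => h1.
have h2 : 2 ^+ k * (sin (sigma * step R k) - 0) - sigma @[k --> \oo] --> (0 : R).
  by have := cvgB h1 (cvg_cst sigma); rewrite subrr; apply.
apply: cvg_trans h2; apply: near_eq_cvg.
by near=> k; rewrite ImB ImM ImB /=; ring.
Unshelve. all: by end_near. Qed.

Lemma ugroup_twist (sigma : R) : ugroup (fun t f => expi (sigma * t) *: U t f).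
Proof.
split.
- by move=> t c f g; rewrite ugl// scalerDr !scalerA [c * _]mulrC.
- move=> t f g; rewrite dotZl dotZr mulrA mul_conjc sqn_expi mul1r.
  exact: ugdot.
- by move=> f; rewrite mulr0 expi0 scale1r ug0.
- by move=> s t f; rewrite ugZ// scalerA -expiD mulrDr ugS.
- move=> f t0; apply: (@hcvg_le _ _ _ _ _ (fun t =>
    nrm (U t f - U t0 f) + Num.sqrt (sqn (expi (sigma * t) - expi (sigma * t0))) * nrm f)).
    move=> t; rewrite -(subrKA (expi (sigma * t) *: U t0 f)) -scalerBr -scalerBl.
    by apply: le_trans (nrmD _ _) _; rewrite !nrmZ sqn_expi sqrtr1 mul1r ug_nrm.
  apply: cvg0D; first exact: (ugc UU f t0).
  apply: cvg0Ml.
  apply: cvg_sqrt0.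
  have h : sigma * t @[t --> t0] --> sigma * t0 by apply: cvgMr; exact: cvg_id.
  exact: (cvg_comp _ _ h (@cvg_expi R (sigma * t0))).
Qed.

(** Twisting the group by e^(- i sigma t) makes the difference quotients of [v] tend to 0, and the
    claim becomes that [v] is fixed by the twisted group. *)
Lemma eigenvector_of_dquot v (sigma : R) :
  hcvg F (fun k => dquot U k v) (Complex 0 sigma *: v) ->
  forall t, U t v = expi (sigma * t) *: v.
Proof.
move=> hv t; pose W := fun t f => expi (- sigma * t) *: U t f.
have WW : ugroup W by exact: ugroup_twist.
have W0 : hcvg F (fun k => dquot W k v) 0.
  apply: (@hcvg_le _ _ _ _ _ (fun k => nrm (dquot U k v - Complex 0 sigma *: v) +
    Num.sqrt (sqn ((2 ^+ k)%:C * (expi (sigma * step R k) - 1) - Complex 0 sigma)) * nrm v)).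
    move=> k; rewrite subr0.
    set E := expi (- sigma * step R k).
    have EE : E * expi (sigma * step R k) = 1 by rewrite /E mulNr expiN.
    have -> : dquot W k v = E *: ((dquot U k v - Complex 0 sigma *: v) -
        ((2 ^+ k)%:C * (expi (sigma * step R k) - 1) - Complex 0 sigma) *: v).
      rewrite scalerBl opprB addrA subrK /dquot /W -/E -[(_ * _) *: v]scalerA -scalerBr.
      rewrite scalerA [E * _]mulrC -scalerA; congr (_ *: _).
      by rewrite scalerBl scale1r opprB addrA subrK scalerBr scalerA EE scale1r.
    rewrite nrmZ sqn_expi sqrtr1 mul1r (le_trans (nrmB _ _))// nrmZ//.
  apply: cvg0D; first exact: hv.
  apply: cvg0Ml; apply: cvg_sqrt0.
  exact/cvgF/cvg_dquot_expi.
(* The norms are nondecreasing in [k] and tend to 0, so all of them vanish and [lipschitz] applies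
   with constant 0. *)
have Wk k : nrm (dquot W k v) <= 0.
  apply/ler_addgt0Pr => eps e0; rewrite add0r.
  have Fk : F [set n | (k <= n)%N] by apply: Foo; exists k.
  move/hcvgP : W0 => /(_ _ e0) FW; have [n [kn]] := filter_ex (filterI Fk FW).
  by rewrite subr0 => /ltW; apply: le_trans; exact: nrm_dquot_le.
have := lipschitz WW Wk t; rewrite mul0r => h.
have /nrm_eq0/eqP : nrm (W t v - v) = 0 by apply/eqP; rewrite eq_le h nrm_ge0.
rewrite subr_eq0 /W => /eqP h'; rewrite -[v in RHS]h' scalerA.
by rewrite mulNr mulrC expiN scale1r.
Qed.

(** For a unit minimizer [f], let [h] be D f and [h'] be D^2 f. Then [nsq h' = m ^ 2] and, D being
    skew, [Re (dot h' f) = - m]; together these force [h' = - m f]. *)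
Theorem eigenvector_ex : exists v, [/\ N v, v <> 0 &
  exists sigma : R, forall t, U t v = expi (sigma * t) *: v].
Proof.
have [f [Nf f1 fm]] := energy_min.
have mf : minimizer f by split=> // k; rewrite f1 mulr1.
have m0 : 0 <= m by have := fm 0%N; apply: le_trans; exact: nsq_ge0.
have [h mh fh] := minimizer_lim mf; have [h' mh' hh'] := minimizer_lim mh.
have h_nsq : nsq h = m.
  rewrite (cvg_unique (@Rhausdorff R) (hcvg_nsq fh) (minimizer_nsq mf)) f1.
  by rewrite mulr1.
have h'_nsq : nsq h' = m ^+ 2.
  by rewrite (cvg_unique (@Rhausdorff R) (hcvg_nsq hh') (minimizer_nsq mh)) h_nsq.
have U_small g : hcvg F (fun k => U (- step R k) g) g.
  have /hcvgP hg := ugc UU g 0; rewrite (ug0 UU) in hg; apply/hcvgP => eps e0.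
  have step0 : - step R k @[k --> F] --> (0 : R).
    by rewrite -[0]oppr0; apply: cvgN; apply: cvgF; exact: cvg_step.
  exact: step0 _ (hg _ e0).
(* The adjoint of [dquot U k] is [- U (- step k)] composed with [dquot U k]; the extra translation
   disappears in the limit by strong continuity. *)
have Uh : hcvg F (fun k => U (- step R k) (dquot U k f)) h.
  apply: (@hcvg_le _ _ _ _ _ (fun k => nrm (dquot U k f - h) + nrm (U (- step R k) h - h))).
    move=> k; rewrite -(subrKA (U (- step R k) h)) -ugB//.
    by apply: le_trans (nrmD _ _) _; rewrite ug_nrm.
  by apply: cvg0D; [exact: fh|exact: U_small].
have h'f : Re (dot h' f) = - m.
  have l1 : Re (dot (dquot U k h) f) @[k --> F] --> Re (dot h' f) by exact: hcvg_dotl.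
  apply: (cvg_unique (@Rhausdorff R) l1).
  have -> : (fun k => Re (dot (dquot U k h) f)) =
      (fun k => - Re (dot (U (- step R k) (dquot U k f)) h)).
    apply/funext => k.
    have E : dot (dquot U k h) f = dot h (- U (- step R k) (dquot U k f)).
      rewrite [dquot U k f]/dquot (ugZ UU) (ugB UU) (ugK UU) -scalerN opprB.
      by rewrite /dquot dotZl dotZr conjc_real dotBl dotBr (ug_adj UU).
    by rewrite E -ReN -dotNl Re_dotC.
  rewrite -h_nsq; apply: cvgN; exact: hcvg_dotl Uh.
have h'E : h' = (- m)%:C *: f.
  apply/eqP; rewrite -subr_eq0; apply/eqP/dot_def; rewrite -/(nsq _).
  rewrite nsqB nsqZ sqnR dotZr conjc_real ReM /= mul0r subr0 h'f f1 h'_nsq; ring.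
have [Nh _] := mh.
pose s := Num.sqrt m.
have ss : s * s = m by rewrite -expr2 sqr_sqrtr.
(* Since (D - i s) (D + i s) f = 0, the vector [g] = (D + i s) f satisfies D g = i s g. If it
   vanishes, [f] itself has eigenvalue - i s. *)
pose g := h + Complex 0 s *: f.
have gs : hcvg F (fun k => dquot U k g) (Complex 0 s *: g).
  have -> : Complex 0 s *: g = h' + Complex 0 s *: h.
    rewrite /g scalerDr scalerA h'E addrC; congr (_ *: _ + _).
    by apply: complex_eqP; rewrite ?ReM ?ImM /= ?ss; ring.
  under eq_fun do rewrite /g dquotD// dquotZ//.
  by apply: hcvgD => //; exact: hcvgZ.
have f0 : f <> 0 by move=> f0; move: f1; rewrite f0 nsq0 => /esym/eqP; rewrite oner_eq0.
have [g0|/eqP g0] := eqVneq g 0; last first.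
  exists g; split=> //; first by rewrite /g addrC; exact: NP.
  by exists s; exact: eigenvector_of_dquot.
exists f; split=> //; exists (- s); apply: eigenvector_of_dquot.
suff <- : h = Complex 0 (- s) *: f by [].
apply/eqP; rewrite -subr_eq0; apply/eqP; rewrite -g0 /g -scaleNr; congr (_ + _ *: _).
by apply: complex_eqP; rewrite ?ReN ?ImN /= ?opprK ?oppr0.
Qed.

End eigenvectors.

(** * Square-integrable real functions and their completeness *)

Section geometric.
Variable R : realType.

Lemma geometric_cvg (w : nat -> R) (s : R) :
  (forall k, `|w k.+1 - w k| <= s * 4^-1 ^+ k) ->
  exists l, w k @[k --> \oo] --> l /\ forall k, `|w k - l| <= 2 * s * 4^-1 ^+ k.
Proof.
move=> h; have s0 : 0 <= s by have := h 0%N; rewrite expr0 mulr1; exact: le_trans.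
have q0 k : 0 <= 4^-1 ^+ k :> R by rewrite exprn_ge0.
(* The subtracted term closes the induction: it drops by [3 / 2 * s * 4^-1 ^ (k + n)] at each step,
   more than the increment [s * 4^-1 ^ (k + n)]. *)
have key k n : `|w (k + n)%N - w k| <= 2 * s * 4^-1 ^+ k - 2 * s * 4^-1 ^+ (k + n).
  elim: n => [|n IH]; first by rewrite addn0 subrr normr0 subrr.
  rewrite -(subrKA (w (k + n)%N)); apply: le_trans (ler_normD _ _) _.
  rewrite addnS; have := h (k + n)%N; have := mulr_ge0 s0 (q0 (k + n)%N).
  by move: IH; rewrite exprS; move: (4^-1 ^+ (k + n)) (4^-1 ^+ k) => a b; lra.
have key2 k n : `|w (k + n)%N - w k| <= 2 * s * 4^-1 ^+ k.
  by apply: le_trans (key k n) _; rewrite gerBl !mulr_ge0.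
have geo0 : 2 * s * 4^-1 ^+ k @[k --> \oo] --> (0 : R).
  rewrite -[0](mulr0 (2 * s)); apply: cvgMr; apply: cvg_expr.
  by rewrite ger0_norm// invf_lt1// ltr1n.
have cw : cvgn w.
  apply: cauchy_cvg; apply: cauchy_exP => eps e0.
  have /cvgr0Pnorm_lt/(_ _ e0)[k _ /(_ k (leqnn k)) /= hk] := geo0.
  exists (w k); exists k => // n /= kn; rewrite /ball /= distrC.
  apply: le_lt_trans hk; rewrite -(subnKC kn) [leRHS]ger0_norm ?key2//.
  by rewrite !mulr_ge0.
exists (limn w); split=> // k.
have h1 : `|w n - w k| @[n --> \oo] --> `|limn w - w k|.
  by apply: cvg_norm; apply: cvgB => //; exact: cvg_cst.
rewrite distrC; apply: (ler_cvg_to h1 (cvg_cst _)).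
by exists k => // n /= kn; rewrite -(subnKC kn) key2.
Qed.

End geometric.

Section square_integrable.
Context d (T : measurableType d) (R : realType) (mu : {measure set T -> \bar R}).
Variables (D : set T) (mD : measurable D).
Implicit Types (f g : T -> R).

Definition qint f : \bar R := (\int[mu]_(x in D) (f x ^+ 2)%:E)%E.

Definition sqint f := measurable_fun D f /\ (qint f < +oo)%E.

Lemma measurable_sqr f : measurable_fun D f ->
  measurable_fun D (fun x => (f x ^+ 2)%:E : \bar R).
Proof. by move=> mf; apply/measurable_EFinP; exact: measurable_funX. Qed.

Lemma qint_ge0 f : (0 <= qint f)%E.
Proof. by apply: integral_ge0 => x _; rewrite lee_fin sqr_ge0. Qed.

Lemma qintD f g : measurable_fun D f -> measurable_fun D g ->
  (qint (fun x => f x + g x)%R <= 2%:E * qint f + 2%:E * qint g)%E.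
Proof.
move=> mf mg; rewrite /qint -!ge0_integralZl//; last 4 first.
- exact: measurable_sqr.
- by move=> x _; rewrite lee_fin sqr_ge0.
- exact: measurable_sqr.
- by move=> x _; rewrite lee_fin sqr_ge0.
rewrite -ge0_integralD//; last 4 first.
- by move=> x _; rewrite mule_ge0// lee_fin sqr_ge0.
- by apply: measurable_funeM; exact: measurable_sqr.
- by move=> x _; rewrite mule_ge0// lee_fin sqr_ge0.
- by apply: measurable_funeM; exact: measurable_sqr.
apply: ge0_le_integral => //.
- by move=> x _; rewrite lee_fin sqr_ge0.
- by apply: measurable_sqr; exact: measurable_funD.
- by apply: emeasurable_funD; apply: measurable_funeM; exact: measurable_sqr.
- move=> x _; rewrite -!EFinM -EFinD lee_fin.
  by have := sqr_ge0 (f x - g x); nra.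
Qed.

Lemma qintZ (c : R) f : measurable_fun D f ->
  qint (fun x => c * f x)%R = ((c ^+ 2)%:E * qint f)%E.
Proof.
move=> mf; rewrite /qint -ge0_integralZl ?lee_fin ?sqr_ge0//.
- by apply: eq_integral => x _; rewrite exprMn EFinM.
- exact: measurable_sqr.
- by move=> x _; rewrite lee_fin sqr_ge0.
Qed.

Lemma sqintD f g : sqint f -> sqint g -> sqint (fun x => f x + g x).
Proof.
move=> [mf qf] [mg qg]; split; first exact: measurable_funD.
by apply: le_lt_trans (qintD mf mg) _; rewrite lte_add_pinfty// lte_mul_pinfty.
Qed.

Lemma sqintZ c f : sqint f -> sqint (fun x => c * f x).
Proof.
move=> [mf qf]; split; first exact: measurable_funM.
by rewrite qintZ// lte_mul_pinfty ?lee_fin ?sqr_ge0.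
Qed.

Lemma sqintB f g : sqint f -> sqint g -> sqint (fun x => f x - g x).
Proof.
move=> hf /(sqintZ (-1)) hg; rewrite (_ : (fun x => _) = (fun x => f x + -1 * g x)).
  exact: sqintD.
by apply/funext => x; rewrite mulN1r.
Qed.

Lemma sqint_integrableM f g : sqint f -> sqint g ->
  mu.-integrable D (EFin \o (fun x => f x * g x)).
Proof.
move=> [mf qf] [mg qg].
apply: (@le_integrable _ _ _ _ _ mD _ (fun x => (f x ^+ 2)%:E + (g x ^+ 2)%:E)%E).
- by apply/measurable_EFinP; exact: measurable_funM.
- move=> x _ /=; rewrite lee_fin [leRHS]ger0_norm ?addr_ge0 ?sqr_ge0//.
  have := sqr_ge0 (f x - g x); have := sqr_ge0 (f x + g x).
  by rewrite ler_norml; have := sqr_ge0 (f x); have := sqr_ge0 (g x); nra.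
apply: integrableD => //; apply/integrableP; split; try exact: measurable_sqr.
- by under eq_integral do rewrite gee0_abs ?lee_fin ?sqr_ge0//.
- by under eq_integral do rewrite gee0_abs ?lee_fin ?sqr_ge0//.
Qed.

Lemma qint_integrable f : sqint f -> mu.-integrable D (fun x => (f x ^+ 2)%:E).
Proof.
move=> [mf qf]; apply/integrableP; split; first exact: measurable_sqr.
by under eq_integral do rewrite gee0_abs ?lee_fin ?sqr_ge0//.
Qed.

Lemma qint_eq0 f : measurable_fun D f -> qint f = 0%E ->
  {ae mu, forall x, D x -> f x = 0}.
Proof.
move=> mf q0; have : ae_eq mu D (fun x => (f x ^+ 2)%:E) (cst 0%E).
  apply/ae_eq_integral_abs => //; first exact: measurable_sqr.
  by under eq_integral do rewrite gee0_abs ?lee_fin ?sqr_ge0//.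
by apply: filterS => x h /h [] /eqP; rewrite sqrf_eq0 => /eqP.
Qed.

End square_integrable.

Section square_integrable_complete.
Context d (T : measurableType d) (R : realType) (mu : {measure set T -> \bar R}).
Variables (D : set T) (mD : measurable D).
Local Notation qint := (qint mu D).
Local Notation sqint := (sqint mu D).

(* The sum [G] of the weighted squared increments of a fast subsequence is
   integrable, and [sqrt G] controls the subsequence geometrically. *)
Lemma sqint_complete (u : nat -> T -> R) : (forall n, sqint (u n)) ->
  (forall eps : R, 0 < eps -> exists N, forall m n, (N <= m)%N -> (N <= n)%N ->
     (qint (fun x => u m x - u n x)%R < eps%:E)%E) ->
  exists2 f, sqint f & forall eps : R, 0 < eps -> exists N, forall n, (N <= n)%N ->
     (qint (fun x => u n x - f x)%R < eps%:E)%E.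
Proof.
move=> su cu; have mu_ n : measurable_fun D (u n) by have [] := su n.
(* The rate 32 pays for two things: the weight 16^k of [g], which yields increments below
   [sqrt G * 4^-k], and a remaining factor 2^-k that keeps the integral of [G] at most 2. *)
have w0 k : 0 < 32^-1 ^+ k :> R by rewrite exprn_gt0// invr_gt0.
pose N k := projT1 (cid (cu _ (w0 k))).
have hN k m n : (N k <= m)%N -> (N k <= n)%N ->
    (qint (fun x => u m x - u n x)%R < (32^-1 ^+ k)%:E)%E.
  by rewrite /N; case: cid => ? /=; exact.
(* An index beyond every [N i] with [i <= k]; the summand [k] makes it unbounded. *)
pose phi k := (k + \sum_(i < k.+1) N i)%N.
have Nphi i k : (i <= k)%N -> (N i <= phi k)%N.
  move=> ik; apply: leq_trans (leq_addl _ _).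
  by rewrite (bigD1 (Ordinal (ik : i < k.+1)%N))//= leq_addr.
pose v k := u (phi k); pose dv k x : R := v k.+1 x - v k x.
have mv k : measurable_fun D (v k) by exact: mu_.
have mdv k : measurable_fun D (dv k) by exact: measurable_funB.
have qdv k : (qint (dv k) <= (32^-1 ^+ k)%:E)%E by apply/ltW/hN; apply: Nphi.
pose g k x : \bar R := ((16 ^+ k) * (dv k x) ^+ 2)%:E.
have g0 k x : (0 <= g k x)%E by rewrite lee_fin mulr_ge0 ?sqr_ge0 ?exprn_ge0.
have mg k : measurable_fun D (g k).
  by apply/measurable_EFinP; apply: measurable_funM => //; exact: measurable_funX.
pose G x : \bar R := (\sum_(0 <= k <oo) g k x)%E.
have mG : measurable_fun D G.
  by apply: ge0_emeasurable_sum => //.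
have G0 x : (0 <= G x)%E by apply: nneseries_ge0.
have iG : (\int[mu]_(x in D) G x <= 2%:E)%E.
  rewrite integral_nneseries//.
  apply: le_trans (@epsilon_trick0 R 2 xpredT (ler0n _ _)).
  apply: lee_nneseries => [k _ _|k _]; first exact: integral_ge0.
  rewrite /g; under eq_integral do rewrite EFinM.
  rewrite ge0_integralZl ?lee_fin ?exprn_ge0//; last 2 first.
  - exact: measurable_sqr.
  - by move=> x _; rewrite lee_fin sqr_ge0.
  apply: (@le_trans _ _ ((16 ^+ k)%:E * (32^-1 ^+ k)%:E)%E).
    by apply: lee_wpmul2l; [rewrite lee_fin exprn_ge0|exact: qdv].
  rewrite -EFinM lee_fin -exprMn natrX exprS invfM mulrA mulfV// mul1r.
  by rewrite -exprVn (_ : 16 / 32 = 2^-1 :> R)//; field.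
pose A := D `&` [set x | (G x < +oo)%E].
have mA : measurable A by apply: measurable_lte.
have aeA : {ae mu, forall x, D x -> A x}.
  have IG : mu.-integrable D G.
    apply/integrableP; split=> //; apply: le_lt_trans (ltry 2).
    by under eq_integral do rewrite gee0_abs ?G0//.
  apply: filterS (integrable_ae mD IG) => x h Dx; split=> //=.
  by rewrite ltey_eq h.
(* Cut off to [A], where [G] is finite, so that the sequence converges at every point. *)
pose h k x : R := \1_A x * v k x.
have mh k : measurable_fun D (h k).
  by apply: measurable_funM => //; apply: measurable_funTS.
have hcv x : exists l, h k x @[k --> \oo] --> l /\
    forall k, `|h k x - l| <= 2 * (\1_A x * Num.sqrt (fine (G x))) * 4^-1 ^+ k.
  apply: geometric_cvg => k; rewrite /h -mulrBr.
  rewrite normrM ger0_norm ?indic_ge0// -mulrA indicE; case: (boolP (x \in A)) => [xA|_]; last by rewrite !mul0r.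
  rewrite !mul1r; move: xA; rewrite inE => -[_ Gx].
  have fG : G x \is a fin_num by rewrite ge0_fin_numE.
  rewrite -(@ler_pXn2r _ 2)// ?nnegrE ?mulr_ge0 ?sqrtr_ge0 ?exprn_ge0//.
  rewrite real_normK ?num_real// exprMn sqr_sqrtr ?fine_ge0//.
  have : (g k x <= G x)%E.
    apply: le_trans (@nneseries_lim_ge R (g^~ x) xpredT 0 k.+1 _) => //.
    by rewrite big_nat_recr//= leeDr// sume_ge0.
  rewrite -(fineK fG) lee_fin -/(dv k x) => hg.
  have -> : (4^-1 ^+ k) ^+ 2 = (16 ^+ k)^-1 :> R.
    rewrite -exprM mulnC exprM (_ : 4^-1 ^+ 2 = 16^-1 :> R) ?exprVn//.
    by field.
  rewrite ler_pdivlMr ?exprn_gt0//.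
  by rewrite mulrC.
pose f x := projT1 (cid (hcv x)).
have hf x : h k x @[k --> \oo] --> f x by rewrite /f; case: cid => ? [].
have hb x k : `|h k x - f x| <= 2 * (\1_A x * Num.sqrt (fine (G x))) * 4^-1 ^+ k.
  by rewrite /f; case: cid => ? [] /= _; apply.
have mf : measurable_fun D f by apply: (measurable_fun_cvg mh) => x _; exact: hf.
(* Pointwise the squared error is at most [4 * 16^-k * G], and the integral of [G] is at most 2. *)
have qvf k : (qint (fun x => v k x - f x)%R <= (8 * 16^-1 ^+ k)%:E)%E.
  have -> : (8 * 16^-1 ^+ k)%:E = ((4 * 16^-1 ^+ k)%:E * 2%:E)%E :> \bar R.
    by rewrite -EFinM; congr EFin; ring.
  have c0 : (0 <= 4 * 16^-1 ^+ k :> R)%R by rewrite mulr_ge0// exprn_ge0.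
  apply: (@le_trans _ _ ((4 * 16^-1 ^+ k)%:E * \int[mu]_(x in D) G x)%E); last first.
    by apply: lee_wpmul2l.
  rewrite -ge0_integralZl//.
  apply: ae_ge0_le_integral => //.
  - by move=> x _; rewrite lee_fin sqr_ge0.
  - by apply: measurable_sqr => //; exact: measurable_funB.
  - by move=> x _; rewrite mule_ge0.
  - exact: measurable_funeM.
  apply: filterS aeA => x DA Dx; have [_ Gx] := DA Dx.
  have fG : G x \is a fin_num by rewrite ge0_fin_numE.
  have := hb x k; rewrite /h indicE mem_set ?mul1r; last exact: DA.
  rewrite -(fineK fG) -EFinM lee_fin => hk.
  rewrite -[leLHS]real_normK ?num_real//.
  apply: le_trans (_ : _ <= (2 * Num.sqrt (fine (G x)) * 4^-1 ^+ k) ^+ 2) _.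
    by rewrite ler_pXn2r// nnegrE ?mulr_ge0 ?sqrtr_ge0 ?exprn_ge0.
  rewrite !exprMn sqr_sqrtr ?fine_ge0//.
  have -> : (4^-1 ^+ k) ^+ 2 = 16^-1 ^+ k :> R.
    by rewrite -exprM mulnC exprM (_ : 4^-1 ^+ 2 = 16^-1 :> R)//; field.
  by rewrite (_ : 2 ^+ 2 = 4 :> R); [lra|ring].
have svf k : sqint (fun x => v k x - f x).
  by split; [exact: measurable_funB|apply: le_lt_trans (qvf k) _; rewrite ltry].
have sf : sqint f.
  have := sqintB mD (su (phi 0%N)) (svf 0%N).
  by rewrite (_ : (fun x => _) = f)//; apply/funext => x; rewrite opprB addrC subrK.
exists f => // eps e0.
have e4 : 0 < eps / 4 by rewrite divr_gt0.
have [M hM] := cu _ e4.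
have q16 : 8 * 16^-1 ^+ k @[k --> \oo] --> (0 : R).
  rewrite -[0](mulr0 8); apply: cvgMr; apply: cvg_expr.
  by rewrite ger0_norm// invf_lt1// ltr1n.
have /cvgr0Pnorm_lt/(_ _ e4)[K _ hK] := q16.
exists M => n Mn.
pose k := maxn K M.
have Mk : (M <= phi k)%N by rewrite (leq_trans (leq_maxr K M))// leq_addr.
have h1 := hM _ _ Mn Mk.
have h2 : (qint (fun x => v k x - f x)%R < (eps / 4)%:E)%E.
  apply: le_lt_trans (qvf k) _; rewrite lte_fin.
  have := hK k (leq_maxl _ _); apply: le_lt_trans.
  by rewrite ler_norm.
have := qintD mu mD (measurable_funB (mu_ n) (mv k)) (measurable_funB (mv k) mf).
rewrite (_ : (fun x => _) = (fun x => u n x - f x)); last first.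
  by apply/funext => x; rewrite /= subrKA.
move=> /le_lt_trans; apply.
have -> : eps%:E = (2%:E * (eps / 4)%:E + 2%:E * (eps / 4)%:E)%E.
  by rewrite -!EFinM -EFinD; congr EFin; field.
by apply: lteD; rewrite lte_pmul2l.
Qed.

End square_integrable_complete.

(** * Translation invariance of Lebesgue measure *)

Section translation.
Variable R : realType.
Local Notation mu := (@lebesgue_measure R).
Implicit Types (t : R) (f : R -> \bar R).

Lemma shift_preimage_itv t (i : interval R) :
  (fun x => x + t) @^-1` [set` i] =
  [set` Interval (match i with Interval (BSide b a) _ => BSide b (a - t)
                             | Interval (BInfty b) _ => BInfty _ b end)
                 (match i with Interval _ (BSide b a) => BSide b (a - t)
                             | Interval _ (BInfty b) => BInfty _ b end)].
Proof.
apply/seteqP; case: i => -[[] a|[]] -[[] b|[]]; split=> x /=;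
  rewrite !in_itv /= ?lerBlDr ?lerBrDr ?ltrBlDr ?ltrBrDr//.
Qed.

Lemma measurable_shift t :
  measurable_fun setT ((fun x : R => x + t) : measurableTypeR R -> measurableTypeR R).
Proof. by apply: measurable_funD => //; exact: measurable_cst. Qed.

(** Lebesgue measure is determined by its values on the generating intervals, whose length a
    translation preserves. *)
Lemma lebesgue_measure_shift t (A : set R) : measurable A ->
  pushforward mu ((fun x => x + t) : _ -> measurableTypeR R) A = mu A.
Proof.
move=> mA; apply/esym/lebesgue_measure_unique => //=; first exact: measurable_shift.
move=> _ _ [[a b]] _ <-.
rewrite /pushforward shift_preimage_itv/= !lebesgue_measure_itv/=.
by rewrite !lte_fin ltrD2r -!EFinB opprD opprK addrACA addNr addr0.
Qed.

Lemma ge0_integral_shift t f : measurable_fun setT f -> (forall x, 0 <= f x)%E ->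
  (\int[mu]_x f (x + t)%R = \int[mu]_x f x)%E.
Proof.
move=> mf f0; have ms := measurable_shift t.
have := @ge0_integral_pushforward _ _ (measurableTypeR R) (measurableTypeR R) R _ ms
  mu setT f measurableT mf (fun x _ => f0 x).
rewrite preimage_setT => <-.
by apply: eq_measure_integral => //= A mA _; exact: lebesgue_measure_shift.
Qed.

End translation.

(** * Variance bounded by increments *)

Section variance.
Variable R : realType.
Local Notation mu := (@lebesgue_measure R).
Variables (D : set (measurableTypeR R)) (mD : measurable D) (a L : R).
Hypotheses (L0 : 0 <= L) (DL : D `<=` `]a, a + L[%classic).
Implicit Types (g : R -> R).

Let Dfin : (mu D < +oo)%E.
Proof.
apply: (@le_lt_trans _ _ (mu `]a, a + L[%classic)).
  by apply: le_measure; rewrite ?inE//; exact: measurable_itv.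
by rewrite lebesgue_measure_itv; case: ifP => // _; rewrite -EFinB ltry.
Qed.

Lemma sqint_cst (c : R) : sqint mu D (fun=> c).
Proof.
split; first exact: measurable_cst.
by rewrite /qint integral_cst// lte_mul_pinfty// lee_fin sqr_ge0.
Qed.

Lemma sqint_integrable g : sqint mu D g -> mu.-integrable D (EFin \o g).
Proof.
move=> sg; have := @sqint_integrableM _ _ _ mu D mD _ _ sg (sqint_cst 1).
by rewrite (_ : (fun x => g x * 1) = g)//; apply/funext => x; rewrite mulr1.
Qed.

Lemma double_integral_sqr g : sqint mu D g ->
  (\int[mu]_(x in D) \int[mu]_(y in D) ((g x - g y) ^+ 2)%:E =
   (2 * fine (mu D) * (\int[mu]_(x in D) (g x ^+ 2)) -
    2 * (\int[mu]_(x in D) g x) ^+ 2)%:E)%E.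
Proof.
move=> sg; set I2 := \int[mu]_(x in D) (g x ^+ 2); set I1 := \int[mu]_(x in D) g x.
set M := fine (mu D).
have ig := sqint_integrable sg.
have ig2 : mu.-integrable D (EFin \o (fun x => g x ^+ 2)) by exact: (@qint_integrable _ _ _ mu D g sg).
have icst (c : R) : mu.-integrable D (EFin \o (fun=> c)).
  exact: sqint_integrable (sqint_cst c).
have EI (f : R -> R) : mu.-integrable D (EFin \o f) ->
    (\int[mu]_(x in D) (f x)%:E = (Rintegral mu D f)%:E)%E.
  by move=> f_; rewrite /Rintegral fineK//; exact: integrable_fin_num.
have iZ (c : R) (f : R -> R) : mu.-integrable D (EFin \o f) ->
    mu.-integrable D (EFin \o (fun x => c * f x)) by move=> f_; exact: (integrableZl mD c f_).
have iD (f h : R -> R) : mu.-integrable D (EFin \o f) -> mu.-integrable D (EFin \o h) ->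
    mu.-integrable D (EFin \o (fun x => f x + h x)) by move=> f_ h_; exact: (integrableD mD f_ h_).
have inner x : (\int[mu]_(y in D) ((g x - g y) ^+ 2)%:E =
    (M * g x ^+ 2 + (- 2 * I1 * g x + I2))%:E)%E.
  have E : (fun y => (g x - g y) ^+ 2) = (fun y => g x ^+ 2 + (- 2 * g x * g y + g y ^+ 2)).
    by apply/funext => y; ring.
  have iE : mu.-integrable D (EFin \o (fun y => - 2 * g x * g y + g y ^+ 2)).
    by apply: iD => //; exact: iZ.
  rewrite (EI (fun y => (g x - g y) ^+ 2)) E; last exact: iD.
  rewrite RintegralD//.
  rewrite RintegralD//; last exact: iZ.
  rewrite (RintegralZl (- 2 * g x) mD ig) Rintegral_cst// -/M -/I1 -/I2; congr EFin; ring.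
under eq_integral do rewrite inner.
rewrite EI; last first.
  by apply: (iD (fun x => M * g x ^+ 2)); [exact: iZ|apply: iD => //; exact: iZ].
rewrite RintegralD//; [|exact: iZ|by apply: iD => //; exact: iZ].
rewrite RintegralD//; last exact: iZ.
rewrite (RintegralZl M mD ig2) (RintegralZl (- 2 * I1) mD ig) Rintegral_cst// -/M -/I1 -/I2; congr EFin; ring.
Qed.

(** A slice [y = x + t] meets [D] x [D] only for [|t| < L]. The total length [2 * L] of these slices
    cancels the factor 2 of [double_integral_sqr]. *)
Lemma variance_bound g (K : R) : sqint mu D g -> 0 <= K ->
  (forall t : R, \int[mu]_(x in D `&` [set y | D (y + t)%R])
     ((g x - g (x + t)) ^+ 2)%:E <= K%:E)%E ->
  fine (mu D) * (\int[mu]_(x in D) (g x ^+ 2)) <=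
  (\int[mu]_(x in D) g x) ^+ 2 + L * K.
Proof.
move=> sg K0 hK; have [mg _] := sg.
pose q := g \_ D.
have mq : measurable_fun (setT : set (measurableTypeR R)) q.
  exact: (measurable_restrictT g mD).1 mg.
have mI : measurable_fun (setT : set (measurableTypeR R)) (\1_D : _ -> R).
  exact: measurable_indic.
(* Extending by indicators to the whole plane lets Tonelli and translation invariance apply without
   restricted domains. *)
pose Fn (z : R * R) : R := (q z.1 - q z.2) ^+ 2 * (\1_D z.1 * \1_D z.2).
have m1 : measurable_fun setT (fun z : measurableTypeR R * measurableTypeR R => z.1).
  exact: measurable_fst.
have m2 : measurable_fun setT (fun z : measurableTypeR R * measurableTypeR R => z.2).
  exact: measurable_snd.
have mF : measurable_fun setT (Fn : measurableTypeR R * measurableTypeR R -> R).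
  apply: measurable_funM.
    apply: measurable_funX; apply: measurable_funB.
      exact: (measurableT_comp mq m1).
    exact: (measurableT_comp mq m2).
  apply: measurable_funM.
    exact: (measurableT_comp mI m1).
  exact: (measurableT_comp mI m2).
have F0 z : 0 <= Fn z by rewrite /Fn !indicE mulr_ge0 ?sqr_ge0// mulr_ge0 ?ler0n.
(* The shear to the coordinates [x] and [t = y - x]; for fixed [x] it is a translation in the second
   variable. *)
pose Gn (z : R * R) : R := Fn (z.1, z.2 + z.1).
have mG : measurable_fun setT (Gn : measurableTypeR R * measurableTypeR R -> R).
  apply: (measurableT_comp mF); apply: measurable_fun_pair => //.
  exact: measurable_funD.
have key : (\int[mu]_(x in D) \int[mu]_(y in D) ((g x - g y) ^+ 2)%:E =
    \int[mu]_t \int[mu]_x (Gn (x, t))%:E)%E.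
  rewrite -(fubini_tonelli (m1 := mu) (m2 := mu) (fun z => (Gn z)%:E)); last 2 first.
  - exact/measurable_EFinP.
  - by move=> z; rewrite lee_fin; exact: F0.
  rewrite integral_mkcond; apply: eq_integral => x _; rewrite patchE.
  have -> : (\int[mu]_t (Gn (x, t))%:E = \int[mu]_t (Fn (x, t))%:E)%E.
    apply: (ge0_integral_shift x (f := fun y => (Fn (x, y))%:E)) => [|y].
      apply/measurable_EFinP; apply: (measurableT_comp mF).
      by apply: measurable_fun_pair => //; exact: measurable_cst.
    by rewrite lee_fin.
  case: ifPn => xD; last first.
    apply/esym/integral0_eq => y _; congr EFin.
    by rewrite /Fn /= !indicE (negbTE xD) mul0r mulr0.
  rewrite integral_mkcond; apply: eq_integral => y _.
  rewrite /Fn /= !indicE xD mul1r /q !patchE xD.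
  by case: ifPn => yD; rewrite ?mulr1// mulr0.
have := double_integral_sqr sg; rewrite key => Egrand.
have : (\int[mu]_t \int[mu]_x (Gn (x, t))%:E <= (2 * L * K)%:E)%E.
  have mItv : measurable (`]- L, L[%classic : set (measurableTypeR R)).
    exact: measurable_itv.
  apply: (@le_trans _ _ (\int[mu]_t (K%:E * (\1_(`]- L, L[%classic) t)%:E)%E)%E).
    apply: ge0_le_integral => //.
    - by move=> t _; apply: integral_ge0 => x _; rewrite lee_fin; exact: F0.
    - apply: (measurable_fun_fubini_tonelli_G (m1 := mu) (fun z => (Gn z)%:E)).
        exact/measurable_EFinP.
      by move=> z; rewrite lee_fin; exact: F0.
    - by apply: measurable_funeM; apply/measurable_EFinP; exact: measurable_indic.
    - move=> t _; rewrite indicE.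
      case: (boolP (t \in `]- L, L[%classic)) => tL.
        rewrite mule1; apply: le_trans (hK t); rewrite [leRHS]integral_mkcond.
        suff -> : (\int[mu]_x (Gn (x, t))%:E = \int[mu]_x ((fun x =>
            ((g x - g (x + t)) ^+ 2)%:E) \_ (D `&` [set y | D (y + t)%R])) x)%E by [].
        apply: eq_integral => x _; rewrite patchE /Gn /Fn /= !indicE /q !patchE in_setI.
        have -> : (x \in [set y | D (y + t)%R]) = (x + t \in D).
          by apply/idP/idP; rewrite !inE.
        rewrite [t + x]addrC; case: (x \in D); case: (x + t \in D);
          by rewrite /= ?mulr1 ?mulr0 ?mul0r ?mulr0.
      rewrite mule0 integral0_eq// => x _; congr EFin.
      rewrite /Gn /Fn /= !indicE; case: (boolP (x \in D)) => [xD|_]; last by rewrite mul0r mulr0.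
      case: (boolP (t + x \in D)) => [txD|_]; last by rewrite !mulr0.
      move: xD txD; rewrite !inE => /DL /= h1 /DL /= h2; exfalso.
      move/negP : tL; apply; rewrite inE /=.
      by move: h1 h2; rewrite /= !in_itv /=; lra.
  rewrite ge0_integralZl_EFin//; last exact/measurable_EFinP/measurable_indic.
  rewrite integral_indic// setIT.
  have hI : (mu (`]- L, L[%classic)%R <= (2 * L)%:E)%E.
    rewrite lebesgue_measure_itv /= lte_fin; case: ifP => _; last by rewrite lee_fin mulr_ge0.
    by rewrite -EFinB lee_fin; lra.
  by rewrite mulrC EFinM; apply: lee_wpmul2l hI.
rewrite Egrand lee_fin; lra.
Qed.

End variance.

#[local] Instance ae_lebesgue_filter (R : realType) :
  Filter (nbhs (almost_everywhere (@lebesgue_measure R))).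
Proof. exact: ae_filter_ringOfSetsType. Qed.

(** * Complex square-integrable functions on a domain *)

Section complex_L2.
Variable R : realType.
Local Notation mu := (@lebesgue_measure R).

Record domain := Domain {
  domain_set :> set (measurableTypeR R) ;
  domain_measurable : measurable domain_set ;
  domain_gt0 : (0 < mu domain_set)%E ;
  domain_fin : (mu domain_set < +oo)%E
}.

Lemma Lfun2_sqint (O : domain) (u : R -> R) :
  (u \_ O : R -> R) \in Lfun mu 2%:E <-> sqint mu O u.
Proof.
have mO := domain_measurable O.
have E : (\int[mu]_x (((u \_ O) x) ^+ 2)%:E = qint mu O u)%E.
  rewrite /qint [RHS]integral_mkcond; apply: eq_integral => x _.
  by rewrite !patchE; case: ifP => // _; rewrite expr0n.
split=> [h|[mu_ qu]].
  have m1 : measurable_fun (setT : set (measurableTypeR R)) (u \_ O).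
    by move: h; rewrite inE => /andP[]; rewrite inE.
  split; first exact: (measurable_restrictT u mO).2.
  by rewrite -E; apply: integrable_lty => //; exact: Lfun2_integrable_sqr.
have m1 : measurable_fun (setT : set (measurableTypeR R)) (u \_ O).
  exact: (measurable_restrictT u mO).1.
rewrite inE; apply/andP; split; rewrite inE//= /finite_norm unlock /=.
apply: poweR_lty; rewrite (_ : integral _ _ _ = qint mu O u)// -E.
apply: eq_integral => x _.
by congr EFin; rewrite powR_mulrn// real_normK ?num_real.
Qed.

Definition cintegrable (O : set (measurableTypeR R)) (f : R -> R[i]) :=
  mu.-integrable O (EFin \o (fun x => Re (f x))) /\
  mu.-integrable O (EFin \o (fun x => Im (f x))).

Section fixed_domain.
Variable O : domain.
Let mO := domain_measurable O.
Implicit Types (f g h : R -> R[i]) (c : R[i]).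

Lemma L2P f : L2 O f <-> sqint mu O (fun x => Re (f x)) /\ sqint mu O (fun x => Im (f x)).
Proof. by split=> -[/Lfun2_sqint h1 /Lfun2_sqint h2]. Qed.

Lemma L2_lin c f g : L2 O f -> L2 O g -> L2 O (fun x => c * f x + g x).
Proof.
move=> /L2P[f1 f2] /L2P[g1 g2]; apply/L2P; split.
  under eq_fun do rewrite ReD ReM.
  by apply: sqintD => //; apply: sqintB => //; exact: sqintZ.
under eq_fun do rewrite ImD ImM.
by apply: sqintD => //; apply: sqintD => //; exact: sqintZ.
Qed.

Lemma L2_0 : L2 O (fun=> 0).
Proof.
apply/L2P; split; split; rewrite /=; try exact: measurable_cst.
- by rewrite /qint integral0_eq// => x _; rewrite expr0n.
- by rewrite /qint integral0_eq// => x _; rewrite expr0n.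
Qed.

Lemma L2D f g : L2 O f -> L2 O g -> L2 O (fun x => f x + g x).
Proof.
move=> hf hg; rewrite (_ : (fun x => _) = (fun x => 1 * f x + g x)).
  exact: L2_lin.
by apply/funext => x; rewrite mul1r.
Qed.

Lemma L2Z c f : L2 O f -> L2 O (fun x => c * f x).
Proof.
move=> hf; rewrite (_ : (fun x => _) = (fun x => c * f x + 0)).
  by apply: L2_lin => //; exact: L2_0.
by apply/funext => x; rewrite addr0.
Qed.

Lemma L2N f : L2 O f -> L2 O (fun x => - f x).
Proof.
move=> /(L2Z (-1)); rewrite (_ : (fun x => _) = (fun x => - f x))//.
by apply/funext => x; rewrite mulN1r.
Qed.

Lemma L2B f g : L2 O f -> L2 O g -> L2 O (fun x => f x - g x).
Proof. by move=> hf hg; apply: L2D => //; exact: L2N. Qed.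

Lemma L2_sum (I : Type) (s : seq I) (F : I -> R -> R[i]) :
  (forall i, L2 O (F i)) -> L2 O (fun x => \sum_(i <- s) F i x).
Proof.
move=> hF; elim: s => [|i s IH].
  by under eq_fun do rewrite big_nil; exact: L2_0.
by under eq_fun do rewrite big_cons; exact: L2D.
Qed.

Lemma L2_cintegrable f g : L2 O f -> L2 O g -> cintegrable O (fun x => f x * (g x)^*).
Proof.
move=> /L2P[f1 f2] /L2P[g1 g2]; split.
  rewrite (_ : _ \o _ = (fun x => (Re (f x) * Re (g x))%:E + (Im (f x) * Im (g x))%:E)%E).
    by apply: integrableD => //; exact: sqint_integrableM.
  by apply/funext => x; rewrite /= ReM ReJ ImJ -EFinD; congr EFin; ring.
rewrite (_ : _ \o _ = (fun x => (Im (f x) * Re (g x))%:E - (Re (f x) * Im (g x))%:E)%E).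
  by apply: integrableB => //; exact: sqint_integrableM.
by apply/funext => x; rewrite /= ImM ReJ ImJ -EFinB; congr EFin; ring.
Qed.

Lemma cintegral_lin c f g : cintegrable O f -> cintegrable O g ->
  cintegral mu O (fun x => c * f x + g x) = c * cintegral mu O f + cintegral mu O g.
Proof.
move=> [f1 f2] [g1 g2].
have Z (a : R) (u : R -> R) : mu.-integrable O (EFin \o u) ->
    mu.-integrable O (EFin \o (fun x => a * u x)) by move=> hu; exact: (integrableZl mO a hu).
have D (u v : R -> R) : mu.-integrable O (EFin \o u) -> mu.-integrable O (EFin \o v) ->
    mu.-integrable O (EFin \o (fun x => u x + v x)) by move=> hu hv; exact: (integrableD mO hu hv).
apply: complex_eqP; rewrite /cintegral ?ReD ?ReM ?ImD ?ImM /=.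
  rewrite (_ : (fun x => _) = (fun x => (Re c * Re (f x) + - Im c * Im (f x)) + Re (g x))).
    rewrite RintegralD//; last by apply: D; exact: Z.
    rewrite RintegralD ?RintegralZl//; try exact: Z.
    by rewrite mulNr.
  by apply/funext => x; rewrite ReD ReM mulNr.
rewrite (_ : (fun x => _) = (fun x => (Re c * Im (f x) + Im c * Re (f x)) + Im (g x))).
  rewrite RintegralD//; last by apply: D; exact: Z.
  by rewrite RintegralD ?RintegralZl//; exact: Z.
by apply/funext => x; rewrite ImD ImM.
Qed.

Lemma aeq_refl f : aeq O f f. Proof. exact: aeW. Qed.

Lemma aeq_sym f g : aeq O f g -> aeq O g f.
Proof. by apply: filterS => x h /h. Qed.

Lemma aeq_trans g f h : aeq O f g -> aeq O g h -> aeq O f h.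
Proof. by apply: filterS2 => x h1 h2 Ox; rewrite h1// h2. Qed.

Lemma aeq_lin c f g f' g' : aeq O f f' -> aeq O g g' ->
  aeq O (fun x => c * f x + g x) (fun x => c * f' x + g' x).
Proof. by apply: filterS2 => x h1 h2 Ox; rewrite h1// h2. Qed.

Lemma cintegral_aeq f g : cintegrable O f -> cintegrable O g -> aeq O f g ->
  cintegral mu O f = cintegral mu O g.
Proof.
move=> [f1 f2] [g1 g2] fg; rewrite /cintegral /Rintegral; congr Complex; congr fine.
  apply: ae_eq_integral => //; [exact: measurable_int f1|exact: measurable_int g1|].
  by apply: filterS fg => x h Ox; rewrite h.
apply: ae_eq_integral => //; [exact: measurable_int f2|exact: measurable_int g2|].
by apply: filterS fg => x h Ox; rewrite h.
Qed.

Lemma dotp_lin c f g h : L2 O f -> L2 O g -> L2 O h ->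
  dotp O (fun x => c * f x + g x) h = c * dotp O f h + dotp O g h.
Proof.
move=> hf hg hh; rewrite /dotp mulrCA -mulrDr; congr (_ * _).
rewrite -cintegral_lin; try exact: L2_cintegrable.
by congr cintegral; apply/funext => x; rewrite mulrDl mulrA.
Qed.

Lemma dotp_conj f g : L2 O f -> L2 O g -> dotp O g f = (dotp O f g)^*.
Proof.
move=> hf hg; rewrite /dotp conjcM conjc_real; congr (_ * _).
rewrite /cintegral; apply: complex_eqP; rewrite ?ReJ ?ImJ /=.
  by apply: eq_Rintegral => x _; rewrite !ReM !ReJ !ImJ; ring.
have [_ h2] := L2_cintegrable hf hg.
rewrite -mulN1r -RintegralZl//.
by apply: eq_Rintegral => x _; rewrite !ImM !ReJ !ImJ; ring.
Qed.

Lemma dotp_aeql f f' g : L2 O f -> L2 O f' -> L2 O g -> aeq O f f' ->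
  dotp O f g = dotp O f' g.
Proof.
move=> hf hf' hg ff'; rewrite /dotp; congr (_ * _).
apply: cintegral_aeq; try exact: L2_cintegrable.
by apply: filterS ff' => x h Ox; rewrite h.
Qed.

Lemma dotp_aeqr f g g' : L2 O f -> L2 O g -> L2 O g' -> aeq O g g' ->
  dotp O f g = dotp O f g'.
Proof.
by move=> hf hg hg' gg'; rewrite dotp_conj// (dotp_aeql _ hg' hf gg')// -dotp_conj.
Qed.

Lemma vol_gt0 : 0 < fine (mu O).
Proof. by apply: fine_gt0; rewrite domain_gt0 domain_fin. Qed.

Lemma Re_dotp f : L2 O f ->
  ((Re (dotp O f f))%:E = (fine (mu O))^-1%:E *
    (qint mu O (fun x => Re (f x)) + qint mu O (fun x => Im (f x))))%E.
Proof.
move=> /[dup] hf /L2P[[m1 q1] [m2 q2]]; rewrite /dotp ReM /= mul0r subr0 EFinM; congr (_ * _)%E.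
rewrite /Rintegral fineK; last first.
  by apply: integrable_fin_num => //; have [] := L2_cintegrable hf hf.
rewrite /qint -ge0_integralD//.
- by apply: eq_integral => x _; rewrite mul_conjc.
- by move=> x _; rewrite lee_fin sqr_ge0.
- exact: measurable_sqr.
- by move=> x _; rewrite lee_fin sqr_ge0.
- exact: measurable_sqr.
Qed.

Lemma qint_le_dotp f : L2 O f ->
  (qint mu O (fun x => Re (f x)) <= (fine (mu O) * Re (dotp O f f))%:E)%E /\
  (qint mu O (fun x => Im (f x)) <= (fine (mu O) * Re (dotp O f f))%:E)%E.
Proof.
move=> hf; have V0 := vol_gt0; rewrite EFinM Re_dotp// muleA -EFinM mulfV ?gt_eqF// mul1e.
by split; [rewrite leeDl// qint_ge0|rewrite leeDr// qint_ge0].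
Qed.

Lemma Re_dotp_ge0 f : L2 O f -> 0 <= Re (dotp O f f).
Proof.
move=> hf; rewrite -lee_fin Re_dotp// mule_ge0//.
  by rewrite lee_fin invr_ge0 ltW// vol_gt0.
by rewrite adde_ge0// qint_ge0.
Qed.

Lemma dotp_eq0 f : L2 O f -> Re (dotp O f f) = 0 -> aeq O f (fun=> 0).
Proof.
move=> hf h; have := Re_dotp hf; rewrite h => /esym/eqP.
rewrite mule_eq0 eqe gt_eqF ?invr_gt0 ?vol_gt0//=.
rewrite padde_eq0 ?qint_ge0// => /andP[/eqP q1 /eqP q2].
move/L2P : hf => [f1 f2]; have := qint_eq0 mO f1.1 q1; have := qint_eq0 mO f2.1 q2.
by apply: filterS2 => x h1 h2 Ox; apply: complex_eqP => /=; [exact: h2|exact: h1].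
Qed.

Lemma dotp_complete (u : nat -> R -> R[i]) : (forall n, L2 O (u n)) ->
  (forall eps : R, 0 < eps -> exists N, forall m n, (N <= m)%N -> (N <= n)%N ->
     Re (dotp O (fun x => u m x - u n x) (fun x => u m x - u n x)) < eps) ->
  exists2 l, L2 O l & forall eps : R, 0 < eps -> exists N, forall n, (N <= n)%N ->
     Re (dotp O (fun x => u n x - l x) (fun x => u n x - l x)) < eps.
Proof.
move=> hu cu; set V := fine (mu O); have V0 : 0 < V := vol_gt0.
have V0' : (0 <= V^-1%:E :> \bar R)%E by rewrite lee_fin invr_ge0 ltW.
have qE f : L2 O f -> ((V^-1)%:E * (qint mu O (fun x => Re (f x)) +
    qint mu O (fun x => Im (f x))))%E = (Re (dotp O f f))%:E by move=> hf; rewrite Re_dotp.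
(* [P] stands for [Re] or [Im], so that one argument serves both parts. *)
have lim (P : R[i] -> R) : (forall f, L2 O f -> sqint mu O (fun x => P (f x)) /\
    (qint mu O (fun x => P (f x)) <= qint mu O (fun x => Re (f x)) +
    qint mu O (fun x => Im (f x)))%E) -> (forall z w, P (z - w) = P z - P w) ->
    exists2 p, sqint mu O p & forall eps : R, 0 < eps -> exists N, forall n, (N <= n)%N ->
      (qint mu O (fun x => P (u n x) - p x)%R < eps%:E)%E.
  move=> hP PB; apply: sqint_complete => //; first by move=> n; have [] := hP _ (hu n).
  move=> eps e0; have [|N hN] := cu (V^-1 * eps); first by rewrite mulr_gt0 ?invr_gt0.
  exists N => m n Nm Nn; have := hN m n Nm Nn.
  have hmn := L2B (hu m) (hu n); have [_] := hP _ hmn.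
  under eq_fun do rewrite PB.
  move=> /le_lt_trans h; rewrite -lte_fin -qE// EFinM lte_pmul2l ?lte_fin ?invr_gt0//.
  exact: h.
have [||p sp hp] := lim (@complex.Re R).
- by move=> f /L2P[f1 f2]; split=> //; rewrite leeDl// qint_ge0.
- exact: ReB.
have [||q sq hq] := lim (@complex.Im R).
- by move=> f /L2P[f1 f2]; split=> //; rewrite leeDr// qint_ge0.
- exact: ImB.
have hl : L2 O (fun x => Complex (p x) (q x)) by apply/L2P.
exists (fun x => Complex (p x) (q x)) => // eps e0.
have e1 : 0 < V * eps / 2 by rewrite divr_gt0 ?mulr_gt0.
have [N hN] := hp _ e1; have [M hM] := hq _ e1.
exists (maxn N M) => n; rewrite geq_max => /andP[Nn Mn].
rewrite -lte_fin -qE; last exact: L2B.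
under eq_fun do rewrite ReB /=.
under [X in (_ * (_ + qint _ _ X))%E]eq_fun do rewrite ImB /=.
have -> : eps%:E = (V^-1%:E * ((V * eps / 2)%:E + (V * eps / 2)%:E))%E.
  by rewrite -EFinD -EFinM -splitr mulrA mulVf ?mul1r// gt_eqF.
by rewrite lte_pmul2l ?lte_fin ?invr_gt0//; apply: lteD; [exact: hN|exact: hM].
Qed.

End fixed_domain.
End complex_L2.

(** * The Hilbert space of classes modulo almost-everywhere equality *)

Section l2_space.
Variables (R : realType) (O : domain R).
Implicit Types (f g : R -> R[i]).

(** Functions with the same class define the same set here, so [xget] picks the same element: [aeq]
    becomes an equality. For [f] in [L2 O] the set contains [f] and the default is not reached. *)
Definition canon f : R -> R[i] := xget (fun=> 0) [set g | L2 O g /\ aeq O f g].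

Lemma canonP f : L2 O f -> L2 O (canon f) /\ aeq O f (canon f).
Proof.
move=> hf; rewrite /canon; case: xgetP => [g _ //|/(_ f)]; case.
by split=> //; exact: aeq_refl.
Qed.

Lemma eq_canon f g : aeq O f g -> canon f = canon g.
Proof.
move=> fg; rewrite /canon; congr xget; apply/seteqP; split=> h [hh fh]; split=> //.
  exact: aeq_trans (aeq_sym fg) fh.
exact: aeq_trans fg fh.
Qed.

Lemma canonK f : L2 O f -> canon (canon f) = canon f.
Proof. by move=> /canonP[_ h]; apply/esym/eq_canon. Qed.

(* L^2(O) as the set of canonical representatives of the classes of [aeq O]. *)
Record l2space := L2Space {
  l2fun :> R -> R[i] ;
  l2funP : L2 O l2fun /\ canon l2fun = l2fun
}.

Lemma l2fun_L2 (u : l2space) : L2 O u. Proof. by have [] := l2funP u. Qed.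

Lemma l2_eq (u v : l2space) : aeq O u v -> u = v.
Proof.
move=> /eq_canon uv; have {}uv : l2fun u = l2fun v.
  by rewrite -(l2funP u).2 -(l2funP v).2.
case: u v uv => u hu [v hv] /= uv; move: hu; rewrite uv => hu.
congr L2Space; exact: Prop_irrelevance.
Qed.

(** Makes [l2pi] a function on all of [R -> R[i]], with no membership proof among its arguments. *)
Definition l2total f : R -> R[i] := if `[< L2 O f >] then f else fun=> 0.

Lemma l2totalP f : L2 O (l2total f).
Proof. by rewrite /l2total; case: asboolP => // _; exact: L2_0. Qed.

Definition l2pi f : l2space :=
  L2Space (conj (canonP (l2totalP f)).1 (canonK (l2totalP f))).

Lemma l2piE f : L2 O f -> aeq O (l2pi f) f.
Proof.
move=> hf; have := (canonP (l2totalP f)).2.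
by rewrite /= /l2total asboolT// => /aeq_sym.
Qed.

Lemma l2piK (u : l2space) : l2pi u = u.
Proof. by apply/l2_eq/l2piE; exact: l2fun_L2. Qed.

Lemma l2pi_eq f g : L2 O f -> L2 O g -> aeq O f g -> l2pi f = l2pi g.
Proof.
move=> hf hg fg; apply: l2_eq; apply: aeq_trans (l2piE hf) _.
exact: aeq_trans fg (aeq_sym (l2piE hg)).
Qed.

Lemma l2pi_inj f g : L2 O f -> L2 O g -> l2pi f = l2pi g -> aeq O f g.
Proof.
move=> hf hg fg; apply: aeq_trans (aeq_sym (l2piE hf)) _; rewrite fg; exact: l2piE.
Qed.

Definition l2add (u v : l2space) := l2pi (fun x => u x + v x).
Definition l2opp (u : l2space) := l2pi (fun x => - u x).
Definition l2scale (c : R[i]) (u : l2space) := l2pi (fun x => c * u x).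

Let addP (u v : l2space) : aeq O (l2add u v) (fun x => u x + v x).
Proof. by apply/l2piE/L2D; exact: l2fun_L2. Qed.

Let oppP (u : l2space) : aeq O (l2opp u) (fun x => - u x).
Proof. by apply/l2piE/L2N; exact: l2fun_L2. Qed.

Let scaleP (c : R[i]) (u : l2space) : aeq O (l2scale c u) (fun x => c * u x).
Proof. by apply/l2piE/L2Z; exact: l2fun_L2. Qed.

Let zeroP : aeq O (l2pi (fun=> 0)) (fun=> 0).
Proof. exact/l2piE/L2_0. Qed.

Let addA : associative l2add.
Proof.
move=> u v w; apply: l2_eq; apply: filterS2 (filterI (addP v w) (addP u (l2add v w)))
  (filterI (addP u v) (addP (l2add u v) w)) => x [h1 h2] [h3 h4] Ox.
by rewrite h2// h1// h4// h3// addrA.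
Qed.

Let addC : commutative l2add.
Proof. by move=> u v; congr l2pi; apply/funext => x; rewrite addrC. Qed.

Let add0 : left_id (l2pi (fun=> 0)) l2add.
Proof.
move=> u; apply: l2_eq; apply: filterS2 (addP (l2pi (fun=> 0)) u) zeroP => x h1 h2 Ox.
by rewrite h1// h2// add0r.
Qed.

Let addN : left_inverse (l2pi (fun=> 0)) l2opp l2add.
Proof.
move=> u; apply: l2_eq; apply: filterS3 (addP (l2opp u) u) (oppP u) zeroP => x h1 h2 h3 Ox.
by rewrite h1// h2// h3// addNr.
Qed.

HB.instance Definition _ := gen_eqMixin l2space.
HB.instance Definition _ := gen_choiceMixin l2space.
HB.instance Definition _ := GRing.isZmodule.Build l2space addA addC add0 addN.

Let scaleA (a b : R[i]) (u : l2space) : l2scale a (l2scale b u) = l2scale (a * b) u.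
Proof.
apply: l2_eq; apply: filterS3 (scaleP a (l2scale b u)) (scaleP b u) (scaleP (a * b) u).
by move=> x h1 h2 h3 Ox; rewrite h1// h2// h3// mulrA.
Qed.

Let scale1 : left_id 1 l2scale.
Proof.
move=> u; apply: l2_eq; apply: filterS (scaleP 1 u) => x h Ox.
by rewrite h// mul1r.
Qed.

Let scaleDr : right_distributive l2scale +%R.
Proof.
move=> a u v; apply: l2_eq.
apply: filterS3 (filterI (scaleP a (u + v)) (addP u v)) (filterI (scaleP a u) (scaleP a v))
  (addP (l2scale a u) (l2scale a v)) => x [h1 h2] [h3 h4] h5 Ox.
by rewrite h1// h2// h5// h3// h4// mulrDr.
Qed.

Let scaleDl (u : l2space) : {morph l2scale^~ u : a b / a + b}.
Proof.
move=> a b; apply: l2_eq.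
apply: filterS2 (filterI (scaleP a u) (scaleP b u)) (filterI (scaleP (a + b) u)
  (addP (l2scale a u) (l2scale b u))) => x [h1 h2] [h3 h4] Ox.
by rewrite h3// h4// h1// h2// mulrDl.
Qed.

HB.instance Definition _ :=
  GRing.Zmodule_isLmodule.Build R[i] l2space scaleA scale1 scaleDr scaleDl.

Definition l2dot (u v : l2space) : R[i] := dotp O u v.

Lemma l2addE (u v : l2space) : aeq O (u + v) (fun x => u x + v x).
Proof. exact: addP. Qed.

Lemma l2scaleE (c : R[i]) (u : l2space) : aeq O (c *: u) (fun x => c * u x).
Proof. exact: scaleP. Qed.

Lemma l2oppE (u : l2space) : aeq O (- u) (fun x => - u x).
Proof. exact: oppP. Qed.

Lemma l2linE (c : R[i]) (u v : l2space) : aeq O (c *: u + v) (fun x => c * u x + v x).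
Proof.
apply: filterS2 (l2addE (c *: u) v) (l2scaleE c u) => x h1 h2 Ox.
by rewrite h1// h2.
Qed.

Lemma l2subE (u v : l2space) : aeq O (u - v) (fun x => u x - v x).
Proof.
apply: filterS2 (l2addE u (- v)) (l2oppE v) => x h1 h2 Ox.
by rewrite h1// h2.
Qed.

Let dot_lin (c : R[i]) (u v w : l2space) : l2dot (c *: u + v) w = c * l2dot u w + l2dot v w.
Proof.
rewrite /l2dot (dotp_aeql _ _ _ (l2linE c u v)); last 3 first.
- exact: l2fun_L2.
- by apply: L2_lin; exact: l2fun_L2.
- exact: l2fun_L2.
by rewrite dotp_lin//; exact: l2fun_L2.
Qed.

Let dot_conj (u v : l2space) : l2dot v u = (l2dot u v)^*.
Proof. by apply: dotp_conj; exact: l2fun_L2. Qed.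

Let dot_pos (u : l2space) : 0 <= Re (l2dot u u).
Proof. by apply: Re_dotp_ge0; exact: l2fun_L2. Qed.

Let dot_definite (u : l2space) : Re (l2dot u u) = 0 -> u = 0.
Proof.
move=> h; apply: l2_eq; apply: aeq_trans (dotp_eq0 (l2fun_L2 u) h) _.
exact: aeq_sym zeroP.
Qed.

Lemma l2dot_pi f g : L2 O f -> L2 O g -> l2dot (l2pi f) (l2pi g) = dotp O f g.
Proof.
move=> hf hg; rewrite /l2dot (dotp_aeql _ hf _ (l2piE hf)); try exact: l2fun_L2.
by rewrite (dotp_aeqr hf _ hg (l2piE hg))//; exact: l2fun_L2.
Qed.

Lemma l2pi_sub f g : L2 O f -> L2 O g -> l2pi f - l2pi g = l2pi (fun x => f x - g x).
Proof.
move=> hf hg; apply: l2_eq.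
apply: filterS2 (filterI (l2subE (l2pi f) (l2pi g)) (l2piE hf))
  (filterI (l2piE hg) (l2piE (L2B hf hg))) => x [h1 h2] [h3 h4] Ox.
by rewrite h1// h2// h3// h4.
Qed.

Let dot_cauchy (u : nat -> l2space) :
  (forall eps, 0 < eps -> exists N, forall m n, (N <= m)%N -> (N <= n)%N ->
     Re (l2dot (u m - u n) (u m - u n)) < eps) ->
  exists l, forall eps, 0 < eps -> exists N, forall n, (N <= n)%N ->
     Re (l2dot (u n - l) (u n - l)) < eps.
Proof.
have E f g : L2 O f -> L2 O g -> l2dot (l2pi f - l2pi g) (l2pi f - l2pi g) =
    dotp O (fun x => f x - g x) (fun x => f x - g x).
  by move=> hf hg; rewrite l2pi_sub// l2dot_pi//; exact: L2B.
move=> cu; have [|eps e0|l hl cl] := @dotp_complete R O (fun n => u n).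
- by move=> n; exact: l2fun_L2.
- have [N hN] := cu _ e0; exists N => m n Nm Nn.
  by rewrite -E ?l2piK; [exact: hN|exact: l2fun_L2|exact: l2fun_L2].
exists (l2pi l) => eps e0; have [N hN] := cl _ e0; exists N => n Nn.
by have := hN _ Nn; rewrite -E ?l2piK//; exact: l2fun_L2.
Qed.

HB.instance Definition _ := Lmodule_isHilbert.Build R l2space
  dot_lin dot_conj dot_pos dot_definite dot_cauchy.

Lemma dot_l2pi f g : L2 O f -> L2 O g -> dot (l2pi f) (l2pi g) = dotp O f g.
Proof. exact: l2dot_pi. Qed.

Lemma nrm_l2pi f : L2 O f -> nrm (l2pi f) = norm2 O f.
Proof. by move=> hf; rewrite /nrm /nsq dot_l2pi. Qed.

Lemma l2pi_lin (c : R[i]) f g : L2 O f -> L2 O g ->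
  l2pi (fun x => c * f x + g x) = c *: l2pi f + l2pi g.
Proof.
move=> hf hg; apply: l2_eq; apply: aeq_trans (l2piE (L2_lin c hf hg)) _.
apply: aeq_sym; apply: aeq_trans (l2linE _ _ _) _.
by apply: aeq_lin; exact: l2piE.
Qed.

Lemma l2pi0 : l2pi (fun=> 0) = 0. Proof. by []. Qed.

Lemma l2piZ (c : R[i]) f : L2 O f -> l2pi (fun x => c * f x) = c *: l2pi f.
Proof.
move=> hf; have := l2pi_lin c hf (L2_0 O); rewrite l2pi0 addr0 => <-.
by congr l2pi; apply/funext => x; rewrite addr0.
Qed.

Lemma l2pi_sum (I : Type) (s : seq I) (F : I -> R -> R[i]) : (forall i, L2 O (F i)) ->
  l2pi (fun x => \sum_(i <- s) F i x) = \sum_(i <- s) l2pi (F i).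
Proof.
move=> hF; elim: s => [|i s IH].
  by rewrite big_nil -l2pi0; congr l2pi; apply/funext => x; rewrite big_nil.
rewrite big_cons -IH -[l2pi (F i)]scale1r -l2pi_lin//; last exact: L2_sum.
by congr l2pi; apply/funext => x; rewrite big_cons mul1r.
Qed.

Lemma norm2_sum_sub (n : nat) (v : nat -> R -> R[i]) (w : R -> R[i]) :
  (forall k, L2 O (v k)) -> L2 O w ->
  norm2 O (fun x => \sum_(k < n) v k x - w x) = nrm (\sum_(k < n) l2pi (v k) - l2pi w).
Proof.
move=> hv hw; have hs : L2 O (fun x => \sum_(k < n) v k x).
  exact: (@L2_sum _ O _ _ (fun (k : 'I_n) x => v k x)).
rewrite -(@l2pi_sum _ _ (fun (k : 'I_n) x => v k x))// (l2pi_sub hs hw) nrm_l2pi//.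
exact: L2B.
Qed.

End l2_space.

(** * Atomic measures with summable weights *)

Section weighted_diracs.
Variable R : realType.
Implicit Types (L : set R) (w : R -> R).

(** The support is the union over [n] of the sets where the weight is at least [n.+1%:R^-1], and
    each of these is finite because the sum is. *)
Lemma countable_esum_support L w : (forall l, L l -> 0 <= w l) ->
  (\esum_(l in L) (w l)%:E < +oo)%E -> countable (L `&` [set l | w l != 0]).
Proof.
move=> w0 fin; set s := (X in (X < _)%E) in fin.
have s0 : (0 <= s)%E by apply: esum_ge0 => l Ll; rewrite lee_fin w0.
have fs : s \is a fin_num by rewrite ge0_fin_numE.
pose S n := L `&` [set l | n.+1%:R^-1 <= w l].
apply: (@sub_countable _ _ _ (\bigcup_n S n)).
  apply: subset_card_le => l [Ll wl].
  have wl0 : 0 < w l by rewrite lt_def wl w0.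
  have [n _ /(_ n (leqnn n)) /= hn] := near_infty_natSinv_lt (PosNum wl0).
  by exists n => //; split => //=; apply: ltW.
apply: bigcup_countable => // n _; apply: finite_set_countable.
apply: contrapT => inf.
(* So many points of weight at least [n.+1%:R^-1] would have a sum above [s]. *)
pose N := (Num.truncn (fine s * n.+1%:R)).+1.
have [B BS NB] := infinite_set_fset N inf.
have BL : [set` B] `<=` L by move=> l /BS[].
have := fset_le_esum (fun l => (w l)%:E) BL; rewrite -/s -(fineK fs) sumEFin lee_fin.
apply/negP; rewrite -ltNge.
have h1 : #|` B|%:R * n.+1%:R^-1 <= \sum_(l <- B) w l.
  apply: (@le_trans _ _ (\sum_(l <- B) n.+1%:R^-1)).
    by rewrite big_const_seq count_predT iter_addr_0 mulr_natl.
  by rewrite big_seq [leRHS]big_seq; apply: ler_sum => l /BS[].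
apply: lt_le_trans h1; rewrite ltr_pdivlMr//.
apply: lt_le_trans (_ : N%:R <= _); last by rewrite ler_nat.
by have := truncnS_gt (fine s * n.+1%:R).
Qed.

(** [L] may be uncountable whereas a series of measures is indexed by integers, so the sum runs over
    the countable support, encoded by [k]. *)
Lemma weighted_diracs L w : (forall l, L l -> 0 <= w l) ->
  (\esum_(l in L) (w l)%:E < +oo)%E ->
  exists mu : {measure set (measurableTypeR R) -> \bar R},
    forall f : measurableTypeR R -> \bar R,
      measurable_fun setT f -> (forall x, 0 <= f x)%E ->
      (\int[mu]_x f x = \esum_(l in L) ((w l)%:E * f l))%E.
Proof.
move=> w0 fin; have /countable_injP[k kinj] := countable_esum_support w0 fin.
set S := L `&` _ in kinj.
pose g n : R := xget 0 [set l | S l /\ k l = n].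
have gk l : S l -> g (k l) = l.
  move=> Sl; rewrite /g; case: xgetP => [y _ [Sy kyl]|/(_ l) []]; last by split.
  by apply: kinj; rewrite ?inE.
(* Integers that code no point carry weight 0, which makes the default value of [g] harmless. *)
pose a n : R := if `[< (k @` S) n >] then w (g n) else 0.
have a0 n : 0 <= a n.
  by rewrite /a; case: asboolP => // -[l Sl <-]; rewrite gk// w0//; case: Sl.
pose m_ n : {measure set (measurableTypeR R) -> \bar R} :=
  mscale (NngNum (a0 n)) (dirac (g n : measurableTypeR R)).
exists (mseries m_ 0) => f mf f0.
rewrite ge0_integral_measure_series//.
transitivity (\sum_(0 <= n <oo) ((a n)%:E * f (g n)))%E.
  apply: eq_eseriesr => n _; rewrite ge0_integral_mscale//= integral_dirac//.
  by rewrite diracT mul1e.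
rewrite nneseries_esumT; last by move=> n; rewrite mule_ge0 ?lee_fin.
transitivity (\esum_(n in k @` S) ((w (g n))%:E * f (g n)))%E.
  rewrite [RHS]esum_mkcond; apply: eq_esum => n _; rewrite /a.
  by case: asboolP => h; [rewrite mem_set|rewrite memNset// mul0e].
rewrite (reindex_esum S (k @` S) k); last first.
  by split=> // l Sl; exists l.
transitivity (\esum_(l in S) ((w l)%:E * f l))%E.
  by apply: eq_esum => l Sl; rewrite gk.
rewrite /S esum_mkcondr; apply: eq_esum => l Ll; case: ifPn => //.
by rewrite notin_setE /= => /negP; rewrite negbK => /eqP ->; rewrite mul0e.
Qed.

End weighted_diracs.

(** * Spectral measures of a vector *)

Section spectral_calculus.
Variables (R : realType) (H : Hilbert.type R).
Variables (L : set R) (e : R -> H).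
Hypothesis ort : forall l m, L l -> L m -> dot (e l) (e m) = (l == m)%:R.
Hypothesis tot : total L e.
Implicit Types (f g h : H).
Local Notation mulrel := (mulrel L e).

(** Describes the sum of the Dirac masses at [l] in [L] with weights [sqn (dot f (e l))], through
    its integrals of nonnegative functions. *)
Definition spectral_measure f (mu : {measure set (measurableTypeR R) -> \bar R}) :=
  forall psi : measurableTypeR R -> R, measurable_fun setT psi -> (forall x, 0 <= psi x) ->
    (\int[mu]_x (psi x)%:E = \esum_(l in L) (psi l * sqn (dot f (e l)))%:E)%E.

Lemma spectral_measure_ex f : exists mu, spectral_measure f mu.
Proof.
have [l Ll||mu hmu] := @weighted_diracs R L (fun l => sqn (dot f (e l))).
- exact: sqn_ge0.
- by rewrite -parseval// ltry.
exists mu => psi mpsi psi0; rewrite hmu.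
- by apply: eq_esum => l _; rewrite -EFinM mulrC.
- exact/measurable_EFinP.
- by move=> x; rewrite lee_fin.
Qed.

Lemma spectral_measure_set f mu (B : set (measurableTypeR R)) g :
  spectral_measure f mu -> measurable B ->
  mulrel (fun l => (\1_B l : R)%:C) f g -> mu B = (Re (dot g f))%:E.
Proof.
move=> hmu mB fg; rewrite (esum_dot ort tot _ fg)//.
by rewrite -hmu// integral_indic// setIT.
Qed.

(** The positive and negative parts of [psi] are dominated by [phi], so both multipliers are defined
    at [f]; each is handled by [esum_dot] and the results are subtracted. *)
Lemma spectral_measure_real f mu (phi : R -> R[i]) g (psi : measurableTypeR R -> R) :
  spectral_measure f mu -> measurable_fun setT psi ->
  mulrel phi f g -> (forall l, L l -> psi l ^+ 2 <= sqn (phi l)) ->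
  exists2 h, mulrel (fun l => (psi l)%:C) f h & Re (dot h f) = \int[mu]_x psi x.
Proof.
move=> hmu mpsi fg psi_le.
have part (p : measurableTypeR R -> R) : measurable_fun setT p -> (forall x, 0 <= p x) ->
    (forall l, L l -> p l ^+ 2 <= sqn (phi l)) ->
    exists2 h, mulrel (fun l => (p l)%:C) f h & (\int[mu]_x (p x)%:E = (Re (dot h f))%:E)%E.
  move=> mp p0 p_le; have [|h fh] := mulrel_ex ort (m := fun l => (p l)%:C) (f := f).
    apply: le_lt_trans (ltry (nsq g)); rewrite -(mulrel_esum ort tot fg).
    apply: le_esum => l Ll; rewrite lee_fin ler_wpM2r ?sqn_ge0// sqnR; exact: p_le.
  by exists h => //; rewrite hmu// -(esum_dot ort tot _ fh).
have [|||hp fhp ip] := part (fun x => Num.max (psi x) 0).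
- exact: measurable_maxr.
- by move=> x; rewrite le_max lexx orbT.
- move=> l Ll; apply: le_trans (psi_le l Ll); case: (leP (psi l) 0) => _ //.
  by rewrite expr0n sqr_ge0.
have [|||hn fhn iN] := part (fun x => Num.max (- psi x) 0).
- by apply: measurable_maxr => //; exact: measurableT_comp.
- by move=> x; rewrite le_max lexx orbT.
- move=> l Ll; apply: le_trans (psi_le l Ll); case: (leP (- psi l) 0) => _.
    by rewrite expr0n sqr_ge0.
  by rewrite sqrrN.
exists (hp - hn).
  move=> l Ll; rewrite dotBl fhp// fhn// -mulrBl; congr (_ * _).
  apply: complex_eqP; rewrite ?ReB ?ImB /= ?subrr//; have [h|/ltW h] := leP 0 (psi l).
    by rewrite max_r ?subr0// oppr_le0.
  by rewrite max_l ?sub0r ?opprK// oppr_ge0.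
rewrite dotBl ReB /Rintegral integralE.
have -> : (\int[mu]_x (fun x => (psi x)%:E)^\+ x = (Re (dot hp f))%:E)%E.
  by rewrite -ip; apply: eq_integral => x _; rewrite funeposE -EFin_max.
have -> : (\int[mu]_x (fun x => (psi x)%:E)^\- x = (Re (dot hn f))%:E)%E.
  by rewrite -iN; apply: eq_integral => x _; rewrite funenegE -EFin_max.
by [].
Qed.

(** Split [g] as [u + i v] along the real and imaginary parts of [phi]. Real multipliers are
    symmetric, so [dot u f] and [dot v f] are real. *)
Lemma spectral_measure_dot f mu (phi : R -> R[i]) g :
  spectral_measure f mu ->
  measurable_fun setT (fun x : measurableTypeR R => Re (phi x)) ->
  measurable_fun setT (fun x : measurableTypeR R => Im (phi x)) ->
  mulrel phi f g -> dot g f = cintegral mu setT phi.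
Proof.
move=> hmu mR mI fg.
have [l _|u fu iu] := spectral_measure_real hmu mR fg; first exact: Re_le_sqn.
have [l _|v fv iv] := spectral_measure_real hmu mI fg; first exact: Im_le_sqn.
have -> : g = u + Complex 0 1 *: v.
  apply: (mulrel_unique tot fg) => l Ll; rewrite dotDl dotZl fu// fv// mulrA -mulrDl.
  by congr (_ * _); apply: complex_eqP; rewrite ?ReD ?ImD ?ReM ?ImM /=; ring.
rewrite dotDl dotZl; apply: complex_eqP; rewrite /cintegral /= -?iu -?iv ?ReD ?ImD ?ReM ?ImM /=.
  by rewrite (mulrel_real ort tot fv); ring.
by rewrite (mulrel_real ort tot fu); ring.
Qed.

Lemma spectral_measure_dom f mu (phi : R -> R[i]) :
  spectral_measure f mu ->
  measurable_fun setT (fun x : measurableTypeR R => Re (phi x)) ->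
  measurable_fun setT (fun x : measurableTypeR R => Im (phi x)) ->
  (exists g, mulrel phi f g) <->
  (\int[mu]_x (Re (phi x) ^+ 2 + Im (phi x) ^+ 2)%:E < +oo)%E.
Proof.
move=> hmu mR mI; rewrite hmu; last 2 first.
- by apply: measurable_funD; exact: measurable_funX.
- by move=> x; exact: sqn_ge0.
split=> [[g fg]|h]; last exact: (mulrel_ex ort h).
by rewrite (mulrel_esum ort tot fg) ltry.
Qed.

End spectral_calculus.

(** * Exponentials as an orthonormal basis *)

Section spectra.
Variables (R : realType) (O : domain R).
Local Notation mu := (@lebesgue_measure R).
Implicit Types (f g : R -> R[i]) (m : R -> R[i]).

Lemma bounded_sqint (u : R -> R) : measurable_fun (setT : set (measurableTypeR R)) u ->
  (forall x, `|u x| <= 1) -> sqint mu O u.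
Proof.
move=> mu_ u1; have mO := domain_measurable O.
have mu_O : measurable_fun O u by exact: measurable_funTS.
split=> //; apply: (@le_lt_trans _ _ (\int[mu]_(x in O) (1%:E))%E).
  apply: ge0_le_integral => //.
  - by move=> x _; rewrite lee_fin sqr_ge0.
  - exact: measurable_sqr.
  - move=> x _; rewrite lee_fin -real_normK ?num_real// expr_le1//.
by rewrite integral_cst// mul1e domain_fin.
Qed.

Lemma L2_e l : L2 O (e_ l).
Proof.
have ml : measurable_fun (setT : set (measurableTypeR R)) (fun x : R => 2 * pi * l * x).
  by apply: measurable_funM => //; exact: measurable_cst.
apply/L2P; split; apply: bounded_sqint.
- exact: (measurableT_comp (continuous_measurable_fun (@continuous_cos R)) ml).
- by move=> x /=; rewrite ler_norml cos_geN1 cos_le1.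
- exact: (measurableT_comp (continuous_measurable_fun (@continuous_sin R)) ml).
- by move=> x /=; rewrite ler_norml sin_geN1 sin_le1.
Qed.

Definition en (l : R) : l2space O := l2pi O (e_ l).

Lemma e_add (l x t : R) : e_ l (x + t) = expi (2 * pi * l * t) * e_ l x.
Proof. by rewrite /e_ mulrDr expiD mulrC. Qed.

Lemma nsq_en l : nsq (en l) = 1.
Proof.
rewrite /nsq dot_l2pi; try exact: L2_e.
apply/eqP; rewrite -eqe Re_dotp; last exact: L2_e.
have [[m1 _] [m2 _]] := (L2P O (e_ l)).1 (L2_e l).
rewrite /qint -ge0_integralD//; last 5 first.
- exact: domain_measurable.
- by move=> x _; rewrite lee_fin sqr_ge0.
- exact: measurable_sqr.
- by move=> x _; rewrite lee_fin sqr_ge0.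
- exact: measurable_sqr.
rewrite (eq_integral (fun=> 1%:E)) => [|x _]; last first.
  by rewrite -EFinD -[_ + _]/(sqn _) sqn_expi.
rewrite integral_cst ?mul1e; last exact: domain_measurable.
have fO : mu O \is a fin_num by rewrite ge0_fin_numE// domain_fin.
by rewrite -[X in (_ * X)%E](fineK fO) -EFinM mulVf// gt_eqF// vol_gt0.
Qed.

Section spectrum.
Variable L : set R.
Local Notation mulrel := (mulrel L en).

Lemma L2_psum (a : R -> R[i]) (F : {fset R}) : L2 O (fun x => \sum_(l <- F) a l * e_ l x).
Proof. by apply: (@L2_sum _ O _ F (fun l x => a l * e_ l x)) => l; apply: L2Z; exact: L2_e. Qed.

Lemma l2pi_psum (a : R -> R[i]) (F : {fset R}) :
  l2pi O (fun x => \sum_(l <- F) a l * e_ l x) = psum en a F.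
Proof.
rewrite (@l2pi_sum _ O _ F (fun l x => a l * e_ l x)); last by move=> l; apply: L2Z; exact: L2_e.
by apply: eq_bigr => l _; rewrite l2piZ//; exact: L2_e.
Qed.

Lemma has_expansionP a f : L2 O f -> has_expansion O L a f <-> hexp L en a (l2pi O f).
Proof.
move=> hf.
have E (F : {fset R}) : norm2 O (fun x => f x - \sum_(l <- F) a l * e_ l x) =
    nrm (l2pi O f - psum en a F).
  rewrite -l2pi_psum l2pi_sub//; last exact: L2_psum.
  by rewrite nrm_l2pi//; apply: L2B => //; exact: L2_psum.
split=> [[_ h] eps e0|h].
  by have [F0 F0L {}h] := h _ e0; exists F0 => // F F0F FL; rewrite -E; exact: h.
split=> // eps e0.
by have [F0 F0L {}h] := h _ e0; exists F0 => // F F0F FL; rewrite E; exact: h.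
Qed.

Hypothesis spL : is_spectrum O L.

Lemma spectrum_ort (l m : R) : L l -> L m -> dot (en l) (en m) = (l == m)%:R.
Proof.
move=> Ll Lm; have [<-|/eqP lm] := eqVneq l m; first by rewrite dotff nsq_en.
rewrite dot_l2pi; [|exact: L2_e..].
by case: spL => h _; rewrite h.
Qed.

Lemma spectrum_total : total L en.
Proof.
apply: (hexp_total spectrum_ort) => u; case: spL => _ h.
have [b hb] := h u (l2fun_L2 u); exists b.
by rewrite -(l2piK u); apply/has_expansionP => //; exact: l2fun_L2.
Qed.

(** As soon as [mulrel] relates the class of [f] to some vector, [xget] does not fall back on its
    default. *)
Lemma multiplierP m f : L2 O f -> (exists u, mulrel m (l2pi O f) u) ->
  L2 O (multiplier O L m f) /\ mulrel m (l2pi O f) (l2pi O (multiplier O L m f)).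
Proof.
move=> hf [u fu].
have [|a fa ga] := @xgetPex _ (fun=> 0) [set g | exists2 a, has_expansion O L a f &
    has_expansion O L (fun l => m l * a l) g].
  exists (l2fun u); exists (fun l => dot (l2pi O f) (en l)).
    apply/has_expansionP => //; apply: total_hexp spectrum_total.
    exact: spectrum_ort.
  apply/has_expansionP; first exact: l2fun_L2.
  rewrite l2piK; apply: eq_hexp (total_hexp spectrum_ort u spectrum_total) => l Ll.
  exact: fu.
have [hg _] := ga; split=> // l Ll.
have /has_expansionP {}ga := ga; have /has_expansionP {}fa := fa.
by rewrite (hexp_coef spectrum_ort (ga hg) Ll) (hexp_coef spectrum_ort (fa hf) Ll).
Qed.

Section linear.
Variables (m : R -> R[i]) (D : set (R -> R[i])).
Hypothesis DE : forall f, D f <-> L2 O f /\ exists u, mulrel m (l2pi O f) u.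

Lemma multiplier_dom f : D f ->
  L2 O (multiplier O L m f) /\ mulrel m (l2pi O f) (l2pi O (multiplier O L m f)).
Proof. by move=> /DE[hf]; exact: multiplierP. Qed.

(** [D] is a parameter so that one proof covers the bounded multipliers, defined on all of [L2 O],
    and the operator [A] on its smaller domain. *)
Lemma multiplier_linear : linear_op O (Op D (multiplier O L m)).
Proof.
split=> //=.
- by move=> f /DE[].
- by move=> f /multiplier_dom[].
- move=> f g Df hg fg; have [hf' fr] := multiplier_dom Df.
  have /DE[hf _] := Df.
  have E := l2pi_eq hf hg fg.
  have Dg : D g by apply/DE; split=> //; exists (l2pi O (multiplier O L m f)); rewrite -E.
  split=> //; have [hg' gr] := multiplier_dom Dg; apply: l2pi_inj => //.
  by apply: (mulrel_unique spectrum_total fr); rewrite E.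
- apply/DE; split; first exact: L2_0.
  by exists 0 => l Ll; rewrite l2pi0 dot0l mulr0.
- move=> c f g Df Dg; have [hf' fr] := multiplier_dom Df.
  have [hg' gr] := multiplier_dom Dg; have /DE[hf _] := Df; have /DE[hg _] := Dg.
  have rel : mulrel m (l2pi O (fun x => c * f x + g x))
      (l2pi O (fun x => c * multiplier O L m f x + multiplier O L m g x)).
    move=> l Ll; rewrite (l2pi_lin c hf hg) (l2pi_lin c hf' hg').
    rewrite (dotPl c (l2pi O f) (l2pi O g)) (dotPl c (l2pi O (multiplier O L m f))).
    by rewrite (fr l Ll) (gr l Ll) mulrDr mulrCA.
  have Dfg : D (fun x => c * f x + g x).
    by apply/DE; split; [exact: L2_lin|eexists; exact: rel].
  split=> //; have [h1 h2] := multiplier_dom Dfg.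
  apply: l2pi_inj => //; first exact: L2_lin.
  exact: (mulrel_unique spectrum_total h2).
Qed.

End linear.

Section bounded.
Variables (m : R -> R[i]).
Hypothesis m1 : forall l, L l -> sqn (m l) <= 1.

Lemma bounded_dom f : L2 O f <-> L2 O f /\ exists u, mulrel m (l2pi O f) u.
Proof.
split=> [hf|[]//]; split=> //.
exact: (bounded_mulrel_ex spectrum_ort spectrum_total m1).
Qed.

Lemma bounded_multiplierP f : L2 O f ->
  L2 O (multiplier O L m f) /\ mulrel m (l2pi O f) (l2pi O (multiplier O L m f)).
Proof. exact: (multiplier_dom bounded_dom). Qed.

Lemma bounded_multiplier_linear : linear_op O (total_op O (multiplier O L m)).
Proof. exact: (multiplier_linear bounded_dom). Qed.

End bounded.

End spectrum.
End spectra.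

(** * The unitary group and the self-adjoint operator of a spectrum *)

Section spectrum_dynamics.
Variables (R : realType) (O : domain R) (L : set R).
Hypothesis spL : is_spectrum O L.
Local Notation mu := (@lebesgue_measure R).
Local Notation mulrel := (mulrel L (en O)).
Local Notation U := (spectrum_group O L).
Local Notation pi_ := (l2pi O).
Implicit Types (f g : R -> R[i]) (m : R -> R[i]) (t : R).

Let ort := spectrum_ort spL.
Let tot := spectrum_total spL.

Let phase t : R -> R[i] := fun l => expi (2 * pi * l * t).

Let phase1 t l : L l -> sqn (phase t l) <= 1.
Proof. by move=> _; rewrite sqn_expi. Qed.

Lemma group_P t f : L2 O f -> L2 O (U t f) /\ mulrel (phase t) (pi_ f) (pi_ (U t f)).
Proof. exact: (bounded_multiplierP spL (phase1 t)). Qed.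

Lemma group_linear t : linear_op O (total_op O (U t)).
Proof. exact: (bounded_multiplier_linear spL (phase1 t)). Qed.

Lemma eq_mulrel m m' (u v : l2space O) : (forall l, L l -> m l = m' l) ->
  mulrel m u v -> mulrel m' u v.
Proof. by move=> mm' uv l Ll; rewrite uv// mm'. Qed.

Lemma mulrel_comp m m' (u v w : l2space O) : mulrel m u v -> mulrel m' v w ->
  mulrel (fun l => m' l * m l) u w.
Proof. by move=> uv vw l Ll; rewrite vw// uv// mulrA. Qed.

Lemma mulrelB m m' (u v v' : l2space O) : mulrel m u v -> mulrel m' u v' ->
  mulrel (fun l => m l - m' l) u (v - v').
Proof. by move=> uv uv' l Ll; rewrite dotBl uv// uv'// mulrBl. Qed.

Lemma mulrel_sub m (u v u' v' : l2space O) : mulrel m u v -> mulrel m u' v' ->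
  mulrel m (u - u') (v - v').
Proof. by move=> uv uv' l Ll; rewrite !dotBl uv// uv'// mulrBr. Qed.

Lemma mulrel_id (u v : l2space O) m : (forall l, L l -> m l = 1) -> mulrel m u v -> v = u.
Proof.
by move=> m1 uv; apply: (mulrel_unique tot uv) => l Ll; rewrite m1// mul1r.
Qed.

Lemma mulrel_inv t (u v : l2space O) : mulrel (phase t) u v -> mulrel (phase (- t)) v u.
Proof. by move=> uv l Ll; rewrite uv// mulrA /phase mulrN expiN mul1r. Qed.

Lemma group_unitary t : unitary O (U t).
Proof.
split; first exact: group_linear.
- move=> f g hf hg; have [hf' fr] := group_P t hf; have [hg' gr] := group_P t hg.
  rewrite -(dot_l2pi hf' hg') -(dot_l2pi hf hg); apply: (mulrel_adjoint ort tot fr).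
  apply: eq_mulrel (mulrel_inv gr) => l Ll.
  by rewrite /phase conj_expi mulrN.
- move=> g hg; have [hg' gr] := group_P (- t) hg; exists (U (- t) g) => //.
  have [hf fr] := group_P t hg'; apply: (l2pi_inj hf hg).
  by apply: (mulrel_unique tot fr) => l Ll; rewrite (gr l Ll) mulrA /phase mulrN [expi _ * expi _]mulrC expiN mul1r.
Qed.

Lemma group_group : unitary_group O U.
Proof.
split.
- exact: group_unitary.
- move=> f hf; have [hf' fr] := group_P 0 hf; apply: (l2pi_inj hf' hf).
  by apply: mulrel_id fr => l Ll; rewrite /phase mulr0 expi0.
- move=> s t f hf; have [h1 r1] := group_P (s + t) hf; have [h2 r2] := group_P t hf.
  have [h3 r3] := group_P s h2; apply: (l2pi_inj h1 h3).
  apply: (mulrel_unique tot r1); apply: eq_mulrel (mulrel_comp r2 r3) => l Ll.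
  by rewrite /phase (mulrDr (2 * pi * l)) expiD.
- move=> f t0 hf.
  have E : (fun t => norm2 O (fun x => U t f x - U t0 f x)) =
      (fun t => nrm ((pi_ (U t f) - pi_ (U t0 f)) - 0)).
    apply/funext => t; have [h1 r1] := group_P t hf; have [h2 r2] := group_P t0 hf.
    by rewrite subr0 (l2pi_sub h1 h2) (nrm_l2pi (L2B h1 h2)).
  (* 4 bounds the squared modulus of a difference of two phases; for each [l] this difference tends
     to 0 as [t] tends to [t0]. *)
  rewrite E; apply: (@mulrel_cvg _ _ _ L (en O) ort tot R (nbhs t0) _ 4
    (fun t l => phase t l - phase t0 l) (pi_ f)).
  + move=> t l _; apply: le_trans (sqnD _ _) _; rewrite sqnN !sqn_expi; lra.
  + move=> l _; have h : 2 * pi * l * t @[t --> t0] --> 2 * pi * l * t0.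
      by apply: cvgMr; exact: cvg_id.
    exact: (cvg_comp _ _ h (@cvg_expi R (2 * pi * l * t0))).
  + by move=> t; exact: mulrelB (group_P t hf).2 (group_P t0 hf).2.
Qed.

Let dom := [set f | exists2 a, has_expansion O L a f &
  (\esum_(l in L) (l ^+ 2 * (Re (a l) ^+ 2 + Im (a l) ^+ 2))%:E < +oo)%E].

Lemma spectrum_domP f : dom f <-> L2 O f /\ exists u, mulrel (fun l => l%:C) (pi_ f) u.
Proof.
have E a : hexp L (en O) a (pi_ f) ->
    (\esum_(l in L) (l ^+ 2 * (Re (a l) ^+ 2 + Im (a l) ^+ 2))%:E =
    \esum_(l in L) (sqn (l%:C) * sqn (dot (pi_ f) (en O l)))%:E)%E.
  by move=> af; apply: eq_esum => l Ll; rewrite (hexp_coef ort af Ll) sqnR.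
split=> [[a af fin]|[hf [u fu]]].
  have hf : L2 O f by have [] := af.
  split=> //; apply: (mulrel_ex ort).
  by rewrite -(E a)//; apply/(has_expansionP _ _ hf).
have hex := total_hexp ort (pi_ f) tot.
exists (fun l => dot (pi_ f) (en O l)); first by apply/(has_expansionP _ _ hf).
by rewrite (E _ hex) (mulrel_esum ort tot fu) ltry.
Qed.

Local Notation A := (spectrum_op O L).

Lemma spectrum_op_P f : dom f ->
  L2 O (act A f) /\ mulrel (fun l => l%:C) (pi_ f) (pi_ (act A f)).
Proof. exact: (multiplier_dom spL spectrum_domP). Qed.

Lemma spectrum_op_linear : linear_op O A.
Proof. exact: (multiplier_linear spL spectrum_domP). Qed.

Lemma mulrel_psum m (a : R -> R[i]) (F : {fset R}) : [set` F] `<=` L ->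
  mulrel m (psum (en O) a F) (psum (en O) (fun l => m l * a l) F).
Proof.
move=> FL l Ll; rewrite !(dot_psum_e ort)//; case: ifP => // _.
by rewrite mulr0.
Qed.

Lemma psum_dom (a : R -> R[i]) (F : {fset R}) : [set` F] `<=` L ->
  dom (fun x => \sum_(l <- F) a l * e_ l x).
Proof.
move=> FL; apply/spectrum_domP; split; first exact: L2_psum.
by rewrite l2pi_psum; eexists; exact: mulrel_psum.
Qed.

(** Symmetry holds because the multiplier is real. Conversely, testing the adjoint identity on the
    exponentials, which lie in the domain, reads off the coefficients of [h] and puts [g] in the
    domain. *)
Lemma spectrum_op_self_adjoint : self_adjoint O A.
Proof.
split; first exact: spectrum_op_linear.
- move=> f eps hf e0; have [F FL hF] := total_hexp ort (pi_ f) tot e0.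
  exists (fun x => \sum_(l <- F) dot (pi_ f) (en O l) * e_ l x); first exact: psum_dom.
  rewrite -nrm_l2pi; last by apply: L2B => //; exact: L2_psum.
  rewrite -l2pi_sub//; last exact: L2_psum.
  by rewrite l2pi_psum; apply: hF.
move=> g h hg hh; split=> [[Dg gh] f Df|adj].
  have [hf' fr] := spectrum_op_P Df; have [hg' gr] := spectrum_op_P Dg.
  have /spectrum_domP[hf _] := Df.
  rewrite -(dot_l2pi hf' hg) -(dot_l2pi hf hh) -(l2pi_eq hg' hh gh).
  by apply: (mulrel_adjoint ort tot fr); apply: eq_mulrel gr => l _; rewrite conjc_real.
have gh : mulrel (fun l => l%:C) (pi_ g) (pi_ h).
  move=> l Ll; have FL : [set` [fset l]%fset] `<=` L by move=> x /=; rewrite inE => /eqP ->.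
  (* The exponential [e_ l] written as a one-term sum, so that [psum_dom] puts it in the domain. *)
  pose f x : R[i] := \sum_(l <- [fset l]%fset) 1 * e_ l x.
  have Df : dom f by exact: psum_dom.
  have [hf' fr] := spectrum_op_P Df; have /spectrum_domP[hf _] := Df.
  have := adj f Df; rewrite -(dot_l2pi hf' hg) -(dot_l2pi hf hh).
  have Ef : pi_ f = en O l by rewrite l2pi_psum /psum big_seq_fset1 scale1r.
  have -> : pi_ (act A f) = l%:C *: en O l.
    apply: (mulrel_unique tot fr) => k Lk; rewrite Ef dotZl ort//.
    by case: eqVneq => [->//|_]; rewrite !mulr0.
  rewrite Ef dotZl => E.
  by rewrite dotJ -E conjcM conjc_real -dotJ.
have Dg : dom g by apply/spectrum_domP; split=> //; exists (pi_ h).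
split=> //; have [hg' gr] := spectrum_op_P Dg.
by apply: (l2pi_inj hg' hh); exact: (mulrel_unique tot gr).
Qed.

End spectrum_dynamics.

(** * The spectral resolution and the exponential of the operator *)

Section functional_calculus.
Variables (R : realType) (O : domain R) (L : set R).
Hypothesis spL : is_spectrum O L.
Local Notation mulrel := (mulrel L (en O)).
Local Notation U := (spectrum_group O L).
Local Notation A := (spectrum_op O L).
Local Notation pi_ := (l2pi O).
Implicit Types (f g : R -> R[i]) (B : set R).

Let ort := spectrum_ort spL.
Let tot := spectrum_total spL.

Definition specproj B := multiplier O L (fun l => (\1_B l : R)%:C).

Let indic1 B l : L l -> sqn (\1_B l : R)%:C <= 1.
Proof. by move=> _; rewrite sqnR indicE; case: (l \in B); rewrite ?expr1n// expr0n. Qed.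

Lemma specprojP B f : L2 O f ->
  L2 O (specproj B f) /\ mulrel (fun l => (\1_B l : R)%:C) (pi_ f) (pi_ (specproj B f)).
Proof. exact: (bounded_multiplierP spL (@indic1 B)). Qed.

Lemma specproj_projection B : orthogonal_projection O (specproj B).
Proof.
split; first exact: (bounded_multiplier_linear spL (@indic1 B)).
- move=> f hf; have [h1 r1] := specprojP B hf; have [h2 r2] := specprojP B h1.
  apply: (l2pi_inj h2 h1); apply: (mulrel_unique tot (mulrel_comp r1 r2)).
  apply: eq_mulrel r1 => l _; rewrite -rmorphM /= !indicE -natrM mulnb andbb.
  by [].
- move=> f g hf hg; have [h1 r1] := specprojP B hf; have [h2 r2] := specprojP B hg.
  rewrite -(dot_l2pi h1 hg) -(dot_l2pi hf h2); apply: (mulrel_adjoint ort tot r1).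
  by apply: eq_mulrel r2 => l _; rewrite conjc_real.
Qed.

Lemma mulrel_sum (I : Type) (s : seq I) (m : I -> R -> R[i]) (u : l2space O)
    (v : I -> l2space O) : (forall i, mulrel (m i) u (v i)) ->
  mulrel (fun l => \sum_(i <- s) m i l) u (\sum_(i <- s) v i).
Proof.
move=> uv l Ll; rewrite dot_suml mulr_suml; apply: eq_bigr => i _.
exact: uv.
Qed.

Lemma specproj_pvm : pvm O specproj.
Proof.
split.
- by move=> B _; exact: specproj_projection.
- move=> f hf; have [h r] := specprojP set0 hf; apply: (l2pi_inj h (L2_0 O)).
  apply: (mulrel_unique tot r) => l Ll.
  by rewrite l2pi0 dot0l indicE in_set0 mul0r.
- move=> f hf; have [h r] := specprojP setT hf; apply: (l2pi_inj h hf).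
  by apply: (mulrel_id spL _ r) => l _; rewrite indicE in_setT.
- move=> B C _ _ f hf; have [h1 r1] := specprojP (B `&` C) hf.
  have [h2 r2] := specprojP C hf; have [h3 r3] := specprojP B h2.
  apply: (l2pi_inj h1 h3); apply: (mulrel_unique tot r1).
  apply: eq_mulrel (mulrel_comp r2 r3) => l _.
  by rewrite -rmorphM /= indicI.
move=> B mB tB f hf.
(* Countable additivity becomes the convergence to 0 of the multipliers [d m]. *)
pose d (m : nat) l : R[i] :=
  \sum_(k < m) (\1_(B k) l : R)%:C - (\1_(\bigcup_k B k) l : R)%:C.
have hB k : L2 O (specproj (B k) f) by have [] := specprojP (B k) hf.
have [hU rU] := specprojP (\bigcup_k B k) hf.
pose u (m : nat) := \sum_(k < m) pi_ (specproj (B k) f) - pi_ (specproj (\bigcup_k B k) f).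
have ru m : mulrel (d m) (pi_ f) (u m).
  apply: mulrelB rU; apply: mulrel_sum => k.
  by have [] := specprojP (B k) hf.
have E : (fun m : nat => norm2 O (fun x => \sum_(k < m) specproj (B k) f x -
    specproj (\bigcup_k B k) f x)) = (fun m => nrm (u m - 0)).
  apply/funext => m; rewrite subr0.
  exact: (norm2_sum_sub m hB hU).
rewrite E.
(* By disjointness at most one [B k] contains [l], so [d m l] takes only the values 0 and -1 and
   vanishes for large [m]. *)
have dE l : (forall m, d m l = 0) \/
    exists k0 : nat, forall m, d m l = (k0 < m)%:R - 1.
  case: (pselect ((\bigcup_k B k) l)) => [[k0 _ Bl]|nl]; [right; exists k0|left] => m; rewrite /d.
    rewrite [in X in _ - X]indicE mem_set; last by exists k0.
    congr (_ - _); rewrite (eq_bigr (fun k : 'I_m => ((k : nat) == k0)%:R)); last first.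
      move=> k _; rewrite indicE; case: eqVneq => [->|kk0]; first by rewrite mem_set.
      rewrite memNset// => Bkl; move/eqP : kk0; apply.
      by apply: tB => //; exists l.
    case: (ltnP k0 m) => k0m.
      rewrite (bigD1 (Ordinal k0m))//= eqxx big1 ?addr0// => k /eqP kk0.
      by case: eqP => // h; exfalso; apply: kk0; exact: val_inj.
    rewrite big1// => k _; case: eqP => // h.
    by have := leq_trans (ltn_ord k) k0m; rewrite h ltnn.
  rewrite [in X in _ - X]indicE memNset// big1 ?subrr// => k _.
  by rewrite indicE memNset// => Bl; apply: nl; exists k.
apply: (@mulrel_cvg _ _ _ L (en O) ort tot nat \oo _ 1 d (pi_ f) u) => //.
- move=> m l _; case: (dE l) => [->|[k0 ->]]; first by rewrite sqn0.
  by case: (k0 < m)%N; rewrite ?subrr ?sqn0// sub0r sqnN sqn1.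
- move=> l _; case: (dE l) => [dl|[k0 dl]].
    by under eq_fun do rewrite dl sqn0; exact: cvg_cst.
  apply/cvgrPdist_lt => e e0; exists k0.+1 => // m /= km.
  by rewrite dl km subrr sqn0 subrr normr0.
Qed.

Lemma multiplier_spectral_integral (phi : R -> R[i]) (D : set (R -> R[i])) :
  measurable_fun setT (fun x : measurableTypeR R => Re (phi x)) ->
  measurable_fun setT (fun x : measurableTypeR R => Im (phi x)) ->
  (forall f, D f <-> L2 O f /\ exists u, mulrel phi (pi_ f) u) ->
  spectral_integral O specproj phi (Op D (multiplier O L phi)).
Proof.
move=> mR mI DE; split; first exact: (multiplier_linear spL DE).
move=> f hf; have [nu hnu] := spectral_measure_ex ort tot (pi_ f).
exists nu; split.
- move=> B mB; have [h r] := specprojP B hf.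
  by rewrite -(dot_l2pi h hf); exact: (spectral_measure_set ort tot hnu mB r).
- rewrite -(spectral_measure_dom ort tot hnu mR mI).
  by split=> [/DE[]//|h]; apply/DE.
- move=> Df; have [h r] := multiplier_dom spL DE Df.
  by rewrite -(dot_l2pi h hf); exact: (spectral_measure_dot ort tot hnu mR mI r).
Qed.

Lemma spectrum_group_exp t : is_exp_2pii O t A (U t).
Proof.
exists specproj; split; first exact: specproj_pvm.
- apply: multiplier_spectral_integral; [exact: measurable_id|exact: measurable_cst|].
  exact: (spectrum_domP spL).
have ml : measurable_fun (setT : set (measurableTypeR R)) (fun x : R => 2 * pi * t * x).
  by apply: measurable_funM => //; exact: measurable_cst.
have -> : total_op O (U t) = Op (L2 O) (multiplier O L (fun x => expi (2 * pi * t * x))).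
  rewrite /total_op /spectrum_group; congr (Op _ (multiplier _ _ _)).
  by apply/funext => l; congr expi; ring.
apply: multiplier_spectral_integral.
- exact: (measurableT_comp (continuous_measurable_fun (@continuous_cos R)) ml).
- exact: (measurableT_comp (continuous_measurable_fun (@continuous_sin R)) ml).
- by apply: (bounded_dom spL) => l _; rewrite sqn_expi.
Qed.

End functional_calculus.

(** * The group of a spectrum acts by local translations *)

Section local_translations.
Variables (R : realType) (O : domain R).
Local Notation mu := (@lebesgue_measure R).
Implicit Types (f g : R -> R[i]) (t : R).

Definition overlap t : set (measurableTypeR R) := O `&` [set y | domain_set O (y + t)].

Lemma measurable_overlap t : measurable (overlap t).
Proof.
apply: measurableI; first exact: domain_measurable.
by have := measurable_shift t measurableT (domain_measurable O); rewrite setTI.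
Qed.

Lemma overlap_sub t : overlap t `<=` O.
Proof. by move=> x []. Qed.

Lemma qint_overlap t (u : R -> R) : measurable_fun O u ->
  (qint mu (overlap t) u <= qint mu O u)%E.
Proof.
move=> mu_; apply: ge0_subset_integral.
- exact: measurable_overlap.
- exact: domain_measurable.
- exact: measurable_sqr.
- by move=> x _; rewrite lee_fin sqr_ge0.
- exact: overlap_sub.
Qed.

Lemma measurable_overlap_shift t (u : R -> R) : measurable_fun O u ->
  measurable_fun (overlap t) (fun x => u (x + t)).
Proof.
move=> mu_; have m1 := (measurable_restrictT u (domain_measurable O)).1 mu_.
have m2 := measurable_funTS (D := overlap t) (measurableT_comp m1 (measurable_shift t)).
apply: eq_measurable_fun m2 => x; rewrite inE => -[_ Oxt].
by rewrite /= patchE mem_set.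
Qed.

Lemma qint_overlap_shift t (u : R -> R) : measurable_fun O u ->
  (qint mu (overlap t) (fun x => u (x + t)%R) <= qint mu O u)%E.
Proof.
move=> mu_; have mO := domain_measurable O.
have m1 := (measurable_restrictT u mO).1 mu_.
have -> : qint mu O u = (\int[mu]_x (((u \_ O) x) ^+ 2)%:E)%E.
  rewrite /qint integral_mkcond; apply: eq_integral => x _.
  by rewrite !patchE; case: ifP => // _; rewrite expr0n.
rewrite -(ge0_integral_shift t (f := fun x => (((u \_ O) x) ^+ 2)%:E)); last 2 first.
- by apply/measurable_EFinP; exact: measurable_funX.
- by move=> x; rewrite lee_fin sqr_ge0.
rewrite /qint integral_mkcond; apply: ge0_le_integral => //.
- by move=> x _; rewrite patchE; case: ifP => // _; rewrite lee_fin sqr_ge0.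
- apply: (measurable_restrictT _ (measurable_overlap t)).1.
  by apply: measurable_sqr; exact: measurable_overlap_shift.
- apply/measurable_EFinP; apply: measurable_funX.
  exact: (measurableT_comp m1 (measurable_shift t)).
- move=> x _; rewrite patchE; case: ifPn => [|_]; last by rewrite lee_fin sqr_ge0.
  by rewrite inE => -[_ Oxt]; rewrite patchE mem_set.
Qed.

(** [g] is compared with the translate of [f] through the translate of [h]. On the overlap a
    translation does not increase the integral of a square over [O]. The 4 collects two errors, each
    doubled by [qintD]. *)
Lemma shift_approx t (P : R[i] -> R) (f g h : R -> R[i]) (eps : R) :
  (forall z w, P (z - w) = P z - P w) ->
  (forall k, L2 O k -> measurable_fun O (fun x => P (k x)) /\
     (qint mu O (fun x => P (k x)) <= (fine (mu O) * Re (dotp O k k))%:E)%E) ->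
  L2 O f -> L2 O g -> L2 O h -> L2 O (fun x => h (x + t)) ->
  Re (dotp O (fun x => g x - h (x + t)) (fun x => g x - h (x + t))) <= eps ->
  Re (dotp O (fun x => h x - f x) (fun x => h x - f x)) <= eps ->
  (qint mu (overlap t) (fun x => P (g x) - P (f (x + t)))%R <=
     (4 * (fine (mu O) * eps))%:E)%E.
Proof.
move=> PB hP hf hg hh hht ge he; have V0 := vol_gt0 O.
have [m1 q1] := hP _ (L2B hg hht); have [m2 q2] := hP _ (L2B hh hf).
have mo := measurable_overlap t.
have m1' : measurable_fun (overlap t) (fun x => P (g x - h (x + t))).
  by apply: measurable_funS m1; [exact: domain_measurable|exact: overlap_sub].
have m2' := @measurable_overlap_shift t (fun x => P (h x - f x)) m2.
rewrite (_ : (fun x => _) = (fun x => P (g x - h (x + t)) + P (h (x + t) - f (x + t)))%R).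
  apply: le_trans (qintD mu mo m1' m2') _.
  have -> : (4 * (fine (mu O) * eps))%:E = (2%:E * (fine (mu O) * eps)%:E +
      2%:E * (fine (mu O) * eps)%:E)%E by rewrite -!EFinM -EFinD; congr EFin; ring.
  apply: leeD; apply: lee_wpmul2l => //.
    apply: le_trans (@qint_overlap t (fun x => P (g x - h (x + t))) m1) _; apply: le_trans q1 _.
    by rewrite lee_fin ler_wpM2l// ltW.
  apply: le_trans (@qint_overlap_shift t (fun x => P (h x - f x)) m2) _; apply: le_trans q2 _.
  by rewrite lee_fin ler_wpM2l// ltW.
by apply/funext => x; rewrite !PB addrA subrK.
Qed.

(** It is enough to approximate [f] by functions [h] whose translates approximate [g]: the integral
    of the squared difference over the overlap is then below every [eps]. *)
Lemma shift_ae t f g : L2 O f -> L2 O g ->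
  (forall eps : R, 0 < eps -> exists h, [/\ L2 O h, L2 O (fun x => h (x + t)),
     Re (dotp O (fun x => g x - h (x + t)) (fun x => g x - h (x + t))) <= eps &
     Re (dotp O (fun x => h x - f x) (fun x => h x - f x)) <= eps]) ->
  {ae mu, forall x, overlap t x -> g x = f (x + t)}.
Proof.
move=> hf hg hap; have V0 := vol_gt0 O; have mo := measurable_overlap t.
have key (P : R[i] -> R) : (forall z w, P (z - w) = P z - P w) ->
    (forall k, L2 O k -> measurable_fun O (fun x => P (k x)) /\
       (qint mu O (fun x => P (k x)) <= (fine (mu O) * Re (dotp O k k))%:E)%E) ->
    {ae mu, forall x, overlap t x -> P (g x) - P (f (x + t)) = 0}.
  move=> PB hP; apply: (qint_eq0 mo).
    apply: measurable_funB; last exact: (@measurable_overlap_shift t (fun x => P (f x)) (hP _ hf).1).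
    have [m1 _] := hP _ hg.
    by apply: measurable_funS m1; [exact: domain_measurable|exact: overlap_sub].
  apply/eqP; rewrite eq_le qint_ge0 andbT; apply/lee_addgt0Pr => eps e0; rewrite add0e.
  have [|h [hh hht h1 h2]] := hap (eps / (4 * fine (mu O))).
    by rewrite divr_gt0 ?mulr_gt0.
  apply: le_trans (shift_approx PB hP hf hg hh hht h1 h2) _.
  rewrite lee_fin (_ : 4 * _ = eps)//; field.
  by rewrite gt_eqF.
have kR := key (@complex.Re R) (@ReB R) _; have kI := key (@complex.Im R) (@ImB R) _.
have {}kR : {ae mu, forall x, overlap t x -> Re (g x) - Re (f (x + t)) = 0}.
  apply: kR => k hk; have [q1 _] := qint_le_dotp hk.
  by have [[] //] := (L2P O k).1 hk.
have {}kI : {ae mu, forall x, overlap t x -> Im (g x) - Im (f (x + t)) = 0}.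
  apply: kI => k hk; have [_ q1] := qint_le_dotp hk.
  by have [_ [] //] := (L2P O k).1 hk.
apply: filterS2 kR kI => x h1 h2 Ox; apply: complex_eqP; apply/eqP.
  by rewrite -subr_eq0 h1.
by rewrite -subr_eq0 h2.
Qed.

Variable L : set R.
Hypothesis spL : is_spectrum O L.

Lemma spectrum_group_local_translations : local_translations O (spectrum_group O L).
Proof.
split; first exact: group_group spL.
move=> f t hf; have [hg fr] := group_P spL t hf.
apply: (shift_ae hf hg) => eps e0.
have [|F FL hF] := total_hexp (spectrum_ort spL) (l2pi O f) (spectrum_total spL) (eps := Num.sqrt eps).
  by rewrite sqrtr_gt0.
have {hF} := hF F (@subset_refl _ _) FL.
set a := fun l => dot _ _.
rewrite nrm_lt ?sqrtr_ge0// sqr_sqrtr ?ltW// => hF.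
pose h x := \sum_(l <- F) a l * e_ l x.
have hh : L2 O h by exact: L2_psum.
pose b l := expi (2 * pi * l * t) * a l.
have Eh : (fun x => h (x + t)) = (fun x => \sum_(l <- F) b l * e_ l x).
  apply/funext => x; apply: eq_bigr => l _.
  by rewrite e_add mulrA [a l * _]mulrC.
have hht : L2 O (fun x => h (x + t)) by rewrite Eh; exact: L2_psum.
exists h; split=> //.
  (* The error after translation is the image of [f - h] under a multiplier of modulus one, so it is
     no larger than the error before. *)
  rewrite -(dot_l2pi (L2B hg hht) (L2B hg hht)) -(l2pi_sub hg hht) Eh l2pi_psum -/(nsq _).
  apply: le_trans (ltW hF); rewrite -[leRHS]mul1r.
  have rel := mulrel_psum spL (fun l => expi (2 * pi * l * t)) a FL.
  apply: (bounded_mulrel (spectrum_ort spL) (spectrum_total spL) (m := fun l => expi (2 * pi * l * t))).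
    by move=> l _; rewrite sqn_expi.
  exact: mulrel_sub fr rel.
rewrite -(dot_l2pi (L2B hh hf) (L2B hh hf)) -(l2pi_sub hh hf) l2pi_psum -/(nsq _).
by rewrite nsqC ltW.
Qed.

End local_translations.

(** * Partition into short intervals *)

Section cells.
Variable R : realType.
Local Notation mu := (@lebesgue_measure R).
Local Notation cell p := (`]p.1, (p.1 + p.2)[%classic : set (measurableTypeR R)).

(* The last clause says that the cells cover [O] up to a null set. *)
Definition fine_cells (O : set (measurableTypeR R)) := forall eps : R, 0 < eps ->
  exists s : seq (R * R), [/\ forall p, p \in s -> 0 < p.2 /\ cell p `<=` O,
    \sum_(p <- s) p.2 ^+ 2 <= eps &
    forall h : measurableTypeR R -> \bar R, measurable_fun O h -> (forall x, 0 <= h x)%E ->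
      (\int[mu]_(x in O) h x <= \sum_(p <- s) \int[mu]_(x in cell p) h x)%E].

Lemma measurable_fun_itvS (i : interval R) (A : set (measurableTypeR R))
    (h : measurableTypeR R -> \bar R) :
  measurable_fun ([set` i] : set (measurableTypeR R)) h -> A `<=` [set` i] ->
  measurable_fun A h.
Proof. by move=> mh Ai; apply: (measurable_funS _ Ai mh); exact: measurable_itv. Qed.

Lemma integral_cells (a l : R) (k : nat) (h : measurableTypeR R -> \bar R) : 0 < l ->
  measurable_fun (`]a, (a + k%:R * l)[%classic : set (measurableTypeR R)) h ->
  (forall x, 0 <= h x)%E ->
  (\int[mu]_(x in `]a, (a + k%:R * l)%R[%classic) h x =
   \sum_(j < k) \int[mu]_(x in `](a + j%:R * l)%R, (a + j%:R * l + l)%R[%classic) h x)%E.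
Proof.
move=> l0; elim: k => [|k IH] mh h0.
  by rewrite mul0r addr0 big_ord0 set_itvoo0 integral_set0.
have kl : 0 <= k%:R * l by rewrite mulr_ge0// ltW.
have E1 : a + k.+1%:R * l = a + k%:R * l + l by rewrite -natr1 mulrDl mul1r addrA.
rewrite big_ord_recr /= -IH//; last first.
  refine (measurable_fun_itvS mh _).
  by move=> x /=; rewrite !in_itv /= => /andP[-> /=]; rewrite E1; lra.
have [k0|k0] := eqVneq (k%:R * l) 0.
  by rewrite E1 k0 addr0 set_itvoo0 integral_set0 add0e.
have kl0 : 0 < k%:R * l by rewrite lt_def k0.
have -> : (`]a, (a + k.+1%:R * l)%R[%classic : set (measurableTypeR R)) =
    `]a, (a + k%:R * l)%R]%classic `|` `](a + k%:R * l)%R, (a + k%:R * l + l)%R[%classic.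
  by rewrite -itv_bndbnd_setU ?E1// bnd_simp; lra.
rewrite ge0_integral_setU//.
- congr (_ + _)%E; apply/esym/integral_itv_bndo_bndc.
  refine (measurable_fun_itvS mh _).
  by move=> x /=; rewrite !in_itv /= => /andP[-> /=]; rewrite E1; lra.
- by rewrite -itv_bndbnd_setU -?E1// bnd_simp; lra.
- apply/disj_setPS => x [] /=; rewrite !in_itv /= => /andP[_ h1] /andP[h2 _]; lra.
Qed.

Lemma fine_cells_itv (a b : R) : a < b -> fine_cells `]a, b[%classic.
Proof.
move=> ab eps e0.
(* [N] equal cells have lengths whose squares sum to [(b - a) ^ 2 / N]. *)
pose N := (Num.truncn ((b - a) ^+ 2 / eps)).+1.
have N0 : 0 < N%:R :> R by rewrite ltr0n.
have hN : (b - a) ^+ 2 / eps < N%:R by exact: truncnS_gt.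
pose l := (b - a) / N%:R.
have l0 : 0 < l by rewrite divr_gt0 ?subr_gt0.
have Nl : N%:R * l = b - a by rewrite /l mulrC divfK ?gt_eqF.
exists [seq (a + (j : 'I_N)%:R * l, l) | j <- index_enum 'I_N]; split.
- move=> p /mapP[j _ ->] /=; split=> // x /=; rewrite !in_itv /= => /andP[h1 h2].
  have jl : 0 <= j%:R * l by rewrite mulr_ge0// ltW.
  have : j%:R * l + l <= N%:R * l.
    by rewrite -{2}[l]mul1r -mulrDl ler_wpM2r ?(ltW l0)// natr1 ler_nat.
  by rewrite Nl => h3; apply/andP; split; lra.
- rewrite big_map /= sumr_const card_ord -mulr_natl.
  rewrite expr2 mulrA Nl /l mulrA -expr2.
  by rewrite ler_pdivrMr// [eps * _]mulrC -ler_pdivrMr// ltW.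
- move=> h mh h0; rewrite big_map /=.
  have E : b = a + N%:R * l by rewrite Nl; lra.
  by rewrite {1}E -integral_cells// -?E.
Qed.

(** The cells only have to bound integrals from above, so it suffices to split off [B \ A] and
    enlarge it to [B]. *)
Lemma fine_cells_setU (A B : set (measurableTypeR R)) : measurable A -> measurable B ->
  fine_cells A -> fine_cells B -> fine_cells (A `|` B).
Proof.
move=> mA mB fA fB eps e0; have e2 : 0 < eps / 2 by rewrite divr_gt0.
have [s [s1 s2 s3]] := fA _ e2; have [t [t1 t2 t3]] := fB _ e2.
exists (s ++ t); split.
- move=> p; rewrite mem_cat => /orP[/s1|/t1][p0 pO]; split=> //.
    by move=> x /pO; left.
  by move=> x /pO; right.
- by rewrite big_cat /= (splitr eps) lerD.
- move=> h mh h0; rewrite big_cat /=.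
  have mhA : measurable_fun A h by apply: measurable_funS mh => //; exact: measurableU.
  have mhB : measurable_fun B h by apply: measurable_funS mh => //; exact: measurableU.
  apply: le_trans (leeD (s3 h mhA h0) (t3 h mhB h0)).
  have -> : A `|` B = A `|` (B `\` A).
    apply/seteqP; split=> x [Ax|]; [by left| |by left|by case; right].
    by move=> Bx; have [Ax|nAx] := pselect (A x); [left|right].
  have mBA : measurable (B `\` A) by exact: measurableD.
  rewrite ge0_integral_setU//; last 2 first.
  - by apply/measurable_funU => //; split=> //; apply: measurable_funS mhB.
  - by apply/disj_setPS => x [Ax []].
  by apply: leeD => //; apply: ge0_subset_integral => // x [].
Qed.

Lemma fine_cells_set0 : fine_cells set0.
Proof.
move=> eps e0; exists [::]; rewrite big_nil ltW//; split=> // h _ _.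
by rewrite integral_set0 big_nil.
Qed.

Lemma fine_cells_bigcup (n : nat) (alpha beta : 'I_n -> R) :
  (forall i, alpha i < beta i) ->
  fine_cells (\bigcup_(i in [set: 'I_n]) `]alpha i, beta i[%classic).
Proof.
move=> ab.
have -> : \bigcup_(i in [set: 'I_n]) `]alpha i, beta i[%classic =
    \bigcup_(i in [set` enum 'I_n]) `]alpha i, beta i[%classic.
  by congr bigcup; apply/seteqP; split=> // i _ /=; rewrite mem_enum.
rewrite bigcup_seq.
elim: (enum 'I_n) => [|i s IH]; first by rewrite big_nil; exact: fine_cells_set0.
have mF j : measurable (`]alpha j, beta j[%classic : set (measurableTypeR R)).
  exact: measurable_itv.
rewrite big_cons; refine (fine_cells_setU (mF i) _ (fine_cells_itv (ab i)) IH).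
by apply: bigsetU_measurable.
Qed.

End cells.

(** * Operators induced on classes *)

Section l2_operators.
Variables (R : realType) (O : domain R).
Implicit Types (f g : R -> R[i]) (u v : l2space O).

Definition l2op (V : (R -> R[i]) -> R -> R[i]) u : l2space O := l2pi O (V u).

Lemma l2opE V f : linear_op O (total_op O V) -> L2 O f -> l2op V (l2pi O f) = l2pi O (V f).
Proof.
move=> lin hf; have hp := l2fun_L2 (l2pi O f).
have [_ E] := op_aeq lin hp hf (l2piE hf).
exact: (l2pi_eq (op_L2 lin hp) (op_L2 lin hf) E).
Qed.

Lemma ugroup_l2op U : unitary_group O U -> ugroup (fun t => l2op (U t)).
Proof.
move=> UU; have lin t : linear_op O (total_op O (U t)) by have [] := ug_unitary UU t.
have hU t u : L2 O (U t u) := op_L2 (lin t) (l2fun_L2 u).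
split.
- move=> t c f g; have hf := l2fun_L2 f; have hg := l2fun_L2 g.
  rewrite -{1}(l2piK f) -{1}(l2piK g) -(l2pi_lin c hf hg) (l2opE (lin t) (L2_lin c hf hg)).
  have [_ E] := op_lin (lin t) c hf hg.
  rewrite (l2pi_eq (op_L2 (lin t) (L2_lin c hf hg)) (L2_lin c (hU t f) (hU t g)) E).
  exact: (l2pi_lin c (hU t f) (hU t g)).
- move=> t f g; rewrite /l2op (dot_l2pi (hU t f) (hU t g)).
  by have [_ h _] := ug_unitary UU t; rewrite h; [|exact: l2fun_L2..].
- move=> f; rewrite -[RHS]l2piK; apply: (l2pi_eq (hU 0 f) (l2fun_L2 f)).
  exact: (ug_0 UU (l2fun_L2 f)).
- move=> s t f; rewrite {3}/l2op (l2opE (lin s) (hU t f)).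
  exact: (l2pi_eq (hU (s + t) f) (op_L2 (lin s) (hU t f)) (ug_add UU s t (l2fun_L2 f))).
- move=> f t0; rewrite /hcvg.
  rewrite (_ : (fun t => nrm _) = (fun t => norm2 O (fun x => U t f x - U t0 f x))).
    exact: (ug_cont UU t0 (l2fun_L2 f)).
  apply/funext => t; rewrite -(nrm_l2pi (L2B (hU t f) (hU t0 f))).
  by rewrite -(l2pi_sub (hU t f) (hU t0 f)).
Qed.

End l2_operators.

(** * The Poincare inequality for local translations *)

Section local_energy.
Variables (R : realType) (O : domain R) (U : R -> (R -> R[i]) -> R -> R[i]).
Local Notation mu := (@lebesgue_measure R).
Hypothesis UO : local_translations O U.
Implicit Types (f g : R -> R[i]) (u v d : l2space O) (P : R[i] -> R).

Let V t := @l2op R O (U t).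
Let UU := UO.1.
Let lin t : linear_op O (total_op O (U t)).
Proof. by have [] := ug_unitary UU t. Qed.
Let hU t f (hf : L2 O f) : L2 O (U t f) := op_L2 (lin t) hf.

(** [variance_bound] concerns real functions; quantifying over the two projections treats both parts
    at once. *)
Definition re_or_im P := P = @complex.Re R \/ P = @complex.Im R.

Lemma re_or_im_sub P z w : re_or_im P -> P (z - w) = P z - P w.
Proof. by case=> ->; [rewrite ReB|rewrite ImB]. Qed.

Lemma re_or_im_sqint P f : re_or_im P -> L2 O f -> sqint mu O (fun x => P (f x)).
Proof. by case=> -> /L2P[]. Qed.

Lemma re_or_im_qint P f : re_or_im P -> L2 O f ->
  (qint mu O (fun x => P (f x)) <= (fine (mu O) * Re (dotp O f f))%:E)%E.
Proof. by case=> -> /qint_le_dotp[]. Qed.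

(** Where [x] and [x + t] both lie in [D], the increment of [d] is, up to sign, the value of
    [U t d - d]. The factor [fine (mu O)] undoes the normalization of [dotp]. *)
Lemma overlap_energy P t d (D : set (measurableTypeR R)) : re_or_im P ->
  measurable D -> D `<=` O ->
  (\int[mu]_(x in D `&` [set y | D (y + t)%R]) ((P (d x) - P (d (x + t))) ^+ 2)%:E <=
     (fine (mu O) * nsq (V t d - d))%:E)%E.
Proof.
move=> PP mD DO; have hd := l2fun_L2 d; have hUd := hU t hd.
have mA : measurable (D `&` [set y | D (y + t)] : set (measurableTypeR R)).
  by apply: measurableI => //; have := measurable_shift t measurableT mD; rewrite setTI.
have AO : D `&` [set y | D (y + t)] `<=` overlap O t by move=> x [/DO Ox /DO Oxt].
have hB := L2B hd hUd.
have -> : nsq (V t d - d) = Re (dotp O (fun x => d x - U t d x) (fun x => d x - U t d x)).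
  rewrite -(dot_l2pi hB hB) -(l2pi_sub hd hUd) -/(nsq _) nsqC l2piK //.
apply: le_trans (re_or_im_qint PP hB).
have mo := measurable_overlap O t.
have md := (re_or_im_sqint PP hd).1.
have mdt : measurable_fun (overlap O t) (fun x => P (d (x + t))).
  exact: (@measurable_overlap_shift R O t (fun x => P (d x)) md).
have mdo : measurable_fun (overlap O t) (fun x => P (d x)).
  by apply: measurable_funS md; [exact: domain_measurable|exact: overlap_sub].
apply: (@le_trans _ _ (qint mu (overlap O t) (fun x => P (d x - U t d x)))); last first.
  apply: (@qint_overlap R O t (fun x => P (d x - U t d x))).
  exact: (re_or_im_sqint PP hB).1.
have mB : measurable_fun (overlap O t) (fun x => P (d x - U t d x)).
  apply: measurable_funS (re_or_im_sqint PP hB).1; first exact: domain_measurable.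
  exact: overlap_sub.
rewrite [leRHS](_ : _ = qint mu (overlap O t) (fun x => P (d x) - P (d (x + t)))); last first.
  apply: ae_eq_integral => //.
  - exact: measurable_sqr.
  - by apply: measurable_sqr; exact: measurable_funB.
  - have := UO.2 d t hd; apply: filterS => x h Ox.
    by rewrite (h Ox) re_or_im_sub.
apply: ge0_subset_integral => //.
  by apply: measurable_sqr; exact: measurable_funB.
by move=> x _; rewrite lee_fin sqr_ge0.
Qed.

Lemma complex_variance_bound (D : set (measurableTypeR R)) (a L K : R) f :
  measurable D -> D `<=` O -> 0 <= L -> D `<=` `]a, a + L[%classic -> L2 O f -> 0 <= K ->
  (forall P t, re_or_im P ->
     (\int[mu]_(x in D `&` [set y | D (y + t)%R])
        ((P (f x) - P (f (x + t))) ^+ 2)%:E <= K%:E)%E) ->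
  fine (mu D) * (\int[mu]_(x in D) (Re (f x) ^+ 2) + \int[mu]_(x in D) (Im (f x) ^+ 2)) <=
  sqn (cintegral mu D f) + 2 * (L * K).
Proof.
move=> mD DO L0 DL hf K0 hK.
have key P : re_or_im P -> fine (mu D) * \int[mu]_(x in D) (P (f x) ^+ 2) <=
    (\int[mu]_(x in D) P (f x)) ^+ 2 + L * K.
  move=> PP; have [m1 q1] := re_or_im_sqint PP hf.
  apply: (@variance_bound R D mD a L L0 DL (fun x => P (f x)) K) => //; last first.
    by move=> t; exact: hK.
  split; first by apply: measurable_funS m1 => //; exact: domain_measurable.
  apply: le_lt_trans q1; apply: ge0_subset_integral => //.
  - exact: domain_measurable.
  - exact: measurable_sqr.
  - by move=> x _; rewrite lee_fin sqr_ge0.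
rewrite mulrDr /sqn /cintegral /=.
have := key (@complex.Re R) (or_introl erefl); have := key (@complex.Im R) (or_intror erefl).
lra.
Qed.

Definition indicC (D : set R) : R -> R[i] := fun x => (\1_D x)%:C.

Lemma L2_indicC (D : set (measurableTypeR R)) : measurable D -> L2 O (indicC D).
Proof.
move=> mD; apply/L2P; split; apply: bounded_sqint => /=.
- exact: measurable_indic.
- by move=> x; rewrite indicE; case: (x \in D); rewrite ?normr0 ?normr1.
- exact: measurable_cst.
- by move=> x; rewrite normr0.
Qed.

Lemma dot_indicC (D : set (measurableTypeR R)) f : measurable D -> D `<=` O -> L2 O f ->
  dotp O f (indicC D) = ((fine (mu O))^-1)%:C * cintegral mu D f.
Proof.
move=> mD DO hf; rewrite /dotp; congr (_ * _).
have E P : (forall z (b : bool), P (z * (b%:R%:C)^*) = if b then P z else 0) ->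
    \int[mu]_(x in O) P (f x * (indicC D x)^*) = \int[mu]_(x in D) P (f x).
  move=> hP; rewrite /Rintegral; congr fine.
  rewrite [RHS]integral_mkcond [LHS]integral_mkcond; apply: eq_integral => x _.
  rewrite !patchE /indicC indicE hP; case: ifPn; case: ifPn => //.
  by rewrite !inE => /DO h; rewrite notin_setE.
rewrite /cintegral (E (@complex.Re R)) ?(E (@complex.Im R))// => z [];
  by rewrite ?conjc1 ?mulr1 ?conjc0 ?mulr0.
Qed.

Lemma sqint_fine (u : R -> R) (D : set (measurableTypeR R)) : sqint mu D u ->
  qint mu D u = (\int[mu]_(x in D) (u x ^+ 2))%:E.
Proof. by move=> [_ q]; rewrite /Rintegral fineK// ge0_fin_numE ?qint_ge0. Qed.

Lemma poincare_local_translations : fine_cells O -> poincare V.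
Proof.
(* Half of [eps], because [complex_variance_bound] adds two real bounds and so carries a factor
   2. *)
move=> fO eps e0; have e2 : 0 < eps / 2 by rewrite divr_gt0.
have [s [s1 s2 s3]] := fO _ e2; have V0 := vol_gt0 O; set W := fine (mu O) in V0.
pose cell (p : R * R) : set (measurableTypeR R) := `]p.1, (p.1 + p.2)[%classic.
have mc p : measurable (cell p) by exact: measurable_itv.
(* Scaled so that [W * sqn (dot d (phi p))] is the squared modulus of the integral of [d] over the
   cell, divided by the length [p.2]. *)
pose phi (p : R * R) : l2space O := (Num.sqrt (W / p.2))%:C *: l2pi O (indicC (cell p)).
exists [seq phi p | p <- s] => d C C0 hd.
have hL2 := l2fun_L2 d.
have sqc P p : re_or_im P -> p \in s -> sqint mu (cell p) (fun x => P (d x)).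
  move=> PP /s1[p0 pO]; have [m1 q1] := re_or_im_sqint PP hL2.
  split; first by apply: measurable_funS m1 => //; exact: domain_measurable.
  apply: le_lt_trans q1; apply: ge0_subset_integral => //.
  - exact: domain_measurable.
  - exact: measurable_sqr.
  - by move=> x _; rewrite lee_fin sqr_ge0.
pose I p := \int[mu]_(x in cell p) (Re (d x) ^+ 2) + \int[mu]_(x in cell p) (Im (d x) ^+ 2).
have local p : p \in s ->
    I p <= W * sqn (dot d (phi p)) + 2 * (W * C ^+ 2 * p.2 ^+ 2).
  move=> ps; have [p0 pO] := s1 _ ps; set K := W * C ^+ 2 * p.2 ^+ 2.
  have K0 : 0 <= K by rewrite !mulr_ge0 ?sqr_ge0// ltW.
  have := @complex_variance_bound (cell p) p.1 p.2 K d (mc p) pO (ltW p0) (@subset_refl _ _) hL2 K0.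
  have -> : fine (mu (cell p)) = p.2.
    by rewrite /cell lebesgue_measure_itv /= lte_fin ltrDl p0 -EFinB /= addrC addKr.
  move=> h; have {}h := h _.
  have {}h : p.2 * I p <= sqn (cintegral mu (cell p) d) + 2 * (p.2 * K).
    apply: h => P t PP; have [tp|tp] := ltP `|t| p.2.
      apply: le_trans (@overlap_energy P t d (cell p) PP (mc p) pO) _.
      rewrite lee_fin /K -mulrA ler_wpM2l ?(ltW V0)// -exprMn -nrm_le ?mulr_ge0 ?(ltW p0)//.
      by apply: le_trans (hd t) _; rewrite ler_wpM2l// ltW.
    (* A cell does not meet its translates by at least its own length; only [|t| < p.2] matters,
       whence [p.2 ^ 2] in [K]. *)
    rewrite (_ : _ `&` _ = set0) ?integral_set0// -subset0 => x [].
    rewrite /cell /= !in_itv /= => /andP[h1 h2] /andP[h3 h4].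
    by move: tp; rewrite leNgt ltr_norml => /negP; apply; apply/andP; split; lra.
  have -> : W * sqn (dot d (phi p)) = sqn (cintegral mu (cell p) d) / p.2.
    rewrite /phi dotZr -{1}(l2piK d) (dot_l2pi hL2 (L2_indicC (mc p))).
    rewrite (dot_indicC (mc p) pO hL2) !sqnM sqnJ !sqnR sqr_sqrtr ?divr_ge0 ?ltW//.
    rewrite -/W; field.
    by rewrite !gt_eqF.
  have -> : sqn (cintegral mu (cell p) d) / p.2 + 2 * K =
      (sqn (cintegral mu (cell p) d) + 2 * (p.2 * K)) / p.2.
    by field; rewrite gt_eqF.
  by rewrite ler_pdivlMr// mulrC.
rewrite big_map /=.
have : W * nsq d <= \sum_(p <- s) I p.
  rewrite -lee_fin /nsq.
  have -> : (W * Re (dot d d))%:E = (qint mu O (fun x => Re (d x)) + qint mu O (fun x => Im (d x)))%E.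
    by rewrite EFinM (Re_dotp hL2) muleA -EFinM mulfV ?gt_eqF// mul1e.
  have sum P : re_or_im P -> (qint mu O (fun x => P (d x)) <=
      (\sum_(p <- s) \int[mu]_(x in cell p) (P (d x) ^+ 2))%:E)%E.
    move=> PP; have [m1 _] := re_or_im_sqint PP hL2.
    apply: le_trans (s3 (fun x => (P (d x) ^+ 2)%:E) _ _) _.
    - exact: measurable_sqr.
    - by move=> x; rewrite lee_fin sqr_ge0.
    - rewrite -sumEFin big_seq [leRHS]big_seq; apply: lee_sum => p ps.
      by rewrite -(sqint_fine (sqc P p PP ps)).
  rewrite big_split EFinD; apply: leeD.
    exact: (sum (@complex.Re R) (or_introl erefl)).
  exact: (sum (@complex.Im R) (or_intror erefl)).
have : \sum_(p <- s) I p <= W * (\sum_(p <- s) sqn (dot d (phi p))) + W * (eps * C ^+ 2).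
  apply: (@le_trans _ _ (\sum_(p <- s) (W * sqn (dot d (phi p)) + 2 * (W * C ^+ 2 * p.2 ^+ 2)))).
    by rewrite big_seq [leRHS]big_seq; apply: ler_sum.
  rewrite big_split /= -mulr_sumr lerD2l -mulr_sumr -mulr_sumr.
  have -> : W * (eps * C ^+ 2) = 2 * (W * C ^+ 2 * (eps / 2)) by field.
  by rewrite ler_wpM2l// ler_wpM2l// mulr_ge0 ?sqr_ge0// ltW.
move=> h1 h2; rewrite -(ler_pM2l V0); apply: le_trans h2 _; apply: le_trans h1 _.
by rewrite mulrDr addrC.
Qed.

End local_energy.

(** * From local translations to a spectrum *)

Section converse.
Variables (R : realType) (O : domain R) (U : R -> (R -> R[i]) -> R -> R[i]).
Local Notation mu := (@lebesgue_measure R).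
Local Notation en := (en O).
Hypothesis UO : local_translations O U.
Variables a B : R.
Hypotheses (B0 : 0 <= B) (OB : O `<=` `]a, a + B[%classic).
Implicit Types (f g : R -> R[i]) (u v d : l2space O) (P : R[i] -> R).

Let V t := @l2op R O (U t).
Let UU := UO.1.
Let VV : ugroup V := ugroup_l2op UU.
Let lin t : linear_op O (total_op O (U t)).
Proof. by have [] := ug_unitary UU t. Qed.

Section demodulation.
Variables (f : R -> R[i]) (l : R).
Hypothesis hf : L2 O f.
Let g x := f x * (e_ l x)^*.

Let sqn_g x : sqn (g x) = sqn (f x).
Proof. by rewrite /g sqnM sqnJ sqn_expi mulr1. Qed.

Let mg : measurable_fun O (fun x => Re (g x)) /\ measurable_fun O (fun x => Im (g x)).
Proof.
have [h1 h2] := L2_cintegrable hf (L2_e O l).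
by split; apply/measurable_EFinP; [exact: measurable_int h1|exact: measurable_int h2].
Qed.

Let qint_split h : measurable_fun O (fun x => Re (h x)) ->
  measurable_fun O (fun x => Im (h x)) ->
  (qint mu O (fun x => Re (h x)) + qint mu O (fun x => Im (h x)) =
   \int[mu]_(x in O) (sqn (h x))%:E)%E.
Proof.
move=> m1 m2; rewrite /qint -ge0_integralD//.
- exact: domain_measurable.
- by move=> x _; rewrite lee_fin sqr_ge0.
- exact: measurable_sqr.
- by move=> x _; rewrite lee_fin sqr_ge0.
- exact: measurable_sqr.
Qed.

Let qint_g : (qint mu O (fun x => Re (g x)) + qint mu O (fun x => Im (g x)) =
  qint mu O (fun x => Re (f x)) + qint mu O (fun x => Im (f x)))%E.
Proof.
have [[m1 _] [m2 _]] := (L2P O f).1 hf.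
rewrite (qint_split mg.1 mg.2) (qint_split m1 m2).
by apply: eq_integral => x _; rewrite sqn_g.
Qed.

(** A factor of modulus one mixes real and imaginary parts but preserves the sum of their squares,
    so integrability is read off from that sum. *)
Lemma L2_demodulation : L2 O g.
Proof.
have [[_ q1] [_ q2]] := (L2P O f).1 hf.
have q : (qint mu O (fun x => Re (g x)) + qint mu O (fun x => Im (g x)) < +oo)%E.
  by rewrite qint_g lte_add_pinfty.
apply/L2P; split; (split; [by case: mg|]); apply: le_lt_trans q.
  by rewrite leeDl// qint_ge0.
by rewrite leeDr// qint_ge0.
Qed.

Lemma dotp_demodulation : dotp O g g = dotp O f f.
Proof.
have hg := L2_demodulation.
have E h : L2 O h -> dotp O h h = (Re (dotp O h h))%:C.
  by move=> hh; rewrite -(dot_l2pi hh hh) dotff.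
rewrite (E _ hg) (E _ hf); congr (_%:C); apply/EFin_inj.
by rewrite (Re_dotp hg) (Re_dotp hf) qint_g.
Qed.

End demodulation.

Let twopi_neq0 : 2 * pi != 0 :> R. Proof. by rewrite gt_eqF// mulr_gt0// pi_gt0. Qed.

(** The variance bound with [K = 0] says that the mean of the demodulated [v] has squared modulus at
    least [nsq v]. This mean is the coefficient of [v] on the unit vector [en l], so Cauchy-Schwarz
    is an equality and [v] is a multiple of [en l]. *)
Lemma eigenvector_exponential v (sigma : R) :
  (forall t, V t v = expi (sigma * t) *: v) ->
  v = dot v (en (sigma / (2 * pi))) *: en (sigma / (2 * pi)).
Proof.
set l := sigma / (2 * pi) => hv.
have ls t : 2 * pi * l * t = sigma * t.
  by rewrite /l [2 * pi * _]mulrC divfK.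
have hL2 := l2fun_L2 v; pose g x := v x * (e_ l x)^*.
have hg : L2 O g := L2_demodulation l hL2.
have V0 := vol_gt0 O.
have ginv t : {ae mu, forall x, overlap O t x -> g (x + t) = g x}.
  have h1 := UO.2 v t hL2; have h2 : aeq O (V t v) (U t v) := l2piE (op_L2 (lin t) hL2).
  have h3 := l2scaleE (expi (sigma * t)) v; rewrite -hv in h3.
  apply: filterS3 h1 h2 h3 => x h1 h2 h3 Ox.
  have Ox' : domain_set O x by case: Ox.
  rewrite /g -(h1 Ox) -(h2 Ox') (h3 Ox') e_add ls conjcM mulrACA mul_conjc sqn_expi.
  by rewrite rmorph1 mul1r.
have g0 P t : re_or_im P ->
    (\int[mu]_(x in O `&` [set y | domain_set O (y + t)%R])
      ((P (g x) - P (g (x + t))) ^+ 2)%:E <= 0%:E)%E.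
  move=> PP; rewrite (_ : integral _ _ _ = 0%E)//.
  rewrite -(@integral0 _ _ _ mu (overlap O t)); apply: ae_eq_integral => //.
  - exact: measurable_overlap.
  - apply: measurable_sqr; apply: measurable_funB.
      apply: measurable_funS (re_or_im_sqint PP hg).1; first exact: domain_measurable.
      exact: overlap_sub.
    apply: (@measurable_overlap_shift R O t (fun x => P (g x))).
    exact: (re_or_im_sqint PP hg).1.
  - by apply: filterS (ginv t) => x h Ox; rewrite (h Ox) subrr expr0n.
have := @complex_variance_bound R O O a B 0 g (domain_measurable O) (@subset_refl _ _)
  B0 OB hg (lexx 0) g0.
rewrite !mulr0 addr0.
have -> : \int[mu]_(x in O) Re (g x) ^+ 2 + \int[mu]_(x in O) Im (g x) ^+ 2 =
    fine (mu O) * nsq v.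
  apply: EFin_inj; rewrite EFinD /nsq -[Re (dot v v)]/(Re (dotp O v v)).
  rewrite -(dotp_demodulation l hL2) EFinM (Re_dotp hg) muleA -EFinM mulfV ?gt_eqF// mul1e.
  by rewrite -(sqint_fine (re_or_im_sqint (or_introl erefl) hg))
    -(sqint_fine (re_or_im_sqint (or_intror erefl) hg)).
have -> : cintegral mu O g = (fine (mu O))%:C * dot v (en l).
  rewrite -[in RHS](l2piK v) (dot_l2pi hL2 (L2_e O l)) /dotp mulrA -rmorphM mulfV ?gt_eqF//.
  by rewrite rmorph1 mul1r.
rewrite sqnM sqnR expr2 mulrA ler_pM2l ?mulr_gt0// => h.
set c := dot v (en l) in h *.
apply/eqP; rewrite -subr_eq0; apply/eqP/dot_def; apply/eqP; rewrite eq_le dot_ge0 andbT.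
rewrite -/(nsq _) nsqB nsqZ nsq_en mulr1 dotZr -/c [c^* * c]mulrC mul_conjc /=.
lra.
Qed.

(** The spectrum is read off from the group: the frequencies whose exponential is an eigenvector
    with the matching phase. Orthogonality and the invariance of the orthogonal complement follow
    from this directly. *)
Let L : set R := [set l | forall t, V t (en l) = expi (2 * pi * l * t) *: en l].

Let ort l m : L l -> L m -> dot (en l) (en m) = (l == m)%:R.
Proof.
move=> Ll Lm; have [<-|lm] := eqVneq l m; first by rewrite dotff nsq_en.
have lm0 : l - m != 0 by rewrite subr_eq0.
(* At this time the two phases differ by pi, so unitarity equates the inner product with its
   opposite. *)
pose t := (2 * (l - m))^-1.
have := ugdot VV t (en l) (en m).
rewrite Ll Lm dotZl dotZr mulrA conj_expi -expiD.
rewrite (_ : _ + _ = pi) ?expi_pi; last by rewrite /t; field.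
by rewrite mulN1r => /esym/eqP; rewrite -addr_eq0 -mulr2n mulrn_eq0 /= => /eqP.
Qed.

Hypothesis fO : fine_cells O.

Let total_L : total L en.
Proof.
move=> f f0; apply: contrapT => fn0.
have [F [UF Foo]] := @ultraFilterLemma _ (\oo : set_system nat) _.
(* The orthogonal complement of the exponentials with frequency in [L], to which [eigenvector_ex] is
   applied. *)
pose N u := forall l, L l -> dot u (en l) = 0.
have [| | | |v [Nv v0 [sigma hv]]] := @eigenvector_ex R (l2space O) V VV
  (poincare_local_translations UO fO) F UF Foo N.
- by move=> c g h Ng Nh l Ll; rewrite dotDl dotZl Ng// Nh// mulr0 addr0.
- by move=> t g Ng l Ll; rewrite (ug_adj VV) Ll dotZr Ng// mulr0.
- move=> G u w PG uw Nu l Ll; apply: complex_eqP.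
    have h : Re (dot (u n) (en l)) @[n --> G] --> Re (dot w (en l)) by exact: hcvg_dotl.
    apply: (cvg_unique (@Rhausdorff R) h).
    have -> : (fun n => Re (dot (u n) (en l))) = (fun=> 0).
      by apply/funext => n; rewrite (Nu n l Ll).
    exact: cvg_cst.
  have h : Im (dot (u n) (en l)) @[n --> G] --> Im (dot w (en l)) by exact: hcvg_dotl_Im.
  apply: (cvg_unique (@Rhausdorff R) h).
  have -> : (fun n => Im (dot (u n) (en l))) = (fun=> 0).
      by apply/funext => n; rewrite (Nu n l Ll).
    exact: cvg_cst.
- by exists f.
have E := eigenvector_exponential hv; set l := sigma / _ in E; set c := dot _ _ in E.
have c0 : c != 0 by apply/eqP => c0; apply: v0; rewrite E c0 scale0r.
(* [v] is a nonzero multiple of [en l], so [en l] is an eigenvector and [l] is in [L]; but then [v]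
   is orthogonal to [en l], which contradicts [c0]. *)
have Ll : L l.
  move=> t; apply: (scalerI c0); rewrite -(ugZ VV) -E hv [2 * pi * _]mulrC divfK//.
  by rewrite scalerA [c * _]mulrC -scalerA -E.
exact: (elimN eqP c0 (Nv l Ll)).
Qed.

Theorem spectral_of_local_translations : spectral O.
Proof.
exists L; split=> [l m Ll Lm lm|f hf].
  rewrite -(dot_l2pi (L2_e O l) (L2_e O m)).
  by have := ort Ll Lm; rewrite (introF eqP lm).
exists (fun l => dot (l2pi O f) (en l)); apply/(has_expansionP L _ hf).
exact: total_hexp ort _ total_L.
Qed.

End converse.

(** * Finite unions of intervals *)

Theorem theorem6p8 (R : realType) (n : nat) (alpha beta : 'I_n -> R)
    (n_gt0 : (0 < n)%N)
    (alpha_lt_beta : forall i : 'I_n, alpha i < beta i)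
    (beta_lt_alpha : forall i j : 'I_n, j = i.+1 :> nat -> beta i < alpha j) :
  let Omega : set R := \bigcup_(i in [set: 'I_n]) `]alpha i, beta i[%classic in
  (forall Lambda : set R, is_spectrum Omega Lambda ->
     [/\ local_translations Omega (spectrum_group Omega Lambda),
         self_adjoint Omega (spectrum_op Omega Lambda) &
         forall t : R, is_exp_2pii Omega t (spectrum_op Omega Lambda)
                         (spectrum_group Omega Lambda t)]) /\
  ((exists U, local_translations Omega U) -> spectral Omega).
Proof.
move=> Omega.
have mF i : measurable (`]alpha i, beta i[%classic : set (measurableTypeR R)).
  exact: measurable_itv.
have mO : measurable (Omega : set (measurableTypeR R)) by apply: fin_bigcup_measurable.
(* A crude bound on all endpoints; the variance bound needs only some bounded interval containing
   [Omega]. *)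
pose M := \sum_i (`|alpha i| + `|beta i|).
have M0 : 0 <= M by rewrite sumr_ge0// => i _; rewrite addr_ge0.
have OM : (Omega : set (measurableTypeR R)) `<=` `]- M, - M + 2 * M[%classic.
  move=> x [i _] /=; rewrite !in_itv /= => /andP[h1 h2].
  have hM : `|alpha i| + `|beta i| <= M.
    by rewrite /M (bigD1 i)//= lerDl sumr_ge0// => j _; rewrite addr_ge0.
  have := ler_norm (- alpha i); have := ler_norm (beta i); rewrite normrN => h3 h4.
  have := normr_ge0 (alpha i); have := normr_ge0 (beta i) => h5 h6.
  by apply/andP; split; lra.
have Ogt0 : (0 < lebesgue_measure (Omega : set (measurableTypeR R)))%E.
  pose i0 := Ordinal n_gt0.
  apply: (@lt_le_trans _ _ (lebesgue_measure (`]alpha i0, beta i0[%classic : set R))).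
    by rewrite lebesgue_measure_itv /= lte_fin alpha_lt_beta -EFinB lte_fin subr_gt0.
  by apply: le_measure; rewrite ?inE//; move=> x xi; exists i0.
have Ofin : (lebesgue_measure (Omega : set (measurableTypeR R)) < +oo)%E.
  apply: (@le_lt_trans _ _ (lebesgue_measure (`](- M), (- M + 2 * M)[%classic : set R))).
    by apply: le_measure; rewrite ?inE//; exact: measurable_itv.
  by rewrite lebesgue_measure_itv; case: ifP => // _; rewrite -EFinB ltry.
pose O := Domain mO Ogt0 Ofin.
split=> [Lambda spL|[U UO]].
  split.
  - exact: (@spectrum_group_local_translations R O Lambda spL).
  - exact: (@spectrum_op_self_adjoint R O Lambda spL).
  - exact: (@spectrum_group_exp R O Lambda spL).
apply: (@spectral_of_local_translations R O U UO (- M) (2 * M)) => //.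
  by rewrite mulr_ge0.
exact: fine_cells_bigcup.
Qed.
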